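(* Let $\xi\in D^\uparrow$ be bounded and let $U,V\in\mathcal{FC}$. Then $$\int_{L_2^\uparrow(\xi)}\langle\mathrm DU(g),\mathrm DV(g)\rangle\,\Xi(dg)=-\int_{L_2^\uparrow(\xi)}L_0U(g)V(g)\,\Xi(dg)-\int_{L_2^\uparrow(\xi)}V(g)\langle\nabla^{L_2}U(g)-\mathrm DU(g),\xi\rangle\,\Xi(dg).$$ In particular, if $U(g)=u(\langle g,h_1\rangle,\dots,\langle g,h_m\rangle)\varphi(\|g\|_2^2)$ with $u\in C_b^\infty(\mathbb R^m)$, $\varphi\in C_0^\infty(\mathbb R)$, $h_1,\dots,h_m\in L_2(\xi)$, then $$\int_{L_2^\uparrow(\xi)}\langle\mathrm DU(g),\mathrm DV(g)\rangle\,\Xi(dg)=-\int_{L_2^\uparrow(\xi)}L_0U(g)V(g)\,\Xi(dg)-\int_{L_2^\uparrow(\xi)}\varphi(\|g\|_2^2)V(g)\sum_{j=1}^m\partial_ju(\langle g,h_1\rangle,\dots,\langle g,h_m\rangle)\,\langle h_j,\xi-\mathrm{pr}_g\xi\rangle\,\Xi(dg).$$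
   Context: Notation. $L_2=L_2[0,1]$ with inner product $\langle\cdot,\cdot\rangle$ and norm $\|\cdot\|_2$. $D^\uparrow$ is the set of càdlàg non-decreasing functions $[0,1]\to[-\infty,\infty]$ that are continuous at $1$; $L_2^\uparrow$ is the (closed) set of elements of $L_2$ having a version in $D^\uparrow$. For $g\in L_2^\uparrow$, $\sigma^\star(g)$ is the Lebesgue completion of $\sigma(g)$, $L_2(g)=\{f\in L_2: f\ \sigma^\star(g)\text{-measurable}\}$, $\mathrm{pr}_g$ is the orthogonal projection of $L_2$ onto $L_2(g)$, and $L_2^\uparrow(g)=L_2(g)\cap L_2^\uparrow$. $\xi\in D^\uparrow$ is a fixed bounded function. Measure $\Xi$. $E^n=\{x\in\mathbb R^n:x_1\le\dots\le x_n\}$ with Lebesgue measure $\lambda_n$; $E^n_0=\{x\in\mathbb R^n:x_1<\dots<x_n\}$; $Q^n=\{(q_1,\dots,q_{n-1}):0<q_1<\dots<q_{n-1}<1\}$ for $n\ge2$, with $q_0=0,q_n=1$; $\chi_n(q,x)=\sum_{i=1}^nx_i\mathbb I_{[q_{i-1},q_i)}+x_n\mathbb I_{\{1\}}$, $\chi_1(x)=x\mathbb I_{[0,1]}$. For $n\ge2$, $\Xi_n(A)=\int_{Q^n}\prod_{i=1}^n(q_i-q_{i-1})\,\lambda_n\{x\in E^n:\chi_n(q,x)\in A\}\,d\xi^{\otimes(n-1)}(q)$ (Lebesgue–Stieltjes integral with respect to $\xi(q_1)\cdots\xi(q_{n-1})$); $\Xi_1(A)=\lambda_1\{x\in\mathbb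 R:\chi_1(x)\in A\}$; $\Xi=\sum_{n\ge1}\Xi_n$, a $\sigma$-finite measure supported on $L_2^\uparrow(\xi)$. Functions and operators. $\mathcal{FC}$ is the linear span of functions $U(g)=u(\langle g,h_1\rangle,\dots,\langle g,h_m\rangle)\varphi(\|g\|_2^2)$ on $L_2^\uparrow(\xi)$ with $m\in\mathbb N$, $u\in C_b^\infty(\mathbb R^m)$ (all partial derivatives bounded), $\varphi\in C_0^\infty(\mathbb R)$ (compact support), $h_j\in L_2(\xi)$. $\nabla^{L_2}$ is the Fréchet gradient in $L_2$ and $\mathrm DU(g)=\mathrm{pr}_g[\nabla^{L_2}U(g)]$; thus for $U$ of the displayed form $\mathrm DU(g)=\varphi(\|g\|_2^2)\sum_j\partial_ju(\cdot)\,\mathrm{pr}_gh_j+2u(\cdot)\varphi'(\|g\|_2^2)g$. The operator $L_0$ is defined by $L_0U(g)=\sum_{i=1}^n\frac{1}{q_i-q_{i-1}}\frac{\partial^2}{\partial x_i^2}U(\chi_n(q,x))$ if $g=\chi_n(q,x)$ with $n\ge2$, $(q,x)\in Q^n\times E_0^n$; $L_0U(g)=\frac{d^2}{dx^2}U(\chi_1(x))$ if $g=\chi_1(x)$, $x\in\mathbb R$; and $L_0U(g)=0$ otherwise. *)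

(* Defs.v *)
From HB Require Import structures.
From mathcomp Require Import all_boot all_order all_algebra.
From mathcomp Require Import all_classical all_reals all_analysis.
From mathcomp Require Import measurable_realfun.

Set Implicit Arguments.
Unset Strict Implicit.
Unset Printing Implicit Defensive.
Import Order.TTheory GRing.Theory Num.Theory.
Import numFieldNormedType.Exports.

Local Open Scope classical_set_scope.
Local Open Scope ring_scope.
Local Open Scope quotient_scope.

Definition L2space d (T : measurableType d) (R : realType)
  (mu : {measure set T -> \bar R}) : Type := LspaceType2 mu.

HB.instance Definition _ d (T : measurableType d) (R : realType)
  (mu : {measure set T -> \bar R}) := gen_eqMixin (L2space mu).
HB.instance Definition _ d (T : measurableType d) (R : realType)
  (mu : {measure set T -> \bar R}) := gen_choiceMixin (L2space mu).

Section L2_space.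
Context d (T : measurableType d) (R : realType).
Variable mu : {measure set T -> \bar R}.
Implicit Types f g h : L2space mu.

Definition L2fun f : T -> R := (f : LspaceType2 mu).
Coercion L2fun : L2space >-> Funclass.

Lemma L2P f g : L2fun f = L2fun g %[ae mu] -> f = g.
Proof.
rewrite /L2fun => fg.
have e : LebesgueSpace.sort f = LebesgueSpace.sort g.
  by rewrite -[LHS]reprK -[RHS]reprK; apply/eqmodP/asboolP.
case: f g {fg} e => [f [[Pf]]] [g [[Pg]]] /= e.
move: Pf Pg; rewrite e => Pf Pg; congr LebesgueSpace.Pack; congr LebesgueSpace.Class.
congr isFinLebesgue.Axioms_.
exact: Prop_irrelevance.
Qed.

Lemma Lnorm_ae (f g : T -> R) : measurable_fun [set: T] f ->
  measurable_fun [set: T] g ->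
  f = g %[ae mu] -> Lnorm mu 2%:E (EFin \o f) = Lnorm mu 2%:E (EFin \o g).
Proof.
move=> mf mg fg; rewrite unlock /Lnorm; congr poweR.
apply: ae_eq_integral => //.
- apply/measurable_EFinP/(@measurableT_comp _ _ _ _ _ _ (@powR R ^~ 2)) => //.
  exact: measurableT_comp.
- apply/measurable_EFinP/(@measurableT_comp _ _ _ _ _ _ (@powR R ^~ 2)) => //.
  exact: measurableT_comp.
by apply: filterS fg => x /(_ I) fg _ /=; rewrite fg.
Qed.

Lemma L2fun_Lfun f : L2fun f \in Lfun mu 2%:E.
Proof.
rewrite inE; apply/andP; split; rewrite inE/=.
  exact: (measurable_funPT (repr (LebesgueSpace.sort f))).
case: f => f [[Pf]]; exact: Pf.
Qed.

Section of_Lfun.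
Variables (f : T -> R) (Pf : f \in Lfun mu 2%:E).

Let mfP : @measurable_fun _ _ T (measurableTypeR R) setT f.
Proof. by have := Pf; rewrite inE => /andP[]; rewrite inE. Qed.

Let mf : {mfun T >-> measurableTypeR R} := MeasurableFun.Pack
  (MeasurableFun.Class (isMeasurableFun.Build _ _ T (measurableTypeR R) f mfP)).

Let q : {mfun_ mu, T >-> measurableTypeR R} :=
  \pi_({mfun_ mu, T >-> measurableTypeR R}) mf.

Let qE : (q : T -> R) = f %[ae mu].
Proof.
have : repr q = mf %[mod {mfun_ mu, T >-> measurableTypeR R}] by rewrite reprK.
by move/eqmodP/asboolP.
Qed.

Let q_fin : finite_norm mu 2 (q : T -> R).
Proof.
rewrite /finite_norm (Lnorm_ae (measurable_funPT (repr q)) mfP qE).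
by have := Pf; rewrite inE => /andP[_]; rewrite inE.
Qed.

Definition to_L2 : L2space mu := LebesgueSpace.Pack (LebesgueSpace.Class
  (isFinLebesgue.Build d T R mu _ (lee1n 2) q q_fin)).

Lemma to_L2E : L2fun to_L2 = f %[ae mu].
Proof. exact: qE. Qed.

End of_Lfun.

Lemma Lfun0 : (fun=> 0 : R) \in Lfun mu 2%:E.
Proof. by have [] := Lfun_addr_closed mu (lee1n 2). Qed.

Lemma LfunN f : (fun x => - f x) \in Lfun mu 2%:E.
Proof. exact: (Lfun_oppr_closed (L2fun_Lfun f)). Qed.

Lemma LfunD f g : (fun x => f x + g x) \in Lfun mu 2%:E.
Proof.
have [_] := Lfun_addr_closed mu (lee1n 2).
by apply; exact: L2fun_Lfun.
Qed.

Lemma LfunZ a f : (fun x => a * f x) \in Lfun mu 2%:E.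
Proof.
have [L0 LZ] := Lfun_submod_closed mu (lee1n 2).
have := LZ a f 0 (L2fun_Lfun f) L0.
by rewrite addr0.
Qed.

Let filterS4 (P1 P2 P3 P4 Q : set T) :
  (forall x, P1 x -> P2 x -> P3 x -> P4 x -> Q x) ->
  {ae mu, forall x, P1 x} -> {ae mu, forall x, P2 x} ->
  {ae mu, forall x, P3 x} -> {ae mu, forall x, P4 x} -> {ae mu, forall x, Q x}.
Proof.
move=> PQ h1 h2; apply: filterS3 (filterI h1 h2) => x []; exact: PQ.
Qed.

Let filterS5 (P1 P2 P3 P4 P5 Q : set T) :
  (forall x, P1 x -> P2 x -> P3 x -> P4 x -> P5 x -> Q x) ->
  {ae mu, forall x, P1 x} -> {ae mu, forall x, P2 x} ->
  {ae mu, forall x, P3 x} -> {ae mu, forall x, P4 x} ->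
  {ae mu, forall x, P5 x} -> {ae mu, forall x, Q x}.
Proof.
move=> PQ h1 h2; apply: filterS4 (filterI h1 h2) => x []; exact: PQ.
Qed.

Definition L2zero := to_L2 Lfun0.
Definition L2opp f := to_L2 (LfunN f).
Definition L2add f g := to_L2 (LfunD f g).
Definition L2scale a f := to_L2 (LfunZ a f).

Lemma L2addA : associative L2add.
Proof.
move=> f g h; apply: L2P.
have := to_L2E (LfunD f (L2add g h)); have := to_L2E (LfunD g h).
have := to_L2E (LfunD (L2add f g) h); have := to_L2E (LfunD f g).
apply: filterS4 => x /(_ I) h1 /(_ I) h2 /(_ I) h3 /(_ I) h4 _.
by rewrite h2 h4 [L2fun (L2add f g) x]h1 [L2fun (L2add g h) x]h3 addrA.
Qed.

Lemma L2addC : commutative L2add.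
Proof.
move=> f g; apply: L2P.
have := to_L2E (LfunD g f); have := to_L2E (LfunD f g).
by apply: filterS2 => x /(_ I) h1 /(_ I) h2 _; rewrite h1 h2 addrC.
Qed.

Lemma L2add0 : left_id L2zero L2add.
Proof.
move=> f; apply: L2P.
have := to_L2E (LfunD L2zero f); have := to_L2E Lfun0.
by apply: filterS2 => x /(_ I) h1 /(_ I) h2 _; rewrite h2 [L2fun L2zero x]h1 add0r.
Qed.

Lemma L2addN : left_inverse L2zero L2opp L2add.
Proof.
move=> f; apply: L2P.
have := to_L2E (LfunD (L2opp f) f); have := to_L2E Lfun0.
have := to_L2E (LfunN f).
apply: filterS3 => x /(_ I) h1 /(_ I) h2 /(_ I) h3 _.
by rewrite h3 h2 [L2fun (L2opp f) x]h1 addNr.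
Qed.

Lemma L2scaleA a b f : L2scale a (L2scale b f) = L2scale (a * b) f.
Proof.
apply: L2P.
have := to_L2E (LfunZ a (L2scale b f)); have := to_L2E (LfunZ b f).
have := to_L2E (LfunZ (a * b) f).
apply: filterS3 => x /(_ I) h1 /(_ I) h2 /(_ I) h3 _.
by rewrite h3 [L2fun (L2scale b f) x]h2 h1 mulrA.
Qed.

Lemma L2scale1 : left_id 1 L2scale.
Proof.
move=> f; apply: L2P; have := to_L2E (LfunZ 1 f).
by apply: filterS => x /(_ I) h1 _; rewrite h1 mul1r.
Qed.

Lemma L2scaleDr : right_distributive L2scale L2add.
Proof.
move=> a f g; apply: L2P.
have := to_L2E (LfunZ a (L2add f g)); have := to_L2E (LfunD f g).
have := to_L2E (LfunZ a g); have := to_L2E (LfunZ a f).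
have := to_L2E (LfunD (L2scale a f) (L2scale a g)).
apply: filterS5 => x /(_ I) h1 /(_ I) h2 /(_ I) h3 /(_ I) h4 /(_ I) h5 _.
rewrite h1 h5 [L2fun (L2scale a f) x]h2 [L2fun (L2scale a g) x]h3.
by rewrite [L2fun (L2add f g) x]h4 mulrDr.
Qed.

Lemma L2scaleDl f : {morph L2scale^~ f : a b / a + b >-> L2add a b}.
Proof.
move=> a b; apply: L2P.
have := to_L2E (LfunZ (a + b) f); have := to_L2E (LfunZ a f).
have := to_L2E (LfunZ b f).
have := to_L2E (LfunD (L2scale a f) (L2scale b f)).
apply: filterS4 => x /(_ I) h1 /(_ I) h2 /(_ I) h3 /(_ I) h4 _.
by rewrite h4 h1 [L2fun (L2scale a f) x]h3 [L2fun (L2scale b f) x]h2 mulrDl.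
Qed.

HB.instance Definition _ := GRing.isZmodule.Build (L2space mu)
  L2addA L2addC L2add0 L2addN.
HB.instance Definition _ := GRing.Zmodule_isLmodule.Build R (L2space mu)
  L2scaleA L2scale1 L2scaleDr L2scaleDl.

Lemma L2D f g : L2fun (f + g) = (fun x => f x + g x) %[ae mu].
Proof. exact: to_L2E. Qed.

Lemma L2Z a f : L2fun (a *: f) = (fun x => a * f x) %[ae mu].
Proof. exact: to_L2E. Qed.

Definition L2norm f := fine (Lnorm mu 2%:E (EFin \o f)).

Lemma L2fun_measurable f : measurable_fun [set: T] f.
Proof. by have := L2fun_Lfun f; rewrite inE => /andP[]; rewrite inE. Qed.

Lemma L2norm_fin f : (L2norm f)%:E = Lnorm mu 2%:E (EFin \o f).
Proof.
rewrite /L2norm fineK// ge0_fin_numE ?Lnorm_ge0//.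
by have := L2fun_Lfun f; rewrite inE => /andP[_]; rewrite inE.
Qed.

Lemma L2norm_ler f g : L2norm (f + g) <= L2norm f + L2norm g.
Proof.
rewrite -lee_fin EFinD !L2norm_fin.
rewrite (@Lnorm_ae _ (f \+ g) (L2fun_measurable _) _ (L2D f g)).
  by apply: eminkowski => //; [exact: L2fun_measurable..|exact: lee1n].
by apply: measurable_funD; exact: L2fun_measurable.
Qed.

Lemma L2normZ a f : L2norm (a *: f) = `|a| * L2norm f.
Proof.
apply: EFin_inj; rewrite EFinM !L2norm_fin.
rewrite (@Lnorm_ae _ (a \*: L2fun f) (L2fun_measurable _) _ (L2Z a f)).
  exact: (LnormZ (Lfun_Sub (lee1n 2) (L2fun_Lfun f))).
by apply: measurable_funM => //; exact: L2fun_measurable.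
Qed.

Lemma L2norm_eq0 f : L2norm f = 0 -> f = 0.
Proof.
move=> f0; apply: L2P.
have := @fine_Lnormr_eq0 _ _ _ mu _ (lee1n 2) (Lfun_Sub (lee1n 2) (L2fun_Lfun f)) f0.
have := to_L2E Lfun0.
by apply: filterS2 => x /(_ I) f1 /(_ I) f2 _; exact: etrans f2 (esym f1).
Qed.

HB.instance Definition _ := Lmodule_isNormed.Build R (L2space mu)
  L2norm_ler L2normZ L2norm_eq0.

End L2_space.

HB.instance Definition _ d (T : measurableType d) (R : realType)
  (mu : {measure set T -> \bar R}) := Measurable.copy (L2space mu)
  (g_sigma_algebraType (@open (L2space mu))).

Definition dot d (T : measurableType d) (R : realType)
    (mu : {measure set T -> \bar R}) (f g : L2space mu) : R :=
  \int[mu]_t (f t * g t).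

(* Lebesgue measure on [0, 1], as a measure on the whole line that ignores
   everything outside [0, 1]. *)
Definition leb01 (R : realType) : {measure set (measurableTypeR R) -> \bar R} :=
  mrestr lebesgue_measure (measurable_itv `[(0 : R), 1]).

Notation L2 R := (L2space (leb01 R)).

Lemma bounded_Lfun (R : realType) (f : R -> R) (M : R) :
  measurable_fun [set: measurableTypeR R] f -> (forall t, `|f t| <= M) ->
  f \in Lfun (leb01 R) 2%:E.
Proof.
move=> mf fM; rewrite inE; apply/andP; split; rewrite inE//=.
have M0 : 0 <= M by apply: le_trans (fM 0).
rewrite /finite_norm unlock poweR_lty//=.
apply: (@le_lt_trans _ _ (\int[leb01 R]_x (cst (M `^ 2)%:E x))%E).
  apply: ge0_le_integral => //=.
  - apply/measurable_EFinP/(@measurableT_comp _ _ _ _ _ _ (@powR R ^~ 2)) => //.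
    exact: measurableT_comp.
  - by move=> x _; rewrite lee_fin ge0_ler_powR// nnegrE.
rewrite integral_cst// lte_mul_pinfty ?lee_fin ?powR_ge0//.
rewrite [ltLHS]/= /mrestr setTI lebesgue_measure_itv/= lte_fin ltr01.
by rewrite -EFinD ltry.
Qed.

(* Only the restriction of f to [0, 1] matters. *)
Definition Dup (R : realType) : set (R -> \bar R) := [set f |
  [/\ {in `[0, 1] &, {homo f : s t / s <= t >-> (s <= t)%E}},
      {in `[0, 1[, forall t, f s @[s --> t^'+] --> f t},
      {in `]0, 1], forall t, cvg (f s @[s --> t^'-])} &
      f s @[s --> 1^'-] --> f 1]].

Definition L2up (R : realType) : set (L2 R) :=
  [set g | exists2 f : R -> \bar R, Dup f & EFin \o g = f %[ae leb01 R]].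

(* The sets of [0, 1] that differ from a set of the sigma-algebra generated by
   the restriction of g to [0, 1] by a subset of a Lebesgue-null Borel set. This
   does not depend on the version of g. *)
Definition sigma_star (R : realType) (g : R -> R) : set (set R) :=
  [set A | A `<=` `[0, 1] /\
    exists2 B, preimage_set_system `[0, 1] g (@measurable _ (measurableTypeR R)) B &
      (leb01 R).-negligible (A `+` B)].

Definition L2_of (R : realType) (g : L2 R) : set (L2 R) :=
  [set f | forall Y : set (measurableTypeR R), measurable Y ->
    sigma_star g (`[0, 1] `&` f @^-1` Y)].

Definition L2up_of (R : realType) (g : L2 R) : set (L2 R) :=
  L2_of g `&` @L2up R.

Definition pr (R : realType) (g h : L2 R) : L2 R :=
  get [set p | L2_of g p /\ forall f, L2_of g f -> dot (h - p) f = 0].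

Definition grad (R : realType) (U : L2 R -> R) (g : L2 R) : L2 R :=
  get [set v | differentiable U g /\ forall h, 'd U g h = dot v h].

Definition Dgrad (R : realType) (U : L2 R -> R) (g : L2 R) : L2 R :=
  pr g (grad U g).

Record bddDup (R : realType) := BddDup {
  bddDup_fun :> R -> \bar R;
  bddDupP : Dup bddDup_fun;
  bddDup_bounded :
    exists M : R, {in `[0, 1], forall t, (`|bddDup_fun t| <= M%:E)%E} }.

Section bddDup_theory.
Variables (R : realType) (xi : bddDup R).

(* xi extended by the constants xi 0 and xi 1 on the left and on the right, so
   that its Lebesgue-Stieltjes measure lives on ]0, 1[. *)
Definition ext01 (t : R) : R := fine (xi (Num.max 0 (Num.min t 1))).

Let clamp_in (t : R) : Num.max 0 (Num.min t 1) \in `[0, 1].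
Proof.
by rewrite in_itv/= le_max lexx/= ge_max ler01/= ge_min lexx orbT.
Qed.

Let xi_fin t : t \in `[0, 1] -> xi t \is a fin_num.
Proof.
move=> t01; have [M /(_ t t01) h] := bddDup_bounded xi.
by rewrite fin_num_abs (le_lt_trans h) ?ltry.
Qed.

Lemma ext01_nd : nondecreasing ext01.
Proof.
move=> s t st; rewrite /ext01 fine_le// ?xi_fin//.
have [h _ _ _] := bddDupP xi; apply: h => //.
by rewrite le_max2// le_min2.
Qed.

Lemma ext01_rc : right_continuous ext01.
Proof.
move=> x; have [x0|x0] := ltP x 0.
  have -> : ext01 x = fine (xi 0).
    by rewrite /ext01 min_l ?max_l ?ltW// (lt_trans x0).
  apply: (@cvg_trans _ (cst (fine (xi 0)) @ x^'+)); last exact: cvg_cst.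
  apply: near_eq_cvg; near=> y.
  have y0 : y < 0 by near: y; exact: nbhs_right_lt.
  by rewrite /ext01 min_l ?max_l ?ltW// (lt_trans y0).
have [x1|x1] := ltP x 1; last first.
  have -> : ext01 x = fine (xi 1) by rewrite /ext01 min_r// max_r.
  apply: (@cvg_trans _ (cst (fine (xi 1)) @ x^'+)); last exact: cvg_cst.
  apply: near_eq_cvg; near=> y.
  have y1 : x < y by near: y; exact: nbhs_right_gt.
  by rewrite /ext01 min_r ?max_r// (le_trans x1)// ltW.
have -> : ext01 x = fine (xi x) by rewrite /ext01 min_l ?max_r// ltW.
apply: (@cvg_trans _ ((fine \o xi) @ x^'+)).
  apply: near_eq_cvg; near=> y.
  have xy : x < y by near: y; exact: nbhs_right_gt.
  have y1 : y < 1 by near: y; exact: nbhs_right_lt.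
  by rewrite /ext01 min_l ?max_r ?ltW// (le_lt_trans x0).
apply: fine_cvg; rewrite fineK ?xi_fin ?in_itv/= ?x0 ?ltW//.
by have [_ h _ _] := bddDupP xi; apply: h; rewrite in_itv/= x0.
Unshelve. all: by end_near. Qed.

HB.instance Definition _ := isCumulative.Build R _ R ext01 ext01_nd ext01_rc.

Lemma ext01_Lfun : ext01 \in Lfun (leb01 R) 2%:E.
Proof.
have [M xiM] := bddDup_bounded xi.
apply: (@bounded_Lfun _ _ M) => [|t].
  by apply: nondecreasing_measurable => //; exact: ext01_nd.
have := xiM _ (clamp_in t).
by rewrite -(fineK (xi_fin (clamp_in t))) lee_fin.
Qed.

Definition bddDup_L2 : L2 R := to_L2 ext01_Lfun.

End bddDup_theory.

Section tuple_measure.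
Context d (T : measurableType d) (R : realType) (mu : set T -> \bar R).

(* For n = 0, the unit mass on the one-point space 0.-tuple T. *)
Fixpoint tuple_measure (n : nat) : set (n.-tuple T) -> \bar R :=
  match n with
  | 0%N => dirac [tuple]
  | n'.+1 => pushforward (mu \x @tuple_measure n')%E
               (fun p => [tuple of p.1 :: p.2])
  end.

End tuple_measure.
Arguments tuple_measure {d T R} mu n _.

Definition En (R : realType) (n : nat) : set (n.-tuple R) :=
  [set x | sorted <=%R x].
Definition En0 (R : realType) (n : nat) : set (n.-tuple R) :=
  [set x | sorted <%R x].

(* Step functions with n + 1 steps are indexed by n : the tuple q holds the n
   interior knots, so that Qn n stands for Q^(n+1), and Qn 0 is a singleton. *)
Definition Qn (R : realType) (n : nat) : set (n.-tuple R) :=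
  [set q | sorted <%R (0 :: rcons q 1)].
Arguments En {R} n _.
Arguments En0 {R} n _.
Arguments Qn {R} n _.

Definition knot (R : realType) (n : nat) (q : n.-tuple R) (i : nat) : R :=
  nth 0 (0 :: rcons q 1) i.

Definition gap (R : realType) (n : nat) (q : n.-tuple R) (i : nat) : R :=
  knot q i.+1 - knot q i.

Definition stepf (R : realType) (n : nat) (q : n.-tuple R) (x : n.+1.-tuple R)
    (t : R) : R :=
  \sum_(i < n.+1) tnth x i * \1_`[knot q i, knot q i.+1[ t
  + tnth x ord_max * \1_[set 1] t.

Lemma stepf_Lfun (R : realType) (n : nat) (q : n.-tuple R) (x : n.+1.-tuple R) :
  stepf q x \in Lfun (leb01 R) 2%:E.
Proof.
apply: (@bounded_Lfun _ _ (\sum_(i < n.+1) `|tnth x i| + `|tnth x ord_max|)).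
  have mI (a : R) (A : set (measurableTypeR R)) : measurable A ->
      measurable_fun [set: measurableTypeR R] (fun t => a * \1_A t).
    by move=> mA; apply: measurable_funM => //; apply: measurable_indic.
  apply: measurable_funD; last exact: mI.
  by apply: measurable_sum => i; apply: mI; exact: measurable_itv.
have b (a : R) (A : set R) t : `|a * \1_A t| <= `|a|.
  by rewrite normrM indicE ler_piMr// normr_nat lern1 leq_b1.
move=> t; rewrite (le_trans (ler_normD _ _))// lerD//.
by rewrite (le_trans (ler_norm_sum _ _ _))// ler_sum.
Qed.

Definition chi (R : realType) (n : nat) (q : n.-tuple R) (x : n.+1.-tuple R) :
  L2 R := to_L2 (stepf_Lfun q x).

(* Xin xi n is the measure Xi_(n+1). For n = 0 the outer integral is over the
   one-point space, the weight is 1 and chi is the constant function, so that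
   Xin xi 0 A is the Lebesgue measure of [set x | A (chi [tuple] x)]. *)
Definition Xin (R : realType) (xi : bddDup R) (n : nat) (A : set (L2 R)) :
    \bar R :=
  (\int[tuple_measure (lebesgue_stieltjes_measure (ext01 xi)) n]_(q in Qn n)
    ((\prod_(i < n.+1) gap q i)%:E *
     tuple_measure lebesgue_measure n.+1 [set x | En n.+1 x /\ A (chi q x)]))%E.

Definition Xi (R : realType) (xi : bddDup R) (A : set (L2 R)) : \bar R :=
  (\sum_(0 <= n <oo) Xin xi n A)%E.

Definition partial (R : realType) (m : nat) (j : 'I_m) (u : 'rV[R]_m -> R) :
  'rV[R]_m -> R := 'D_(delta_mx 0 j) u.

(* s ranges over the multi-indices, the empty one included. *)
Definition Cb_smooth (R : realType) (m : nat) (u : 'rV[R]_m -> R) : Prop :=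
  forall s : seq 'I_m, let v := foldr (@partial R m) u s in
    [/\ continuous v, (forall j y, derivable v y (delta_mx 0 j)) &
       exists M, forall y, `|v y| <= M].

Definition C0_smooth (R : realType) (phi : R -> R) : Prop :=
  (forall n t, derivable (derive1n n phi) t 1) /\
  compact (closure [set t | phi t != 0]).

Definition coords (R : realType) (m : nat) (h : 'I_m -> L2 R) (g : L2 R) :
  'rV[R]_m := \row_j dot g (h j).

(* The functions of FC are given by formulas that make sense on all of L2; they
   are taken on L2, where their Frechet gradient is computed. *)
Definition cylf (R : realType) (m : nat) (u : 'rV[R]_m -> R) (phi : R -> R)
    (h : 'I_m -> L2 R) (g : L2 R) : R :=
  u (coords h g) * phi (`|g| ^+ 2).

Definition cyl (R : realType) (xi : L2 R) : set (L2 R -> R) :=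
  [set U | exists m (u : 'rV[R]_m -> R) (phi : R -> R) (h : 'I_m -> L2 R),
    [/\ Cb_smooth u, C0_smooth phi, (forall j, L2_of xi (h j)) &
        U = cylf u phi h]].

Definition FC (R : realType) (xi : L2 R) : set (L2 R -> R) :=
  [set U | exists k (a : 'I_k -> R) (F : 'I_k -> L2 R -> R),
    (forall i, cyl xi (F i)) /\ U = (fun g => \sum_(i < k) a i * F i g)].

Definition upd (R : realType) (n : nat) (x : n.-tuple R) (i : 'I_n) (s : R) :
    n.-tuple R :=
  [tuple if j == i then s else tnth x j | j < n].

(* A g of the form chi q x with q in Qn and x in En0 determines n, q and x, so
   that the set below has at most one element; xget yields 0 if it is empty. *)
Definition L0 (R : realType) (U : L2 R -> R) (g : L2 R) : R :=
  xget 0 [set v | exists n (q : n.-tuple R) (x : n.+1.-tuple R),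
    [/\ Qn n q, En0 n.+1 x, g = chi q x &
        v = \sum_(i < n.+1)
          (gap q i)^-1 * derive1n 2 (fun s => U (chi q (upd x i s))) (tnth x i)]].

(* Main.v *)
Require Import Defs.
From HB Require Import structures.
From mathcomp Require Import all_boot all_order all_algebra.
From mathcomp Require Import all_classical all_reals all_analysis.
From mathcomp Require Import measurable_realfun lra zify.
Import Order.TTheory GRing.Theory Num.Theory.
Import numFieldNormedType.Exports.

Set Implicit Arguments.
Unset Strict Implicit.
Unset Printing Implicit Defensive.

Local Open Scope classical_set_scope.
Local Open Scope ring_scope.

(** On the stratum of step functions with knots [q] and values [x], the gradient
    [Dgrad] is the Euclidean gradient in [x] for the weights [gap q i]. Integrating
    by parts in each [x_i] over the ordered cone turns the sum of the first two
    integrals into boundary terms on the faces [x_j = x_(j+1)]. On such a face the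
    knot between the two merged steps no longer affects the function, so it can be
    integrated out against d xi: the two boundary terms of the face combine to
    [\int (dot G 1_[a, r[ - (r - a) m) d xi (r)], where [G] is the gradient of [U],
    [a] the left end of the merged step and [m] the mean of [G] on it. By Fubini
    this is minus the integral of [(G - m) xi] over the merged step, and summing
    over the steps gives [- dot (G - pr g G) xi]. So the boundary terms of the
    stratum with [n + 1] knots are the remainder term of the stratum with [n]
    knots, and the identity follows by summing over [n].

    The convergence of all the series comes from the bound of the mass of a ball of
    [L2] in each stratum by a Gaussian integral of small variance. *)

(** [Dgrad], [L0] and [pr] are given by choice operators, and they are evaluated here only at step
    functions with strictly increasing values; the domain of integration moreover asks for
    measurability with respect to [xi], which holds when no knot lies in an open interval on which
    [xi] is constant. All integrals are therefore moved to the set [core] of such functions. It has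
    full measure and is a countable union of compact images of parameter sets, which gives
    measurability without a measurable inverse of the parametrization.

    In the parameters (q, x) the integrands contain 1 / gap, which is singular where a step
    collapses. Inside a stratum the singularity cancels, because the squared norm of a step is its
    gap. On a face it does not, and the weight [wgt] of the stratum measure removes it: multiplied
    by the jump, it leaves exactly the weight of the function with merged steps.

    The identity relates partial sums whose lengths differ by one, so each of the three series has
    to converge separately. *)

(** * Continuity and integrability of real-valued functions *)

Lemma bounded_integrable d (T : measurableType d) (R : realType)
    (mu : {measure set T -> \bar R}) (A : set T) (f : T -> R) (M : R) :
  measurable A -> (mu A < +oo)%E -> measurable_fun A f ->
  (forall t, A t -> `|f t| <= M) -> mu.-integrable A (EFin \o f).
Proof.
move=> mA Afin mf fM; apply: measurable_bounded_integrable => //.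
by exists M; split; [exact: num_real|move=> N MN t At; exact: le_trans (fM t At) (ltW MN)].
Qed.

Lemma ae_imp d (T : measurableType d) (R : realType)
    (mu : {measure set T -> \bar R}) (P Q : T -> Prop) :
  (forall t, P t -> Q t) -> {ae mu, forall t, P t} -> {ae mu, forall t, Q t}.
Proof. exact: filterS. Qed.

Section continuous_ops.
Context (R : realType) (X Y Z : topologicalType) (V : normedModType R).

Lemma continuousF_comp (f : X -> Y) (g : Y -> Z) :
  continuous f -> continuous g -> continuous (fun x => g (f x)).
Proof. by move=> cf cg x; apply: continuous_comp; [exact: cf|exact: cg]. Qed.

Lemma continuousF_pair (f : X -> Y) (g : X -> Z) :
  continuous f -> continuous g -> continuous (fun x => (f x, g x)).
Proof. by move=> cf cg x; exact: cvg_pair (cf x) (cg x). Qed.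

Lemma continuousF_fst : continuous (fst : X * Y -> X).
Proof. by move=> x; exact: cvg_fst. Qed.

Lemma continuousF_snd : continuous (snd : X * Y -> Y).
Proof. by move=> x; exact: cvg_snd. Qed.

Lemma continuousFD (f g : X -> V) :
  continuous f -> continuous g -> continuous (fun x => f x + g x).
Proof. by move=> cf cg x; exact: cvgD (cf x) (cg x). Qed.

Lemma continuousFB (f g : X -> V) :
  continuous f -> continuous g -> continuous (fun x => f x - g x).
Proof. by move=> cf cg x; exact: cvgB (cf x) (cg x). Qed.

Lemma continuousFM (f g : X -> R) :
  continuous f -> continuous g -> continuous (fun x => f x * g x).
Proof. by move=> cf cg x; exact: cvgM (cf x) (cg x). Qed.

Lemma continuousFZ (f : X -> R) (g : X -> V) :
  continuous f -> continuous g -> continuous (fun x => f x *: g x).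
Proof. by move=> cf cg x; exact: cvgZ (cf x) (cg x). Qed.

Lemma continuousF_sum I (s : seq I) (f : I -> X -> V) :
  (forall i, continuous (f i)) -> continuous (fun x => \sum_(i <- s) f i x).
Proof.
move=> cf; elim: s => [|i s IH].
  by under eq_fun do rewrite big_nil; exact: cst_continuous.
by under eq_fun do rewrite big_cons; exact: continuousFD.
Qed.

End continuous_ops.

Section real_integrable.
Context d (T : measurableType d) (R : realType).
Variables (mu : {measure set T -> \bar R}) (D : set T).
Hypothesis mD : measurable D.
Implicit Types f g : T -> R.

Lemma integrableRD f g : mu.-integrable D (EFin \o f) -> mu.-integrable D (EFin \o g) ->
  mu.-integrable D (EFin \o (fun t => f t + g t)).
Proof. by move=> mf mg; have := integrableD mD mf mg; apply: eq_integrable. Qed.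

Lemma integrableRB f g : mu.-integrable D (EFin \o f) -> mu.-integrable D (EFin \o g) ->
  mu.-integrable D (EFin \o (fun t => f t - g t)).
Proof. by move=> mf mg; have := integrableB mD mf mg; apply: eq_integrable. Qed.

Lemma integrableRZ (a : R) f : mu.-integrable D (EFin \o f) ->
  mu.-integrable D (EFin \o (fun t => a * f t)).
Proof. by move=> mf; have := integrableZl mD a mf; apply: eq_integrable. Qed.

Lemma integrableR_sum I (s : seq I) (P : pred I) (f : I -> T -> R) :
  (forall i, P i -> mu.-integrable D (EFin \o f i)) ->
  mu.-integrable D (EFin \o (fun t => \sum_(i <- s | P i) f i t)).
Proof.
move=> h; have := @integrable_sum _ _ _ mu D mD I s P (fun i => EFin \o f i) h.
by apply: eq_integrable => // t _; rewrite /= sumEFin.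
Qed.

Lemma Rintegral_sum I (s : seq I) (f : I -> T -> R) :
  (forall i, mu.-integrable D (EFin \o f i)) ->
  \int[mu]_(t in D) (\sum_(i <- s) f i t) = \sum_(i <- s) \int[mu]_(t in D) f i t.
Proof.
move=> h; elim: s => [|i s IH].
  rewrite big_nil -[RHS](mul0r (fine (mu D))) -Rintegral_cst//.
  by apply: eq_Rintegral => t _; rewrite big_nil.
rewrite big_cons -IH -RintegralD//; first by apply: eq_Rintegral => t _; rewrite big_cons.
by apply: integrableR_sum => // j _.
Qed.

End real_integrable.

(** * The Hilbert space L2 and step functions *)

Section L2_dot.
Context d (T : measurableType d) (R : realType).
Variable mu : {measure set T -> \bar R}.
Implicit Types f g h : L2space mu.

Lemma L2DE f g : {ae mu, forall t, L2fun (f + g) t = L2fun f t + L2fun g t}.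
Proof. by apply: filterS (L2D f g) => t /(_ I). Qed.

Lemma L2ZE a f : {ae mu, forall t, L2fun (a *: f) t = a * L2fun f t}.
Proof. by apply: filterS (L2Z a f) => t /(_ I). Qed.

Lemma L2BE f g : {ae mu, forall t, L2fun (f - g) t = L2fun f t - L2fun g t}.
Proof.
rewrite -scaleN1r; apply: filterS2 (L2DE f (-1 *: g)) (L2ZE (-1) g) => t -> ->.
by rewrite mulN1r.
Qed.

Lemma L2_0E : {ae mu, forall t, L2fun (0 : L2space mu) t = 0}.
Proof. by apply: filterS (to_L2E (Lfun0 mu)) => t /(_ I). Qed.

Lemma L2_sumE n (f : 'I_n -> L2space mu) :
  {ae mu, forall t, L2fun (\sum_(i < n) f i) t = \sum_(i < n) L2fun (f i) t}.
Proof.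
elim: n f => [|n IH] f.
  by apply: filterS L2_0E => t e; rewrite !big_ord0.
have IHf := IH (fun i => f (widen_ord (leqnSn n) i)).
rewrite big_ord_recr/=; set F := \sum_(i < n) _ in IHf *.
apply: filterS2 IHf (L2DE F (f ord_max)) => t e1 e2.
by rewrite e2 e1 big_ord_recr.
Qed.

Lemma ae_forall_ord n (P : 'I_n -> T -> Prop) :
  (forall i, {ae mu, forall t, P i t}) -> {ae mu, forall t, forall i, P i t}.
Proof.
elim: n P => [|n IH] P H; first by apply: filterE => t [].
apply: filterS2 (IH _ (fun i => H (lift ord0 i))) (H ord0) => t h1 h0 i.
by case: (unliftP ord0 i) => [j ->|->].
Qed.

Lemma integrable_dot f g : mu.-integrable setT (EFin \o (fun t => f t * g t)).
Proof. by apply/Lfun1_integrable/Lfun2_mul_Lfun1; exact: L2fun_Lfun. Qed.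

Lemma ae_eq_Rintegral (f g : T -> R) : measurable_fun setT f ->
  measurable_fun setT g -> f = g %[ae mu] ->
  \int[mu]_t f t = \int[mu]_t g t.
Proof.
move=> mf mg fg; congr fine; apply: ae_eq_integral => //.
- exact/measurable_EFinP.
- exact/measurable_EFinP.
- by apply: filterS fg => x /(_ I) fg _; rewrite fg.
Qed.

Lemma measurable_dot f g : measurable_fun setT (fun t => f t * g t).
Proof. by apply: measurable_funM; exact: L2fun_measurable. Qed.

Lemma dotC f g : dot f g = dot g f.
Proof. by apply: eq_Rintegral => t _; rewrite mulrC. Qed.

Lemma dotDl f g h : dot (f + g) h = dot f h + dot g h.
Proof.
rewrite /dot -RintegralD//; [|exact: integrable_dot..].
apply: ae_eq_Rintegral; first exact: measurable_dot.
  by apply: measurable_funD; exact: measurable_dot.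
by apply: filterS (L2D f g) => x /(_ I) e _; rewrite e mulrDl.
Qed.

Lemma dotZl a f g : dot (a *: f) g = a * dot f g.
Proof.
rewrite /dot -RintegralZl//; last exact: integrable_dot.
apply: ae_eq_Rintegral; first exact: measurable_dot.
  by apply: measurable_funM => //; exact: measurable_dot.
by apply: filterS (L2Z a f) => x /(_ I) e _; rewrite e mulrA.
Qed.

Lemma dotDr h f g : dot h (f + g) = dot h f + dot h g.
Proof. by rewrite !(dotC h) dotDl. Qed.

Lemma dotZr a f g : dot f (a *: g) = a * dot f g.
Proof. by rewrite !(dotC f) dotZl. Qed.

Lemma dot0l f : dot 0 f = 0.
Proof. by rewrite -(scale0r (0 : L2space mu)) dotZl mul0r. Qed.

Lemma dot0r f : dot f 0 = 0.
Proof. by rewrite dotC dot0l. Qed.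

Lemma dotNl f g : dot (- f) g = - dot f g.
Proof. by rewrite -scaleN1r dotZl mulN1r. Qed.

Lemma dotNr f g : dot f (- g) = - dot f g.
Proof. by rewrite dotC dotNl dotC. Qed.

Lemma dotBl f g h : dot (f - g) h = dot f h - dot g h.
Proof. by rewrite dotDl dotNl. Qed.

Lemma dotBr f g h : dot h (f - g) = dot h f - dot h g.
Proof. by rewrite dotDr dotNr. Qed.

Lemma dot_suml I (r : seq I) (P : pred I) (F : I -> L2space mu) g :
  dot (\sum_(i <- r | P i) F i) g = \sum_(i <- r | P i) dot (F i) g.
Proof. by elim/big_rec2: _ => [|i y x _ <-]; rewrite ?dot0l ?dotDl. Qed.

Lemma dot_sumr I (r : seq I) (P : pred I) (F : I -> L2space mu) g :
  dot g (\sum_(i <- r | P i) F i) = \sum_(i <- r | P i) dot g (F i).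
Proof. by elim/big_rec2: _ => [|i y x _ <-]; rewrite ?dot0r ?dotDr. Qed.

Lemma dot_norm f : dot f f = `|f| ^+ 2.
Proof.
have e : `|f| = L2norm f by [].
rewrite e; apply: EFin_inj.
rewrite -powR_mulrn ?fine_ge0 ?Lnorm_ge0// -poweR_EFin L2norm_fin powR_Lnorm//.
rewrite /dot /Rintegral fineK; last exact: integrable_fin_num (integrable_dot f f).
by apply: eq_integral => x _; rewrite /= ?poweR_EFin powR_mulrn// real_normK ?num_real// -expr2.
Qed.

Lemma dot_ge0 f : 0 <= dot f f.
Proof. by rewrite dot_norm sqr_ge0. Qed.

Lemma cauchy_schwarz f g : `|dot f g| <= `|f| * `|g|.
Proof.
have [->|g0] := eqVneq g 0; first by rewrite dot0r normr0 normr0 mulr0.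
(* Expanding the squared norm of |g|^2 f - <f, g> g leaves |g|^2 times the difference of the two
   sides. *)
have gn0 : 0 < `|g| by rewrite normr_gt0.
have := dot_ge0 (dot g g *: f - dot f g *: g).
rewrite !(dotBl, dotBr, dotZl, dotZr) (dotC g f) !dot_norm => H.
rewrite -(@ler_pXn2r _ 2) ?nnegrE ?mulr_ge0 // exprMn real_normK ?num_real//.
have : 0 <= `|g| ^+ 2 * (`|f| ^+ 2 * `|g| ^+ 2 - dot f g ^+ 2).
  by apply: le_trans H _; rewrite le_eqVlt; apply/orP; left; apply/eqP; lra.
by rewrite pmulr_rge0 ?exprn_gt0// subr_ge0.
Qed.

Lemma dot_eq f g : (forall h, dot f h = dot g h) -> f = g.
Proof.
move=> fg; apply/subr0_eq/eqP; rewrite -normr_eq0 -sqrf_eq0 -dot_norm.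
by rewrite dotBl fg subrr.
Qed.

Lemma dot_continuous : continuous (fun p : L2space mu * L2space mu => dot p.1 p.2 : R).
Proof.
move=> [f g] /=; apply/cvgrPdist_lt => e e0.
pose M := `|f| + `|g| + 1.
have M0 : 0 < M by rewrite /M; have := normr_ge0 f; have := normr_ge0 g; lra.
have d0 : 0 < Num.min 1 (e / (2 * M)) by rewrite lt_min ltr01 divr_gt0// mulr_gt0.
have : \forall p \near (f, g), `|f - p.1| < Num.min 1 (e / (2 * M)) /\
    `|g - p.2| < Num.min 1 (e / (2 * M)).
  exists (ball f (Num.min 1 (e / (2 * M))), ball g (Num.min 1 (e / (2 * M)))) => /=.
    by split; exact: nbhsx_ballx.
  by case=> a b /= [ha hb]; split; rewrite -?ball_normE in ha hb.
apply: filterS => -[f' g'] /= [].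
rewrite !lt_min => /andP[f1 f2] /andP[g1 g2].
have -> : dot f g - dot f' g' = dot (f - f') g + dot f' (g - g').
  by rewrite !(dotBl, dotBr); lra.
apply: le_lt_trans (ler_normD _ _) _.
apply: le_lt_trans (lerD (cauchy_schwarz _ _) (cauchy_schwarz _ _)) _.
have f'M : `|f'| <= `|f| + 1.
  by rewrite -lerBlDl; apply: le_trans (lerB_dist _ _) _; rewrite distrC ltW.
have := normr_ge0 f; have := normr_ge0 g; have := normr_ge0 (f - f') => h1 h2 h3.
have := normr_ge0 (g - g') => h4.
have : `|f - f'| * `|g| + `|f'| * `|g - g'| <= (e / (2 * M)) * `|g| + (`|f| + 1) * (e / (2 * M)).
  by apply: lerD; [apply: ler_pM => //; exact: ltW|apply: ler_pM => //; exact: ltW].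
move=> /le_lt_trans; apply.
have -> : e / (2 * M) * `|g| + (`|f| + 1) * (e / (2 * M)) = (e / (2 * M)) * M by rewrite /M; lra.
by rewrite invfM mulrA mulfVK ?gt_eqF//; lra.
Qed.

End L2_dot.

Section L2_finite_measure.
Context d (T : measurableType d) (R : realType).
Variable mu : {measure set T -> \bar R}.
Hypothesis mu_lty : (mu setT < +oo)%E.
Implicit Types (h : L2space mu) (A B : set T).

Let mu_fin A : measurable A -> mu A \is a fin_num.
Proof.
move=> mA; rewrite ge0_fin_numE//; apply: le_lt_trans mu_lty.
by apply: le_measure => //; rewrite inE.
Qed.

Let mu_finI A : measurable A -> (mu A < +oo)%E.
Proof. by move=> mA; rewrite -ge0_fin_numE// mu_fin. Qed.

Lemma integrable_indicT A : measurable A -> mu.-integrable setT (EFin \o \1_A).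
Proof.
move=> mA; apply: (@bounded_integrable _ _ _ _ _ _ 1) => //.
by move=> t _; rewrite indicE normr_nat lern1 leq_b1.
Qed.

Lemma Rintegral_indic A : measurable A -> \int[mu]_t (\1_A t) = fine (mu A).
Proof. by move=> mA; rewrite /Rintegral integral_indic// setIT. Qed.

Lemma indic_Lfun A : measurable A -> (\1_A : T -> R) \in Lfun mu 2%:E.
Proof.
move=> mA; rewrite inE; apply/andP; split; rewrite inE//=.
rewrite /finite_norm unlock poweR_lty//.
apply: (@le_lt_trans _ _ (\int[mu]_x (\1_A x)%:E)%E).
  apply: ge0_le_integral => //=.
  - apply/measurable_EFinP/(@measurableT_comp _ _ _ _ _ _ (@powR R ^~ 2)) => //.
    exact: measurableT_comp.
  - by apply/measurable_EFinP.
  - move=> x _; rewrite lee_fin indicE; case: (_ \in _); rewrite ?normr1 ?powR1//.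
    by rewrite normr0 powR0// lt0r_neq0.
by rewrite integral_indic// setIT mu_finI.
Qed.

Definition indicL2 A (mA : measurable A) : L2space mu := to_L2 (indic_Lfun mA).

Lemma indicL2E A (mA : measurable A) : {ae mu, forall t, L2fun (indicL2 mA) t = \1_A t}.
Proof. by apply: filterS (to_L2E (indic_Lfun mA)) => t /(_ I). Qed.

Lemma integrable_L2 h : mu.-integrable setT (EFin \o h).
Proof.
apply/Lfun1_integrable/(Lfun_subset12 (mu_fin measurableT)); exact: L2fun_Lfun.
Qed.

Lemma dot_indicL2 h A (mA : measurable A) : dot h (indicL2 mA) = \int[mu]_(t in A) h t.
Proof.
rewrite [RHS]Rintegral_mkcond; apply: ae_eq_Rintegral.
- exact: measurable_dot.
- by apply/(measurable_restrictT _ mA); apply: measurable_funS (L2fun_measurable h).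
apply: filterS (indicL2E mA) => t -> _; rewrite patchE indicE.
by case: ifPn; rewrite ?mulr1 ?mulr0.
Qed.

Lemma dot_indicL2_indicL2 A B (mA : measurable A) (mB : measurable B) :
  dot (indicL2 mA) (indicL2 mB) = fine (mu (A `&` B)).
Proof.
have mAB : measurable (A `&` B) by exact: measurableI.
rewrite -(Rintegral_indic mAB); apply: ae_eq_Rintegral => //.
  exact: measurable_dot.
by apply: filterS2 (indicL2E mA) (indicL2E mB) => t -> -> _; rewrite indicI.
Qed.

(** The square of the difference of two indicators is the indicator of the symmetric difference. *)
Lemma indicL2_dist A B C D (mA : measurable A) (mB : measurable B) :
  measurable C -> measurable D ->
  A `\` B `|` B `\` A `<=` C `|` D ->
  `|indicL2 mA - indicL2 mB| ^+ 2 <= fine (mu C) + fine (mu D).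
Proof.
move=> mC mD CD; rewrite -dot_norm -(Rintegral_indic mC) -(Rintegral_indic mD).
rewrite -RintegralD//; [|exact: integrable_indicT..].
have mF : measurable_fun setT (fun t : T => (\1_A t - \1_B t : R) ^+ 2).
  by apply: measurable_funX; apply: measurable_funB.
have eF : (fun t => L2fun (indicL2 mA - indicL2 mB) t * L2fun (indicL2 mA - indicL2 mB) t)
    = (fun t : T => (\1_A t - \1_B t : R) ^+ 2) %[ae mu].
  by apply: filterS3 (L2BE (indicL2 mA) (indicL2 mB)) (indicL2E mA) (indicL2E mB) => t -> -> -> _.
rewrite /dot (ae_eq_Rintegral _ mF eF); last exact: measurable_dot.
apply: le_Rintegral => //.
- apply: (@bounded_integrable _ _ _ _ _ _ 1) => // t _.
  rewrite !indicE; do 2 case: (_ \in _);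
    by rewrite ?subrr ?subr0 ?sub0r ?sqrrN ?expr1n ?expr0n/= ?normr0 ?normr1.
- by apply: integrableRD => //; exact: integrable_indicT.
move=> t _; rewrite !indicE.
have H : (t \in A) != (t \in B) -> (t \in C) || (t \in D).
  have [tA|tA] := boolP (t \in A); have [tB|tB] := boolP (t \in B) => // _.
    move: tA tB => /set_mem tA /negP tB.
    have [] : (C `|` D) t by apply: CD; left; split => // /mem_set.
      by move=> /mem_set ->.
    by move=> /mem_set ->; rewrite orbT.
  move: tB tA => /set_mem tA /negP tB.
  have [] : (C `|` D) t by apply: CD; right; split => // /mem_set.
    by move=> /mem_set ->.
  by move=> /mem_set ->; rewrite orbT.
move: H; case: (t \in A); case: (t \in B); case: (t \in C); case: (t \in D) => /= H;
  by [have := H isT|lra].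
Qed.

Lemma to_L2_sum n (f : T -> R) (Pf : f \in Lfun mu 2%:E) (a : 'I_n -> R)
    (A : 'I_n -> set T) (mA : forall i, measurable (A i)) :
  {ae mu, forall t, f t = \sum_(i < n) a i * \1_(A i) t} ->
  to_L2 Pf = \sum_(i < n) a i *: indicL2 (mA i).
Proof.
move=> fE; apply: L2P.
have H1 : {ae mu, forall t, forall i : 'I_n,
    L2fun (a i *: indicL2 (mA i)) t = a i * \1_(A i) t}.
  apply: ae_forall_ord => i.
  by apply: filterS2 (L2ZE (a i) (indicL2 (mA i))) (indicL2E (mA i)) => t -> ->.
have H2 := L2_sumE (fun i => a i *: indicL2 (mA i)).
apply: filterS3 (filterI H2 fE) H1 (to_L2E Pf).
move=> t [e ft] e1 /(_ I) e3 _; rewrite e3 e ft; apply: eq_bigr => i _.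
by rewrite e1.
Qed.

End L2_finite_measure.

Section itvL2.
Variable R : realType.
Implicit Types (a b c d t : R) (g h : L2 R).

Lemma leb01_le a b : a <= b -> (leb01 R `[a, b[%classic <= (b - a)%:E)%E.
Proof.
move=> ab; rewrite [leLHS]/= /mrestr.
apply: (@le_trans _ _ (lebesgue_measure (`[a, b[%classic : set R))).
  by apply: le_measure => //; rewrite inE; [apply: measurableI|]; exact: measurable_itv.
by rewrite lebesgue_measure_itv/= lte_fin; case: ifPn => // _; rewrite lee_fin subr_ge0.
Qed.

Lemma leb01_itv a b : 0 <= a -> a <= b -> b <= 1 ->
  leb01 R `[a, b[%classic = (b - a)%:E.
Proof.
move=> a0 ab b1; rewrite [LHS]/= /mrestr setIidl; last first.
  move=> t /=; rewrite !in_itv/= => /andP[at_ tb].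
  by rewrite (le_trans a0)//= (le_trans (ltW tb)).
rewrite lebesgue_measure_itv/= lte_fin; case: ltP => // ba.
by have -> : b - a = 0 by lra.
Qed.

Lemma leb01_set1 t : leb01 R [set t] = 0%E.
Proof.
rewrite [LHS]/= /mrestr; apply/eqP; rewrite -measure_le0.
rewrite -(lebesgue_measure_set1 t); apply: le_measure => //; rewrite inE.
- by apply: measurableI => //; exact: measurable_itv.
- exact: measurable_set1.
Qed.

Lemma leb01_lty (A : set (measurableTypeR R)) : measurable A -> (leb01 R A < +oo)%E.
Proof.
move=> mA; apply: (@le_lt_trans _ _ 1%E); last exact: ltry.
rewrite [leLHS]/= /mrestr; apply: (@le_trans _ _ (lebesgue_measure (`[0, 1]%classic : set R))).
  have m01 : measurable (`[0, 1]%classic : set (measurableTypeR R)) by exact: measurable_itv.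
  by apply: le_measure => //; rewrite inE//; apply: measurableI.
by rewrite lebesgue_measure_itv/= lte_fin ltr01 -EFinD subr0.
Qed.

(** The endpoint [1] is discarded so that the half-open steps of a subdivision cover almost every
    point. *)
Lemma ae_leb01 : {ae leb01 R, forall t, t \in `[0, 1[}.
Proof.
exists (~` `[0, 1]%classic `|` [set 1]); split.
- by apply: measurableU => //; apply: measurableC; exact: measurable_itv.
- apply/eqP; rewrite -measure_le0; apply: le_trans (measureU2 _ _ _) _ => //.
    by apply: measurableC; exact: measurable_itv.
  by rewrite [X in (_ + X)%E]leb01_set1 adde0 [leLHS]/= /mrestr setICl measure0.
move=> t /= H; have [->|t1] := eqVneq t 1; first by right.
left => t01; apply: H; move: t01; rewrite /= !in_itv/= => /andP[-> /=].
by rewrite lt_neqAle t1.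
Qed.

Definition itvL2 a b : L2 R :=
  indicL2 (leb01_lty measurableT) (measurable_itv `[a, b[).

Lemma dot_itvL2_itvL2 a b c d : dot (itvL2 a b) (itvL2 c d) =
  fine (leb01 R (`[a, b[%classic `&` `[c, d[%classic)).
Proof. exact: dot_indicL2_indicL2. Qed.

Lemma norm_itvL2 a b : 0 <= a -> a <= b -> b <= 1 -> `|itvL2 a b| ^+ 2 = b - a.
Proof. by move=> a0 ab b1; rewrite -dot_norm dot_itvL2_itvL2 setIid leb01_itv. Qed.

Lemma itvL2_orth a b c d : b <= c -> dot (itvL2 a b) (itvL2 c d) = 0.
Proof.
move=> bc; rewrite dot_itvL2_itvL2 (_ : _ `&` _ = set0) ?measure0//.
rewrite -subset0 => t /=; rewrite !in_itv/= => -[/andP[_ tb] /andP[ct _]].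
by have := le_lt_trans (le_trans bc ct) tb; rewrite ltxx.
Qed.

(** The symmetric difference lies in the interval spanned by the left endpoints together with the
    one spanned by the right endpoints, whatever the order of the endpoints. Hence [chi] is
    continuous for all knots, not only for the ordered ones. *)
Lemma itvL2_dist a b a' b' :
  `|itvL2 a b - itvL2 a' b'| ^+ 2 <= `|a - a'| + `|b - b'|.
Proof.
pose I (x y : R) : set (measurableTypeR R) := `[Num.min x y, Num.max x y[%classic.
have mI x y : measurable (I x y) by exact: measurable_itv.
have LI x y : fine (leb01 R (I x y)) <= `|x - y|.
  rewrite -lee_fin fineK; last by rewrite ge0_fin_numE// leb01_lty.
  apply: le_trans (leb01_le _) _; first by rewrite ge_min le_max lexx.
  rewrite lee_fin; case: (leP x y) => xy.
    by rewrite distrC ler_norm.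
  by rewrite ler_norm.
apply: le_trans (lerD (LI a a') (LI b b')); apply: indicL2_dist => // t.
rewrite /I/= !in_itv/= !ge_min !lt_max.
case: (leP a t) => h1; case: (leP a' t) => h2; case: (ltP t b) => h3; case: (ltP t b') => h4;
  rewrite /=; by [move=> _; left|move=> _; right|move=> [[]|[]]// _ /(_ isT)].
Qed.

Lemma itvL2_continuous : continuous (fun p : R * R => itvL2 p.1 p.2).
Proof.
move=> [a b] /=; apply/cvgrPdist_lt => e e0.
have d0 : 0 < e ^+ 2 / 2 by rewrite divr_gt0// exprn_gt0.
have : \forall p \near (a, b), `|a - p.1| < e ^+ 2 / 2 /\ `|b - p.2| < e ^+ 2 / 2.
  exists (ball a (e ^+ 2 / 2), ball b (e ^+ 2 / 2)) => /=.
    by split; exact: nbhsx_ballx.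
  by case=> c d /= [hc hd]; split.
apply: filterS => -[c d] /= [hc hd].
rewrite -(@ltr_pXn2r _ 2) ?nnegrE ?normr_ge0 ?(ltW e0)//.
by apply: le_lt_trans (itvL2_dist _ _ _ _) _; lra.
Qed.

End itvL2.

Section knots.
Variable R : realType.
Implicit Types (n i j : nat).

Lemma knot0 n (q : n.-tuple R) : knot q 0 = 0. Proof. by []. Qed.

Lemma knot_last n (q : n.-tuple R) : knot q n.+1 = 1.
Proof. by rewrite /knot/= nth_rcons size_tuple ltnn eqxx. Qed.

Lemma knotS n (q : n.-tuple R) i : (i < n)%N -> knot q i.+1 = nth 0 q i.
Proof. by move=> in_; rewrite /knot/= nth_rcons size_tuple in_. Qed.

Lemma Qn_gapP n (q : n.-tuple R) : Qn n q <-> forall i, (i <= n)%N -> 0 < gap q i.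
Proof.
split=> [h i ni|h].
  rewrite /gap subr_gt0; move: h => /(sortedP 0) /(_ i); apply.
  by rewrite /= size_rcons size_tuple.
apply/(sortedP 0) => i; rewrite /= size_rcons size_tuple !ltnS => ni.
by have := h _ ni; rewrite /gap subr_gt0.
Qed.

Lemma knot_le n (q : n.-tuple R) i j : Qn n q -> (i <= j)%N -> (j <= n.+1)%N ->
  knot q i <= knot q j.
Proof.
move=> /Qn_gapP Q; elim: j => [|j IH]; first by rewrite leqn0 => /eqP ->.
rewrite leq_eqVlt => /predU1P[->//|ij] jn.
apply: le_trans (IH ij (ltnW jn)) _.
by have := Q j jn; rewrite /gap subr_gt0 => /ltW.
Qed.

Lemma knot_ge0 n (q : n.-tuple R) i : Qn n q -> (i <= n.+1)%N -> 0 <= knot q i.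
Proof. by move=> Q ni; rewrite -(knot0 q) knot_le. Qed.

Lemma knot_le1 n (q : n.-tuple R) i : Qn n q -> (i <= n.+1)%N -> knot q i <= 1.
Proof. by move=> Q ni; rewrite -(knot_last q) knot_le. Qed.

Lemma sum_gap n (q : n.-tuple R) : \sum_(i < n.+1) gap q i = 1.
Proof.
have := telescope_sumr (knot q) (leq0n n.+1).
by rewrite big_mkord knot_last knot0 subr0.
Qed.

Definition stepL2 n (q : n.-tuple R) i : L2 R := itvL2 (knot q i) (knot q i.+1).

Lemma chiE n (q : n.-tuple R) (x : n.+1.-tuple R) :
  chi q x = \sum_(i < n.+1) tnth x i *: stepL2 q i.
Proof.
apply: to_L2_sum; apply: (ae_imp _ (ae_leb01 R)) => t t1.
rewrite /stepf [X in _ + X](_ : _ = 0) ?addr0//.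
rewrite indicE memNset ?mulr0// => t11.
by move: t1; rewrite t11 in_itv/= ltxx andbF.
Qed.

Lemma dot_stepL2 n (q : n.-tuple R) i j : Qn n q -> (i <= n)%N -> (j <= n)%N ->
  dot (stepL2 q i) (stepL2 q j) = (i == j)%:R * gap q i.
Proof.
move=> Q ni nj; have [<-|ij] := eqVneq i j.
  rewrite mul1r dot_norm norm_itvL2 ?knot_ge0 ?knot_le1 ?knot_le//; exact: leqW.
rewrite mul0r; move: ij; rewrite neq_ltn => /orP[] ij.
  by apply: itvL2_orth; apply: knot_le => //; exact: leqW.
by rewrite dotC; apply: itvL2_orth; apply: knot_le => //; exact: leqW.
Qed.

Definition comb n (q : n.-tuple R) (c : 'I_n.+1 -> R) : L2 R :=
  \sum_(i < n.+1) c i *: stepL2 q i.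

Lemma chi_comb n (q : n.-tuple R) (x : n.+1.-tuple R) : chi q x = comb q (tnth x).
Proof. exact: chiE. Qed.

Lemma dot_comb_stepL2 n (q : n.-tuple R) (c : 'I_n.+1 -> R) (i : 'I_n.+1) : Qn n q ->
  dot (comb q c) (stepL2 q i) = c i * gap q i.
Proof.
move=> Q; rewrite /comb dot_suml (bigD1 i)//= big1 ?addr0 => [|j ji].
  by rewrite dotZl (dot_stepL2 Q (ltn_ord i) (ltn_ord i)) eqxx mul1r.
have ij : (j == i :> nat) = false by apply/negbTE.
by rewrite dotZl (dot_stepL2 Q (ltn_ord j) (ltn_ord i)) ij mul0r mulr0.
Qed.

Lemma norm_chi n (q : n.-tuple R) (x : n.+1.-tuple R) : Qn n q ->
  `|chi q x| ^+ 2 = \sum_(i < n.+1) gap q i * tnth x i ^+ 2.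
Proof.
move=> Q; rewrite -dot_norm [X in dot _ X]chiE dot_sumr; apply: eq_bigr => i _.
by rewrite dotZr chi_comb dot_comb_stepL2// mulrA mulrC expr2.
Qed.

Lemma norm_stepL2 n (q : n.-tuple R) i : Qn n q -> (i <= n)%N ->
  `|stepL2 q i| ^+ 2 = gap q i.
Proof. by move=> Q ni; rewrite -dot_norm dot_stepL2// eqxx mul1r. Qed.

(** Row vectors carry the topology and tuples the sigma-algebra: continuity is proved through [tup],
    and measurability follows through its right inverse [rv]. *)
Definition tup n (v : 'rV[R]_n) : n.-tuple R := [tuple v 0 i | i < n].

Lemma tnth_tup n (v : 'rV[R]_n) (i : 'I_n) : tnth (tup v) i = v 0 i.
Proof. by rewrite tnth_mktuple. Qed.

Lemma rv_continuous n (i : 'I_n) : continuous (fun v : 'rV[R]_n => v 0 i).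
Proof. by move=> v; exact: coord_continuous. Qed.

Lemma knot_continuous n i : continuous (fun v : 'rV[R]_n => knot (tup v) i).
Proof.
have [/eqP->|i0] := boolP (i == 0%N); first exact: cst_continuous.
have [k ->] : exists k, i = k.+1 by exists i.-1; rewrite prednK// lt0n.
have [kn|nk] := ltnP k n.
  rewrite (_ : (fun v => _) = fun v : 'rV[R]_n => v 0 (Ordinal kn)).
    exact: rv_continuous.
  apply/funext => v; rewrite -[LHS]/(nth 0 (rcons (tup v) 1) k) nth_rcons size_tuple kn.
  by rewrite -[k]/(nat_of_ord (Ordinal kn)) -tnth_nth tnth_tup.
(* This is the last knot 1 for [k = n] and the default value 0 beyond it. *)
rewrite (_ : (fun v => _) = fun v : 'rV[R]_n => nth 0 [:: 1] (k - n)).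
  exact: cst_continuous.
apply/funext => v; rewrite -[LHS]/(nth 0 (rcons (tup v) 1) k) nth_rcons size_tuple ltnNge nk/=.
by case: eqP => [->|/eqP nk']; rewrite ?subnn// nth_default// subn_gt0 ltn_neqAle eq_sym nk'.
Qed.

Lemma gap_continuous n i : continuous (fun v : 'rV[R]_n => gap (tup v) i).
Proof. by rewrite /gap; apply: continuousFB; exact: knot_continuous. Qed.

Lemma stepL2_continuous n i : continuous (fun v : 'rV[R]_n => stepL2 (tup v) i).
Proof.
apply: (continuousF_comp (f := fun v : 'rV[R]_n => (knot (tup v) i, knot (tup v) i.+1))
  _ (@itvL2_continuous R)).
by apply: continuousF_pair; exact: knot_continuous.
Qed.

Lemma chi_continuous n :
  continuous (fun p : 'rV[R]_n * 'rV[R]_n.+1 => chi (tup p.1) (tup p.2)).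
Proof.
rewrite (_ : (fun p => _) = fun p : 'rV[R]_n * 'rV[R]_n.+1 =>
    \sum_(i < n.+1) p.2 0 i *: stepL2 (tup p.1) i); last first.
  by apply/funext => q; rewrite chiE; apply: eq_bigr => i _; rewrite tnth_tup.
apply: continuousF_sum => i; apply: continuousFZ.
  exact: (continuousF_comp (@continuousF_snd _ _) (@rv_continuous _ i)).
exact: (continuousF_comp (@continuousF_fst _ _) (@stepL2_continuous n i)).
Qed.

End knots.

(** * Cylinder functions *)

Section differentiability.
Variable R : realType.

Lemma line_is_derive (V : normedModType R) (f : V -> R) (g a : V) (s : R) :
  derivable f (g + s *: a) a ->
  is_derive s 1 (fun t : R => f (g + t *: a)) ('D_a f (g + s *: a)).
Proof.
move=> df; set F := fun t : R => f (g + t *: a).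
have e : (fun h : R => h^-1 *: ((F \o shift s) (h *: 1) - F s)) =
         (fun h : R => h^-1 *: ((f \o shift (g + s *: a)) (h *: a) - f (g + s *: a))).
  apply/funext => h; rewrite /F/= ; congr (_ *: (f _ - _)).
  by rewrite [h *: 1]mulr1 scalerDl addrCA.
by split; rewrite /derivable/derive ?e.
Qed.

Lemma mvt_bound (f df : R -> R) (M : R) (t : R) :
  (forall s : R, is_derive s 1 f (df s)) -> (forall s : R, `|df s| <= M) ->
  `|f t - f 0| <= M * `|t|.
Proof.
move=> fd dM.
have cf : continuous f.
  by move=> x; apply: differentiable_continuous; apply/derivable1_diffP; have [] := fd x.
have [t0|t0] := leP 0 t.
  have [c _ ->] := MVT_segment t0 (fun x _ => fd x) (continuous_subspaceT cf).
  by rewrite subr0 normrM ler_wpM2r.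
have [c _ e] := MVT_segment (ltW t0) (fun x _ => fd x) (continuous_subspaceT cf).
by rewrite distrC e sub0r normrM normrN ler_wpM2r.
Qed.

(** The mean value theorem is applied to [f s - s * df 0], whose derivative [df s - df 0] is itself
    bounded by the first-order estimate. *)
Lemma mvt_bound2 (f df d2f : R -> R) (M : R) (t : R) :
  (forall s : R, is_derive s 1 f (df s)) -> (forall s : R, is_derive s 1 df (d2f s)) ->
  (forall s : R, `|d2f s| <= M) ->
  `|f t - f 0 - t * df 0| <= M * `|t| ^+ 2.
Proof.
move=> fd dfd dM.
have M0 : 0 <= M by apply: le_trans (dM 0).
have gd (s : R) : is_derive s 1 (fun s => f s - s * df 0) (df s - df 0).
  have h := fd s; apply: is_derive_eq.
  by rewrite ?scaler0 ?add0r; congr (_ - _); rewrite -[LHS]/(_ * _) ?mulr1.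
have cg : continuous (fun s => f s - s * df 0).
  by move=> x; apply: differentiable_continuous; apply/derivable1_diffP; have [] := gd x.
have key c : `|c| <= `|t| -> `|df c - df 0| <= M * `|t|.
  by move=> ct; apply: le_trans (mvt_bound c dfd dM) _; rewrite ler_wpM2l.
have [t0|t0] := leP 0 t.
  have [c ct e] := MVT_segment t0 (fun x _ => gd x) (continuous_subspaceT cg).
  have -> : f t - f 0 - t * df 0 = (df c - df 0) * t.
    by move: e; rewrite /= mul0r !subr0 => <-; lra.
  rewrite normrM expr2 mulrA ler_wpM2r// key//.
  by move: ct; rewrite in_itv/= => /andP[c0 ct]; rewrite !ger0_norm.
have [c ct e] := MVT_segment (ltW t0) (fun x _ => gd x) (continuous_subspaceT cg).
have -> : f t - f 0 - t * df 0 = (df c - df 0) * t.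
  by move: e; rewrite /= mul0r subr0; lra.
rewrite normrM expr2 mulrA ler_wpM2r// key//.
move: ct; rewrite in_itv/= => /andP[ct c0]; rewrite !ler0_norm ?(ltW t0)//.
by rewrite lerN2.
Qed.

(** A quadratic remainder is a little-o of the increment. The differentials of the norm and of the
    cylinder coordinates are both obtained from this criterion. *)
Lemma is_diff_quad (V : normedModType R) (f : V -> R) (L : {linear V -> R}) (x : V) (M : R) :
  continuous L -> (forall h, `|f (x + h) - f x - L h| <= M * `|h| ^+ 2) ->
  is_diff x f L.
Proof.
move=> cL Q.
have o : f \o shift x = cst (f x) + L +o_ (0 : V) id.
  apply/eqaddoP => e e0; near=> h.
  rewrite /= -![(_ + _ : _ -> _) _]/(_ + _) -![(- _ : _ -> _) _]/(- _) /cst/=.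
  rewrite opprD addrA [h + x]addrC; apply: le_trans (Q h) _.
  rewrite expr2 mulrA ler_wpM2r//.
  have : `|h| < e / (`|M| + 1).
    near: h; apply/nbhs_normP; exists (e / (`|M| + 1)) => /=.
      by rewrite divr_gt0// ltr_wpDl.
    by move=> y /=; rewrite sub0r normrN.
  rewrite ltr_pdivlMr ?ltr_wpDl// => /ltW; apply: le_trans.
  by rewrite mulrC ler_wpM2l// (le_trans (ler_norm M))// lerDl.
have dL := diff_unique cL o.
by split => //; apply/diff_locallyP; rewrite dL.
Unshelve. all: by end_near. Qed.

End differentiability.

Section Cb_smooth_diff.
Variables (R : realType) (m : nat).
Implicit Types (u v : 'rV[R]_m -> R) (y h : 'rV[R]_m) (j k : 'I_m).

Let E j : 'rV[R]_m := delta_mx 0 j.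

(** [foldr] applies the last index first, so the derivatives of [partial j u] are those of [u] along
    lists ending in [j]. *)
Lemma Cb_smooth_partial u j : Cb_smooth u -> Cb_smooth (partial j u).
Proof. by move=> su s; have := su (rcons s j); rewrite -cats1 foldr_cat. Qed.

Lemma Cb_smooth_bounded u : Cb_smooth u -> exists2 M, 0 <= M & forall y, `|u y| <= M.
Proof.
move=> /(_ [::])[_ _ [M uM]]; exists M => //.
by apply: le_trans (uM 0).
Qed.

Lemma Cb_smooth_line u y j (s : R) : Cb_smooth u ->
  is_derive s 1 (fun t : R => u (y + t *: E j)) (partial j u (y + s *: E j)).
Proof. by move=> /(_ [::])[_ du _]; apply: line_is_derive; exact: du. Qed.

Let fin_bound (F : 'I_m -> 'rV[R]_m -> R) :
  (forall j, exists2 M, 0 <= M & forall y, `|F j y| <= M) ->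
  exists2 M, 0 <= M & forall j y, `|F j y| <= M.
Proof.
move=> H; have [M HM] := choice (fun j => let: ex_intro2 M M0 FM := H j in ex_intro (fun M => 0 <= M /\ forall y, `|F j y| <= M) M (conj M0 FM)).
exists (\sum_j M j); first by apply: sumr_ge0 => j _; have [] := HM j.
move=> j y; have [_ /(_ y) h] := HM j; apply: le_trans h _.
by rewrite (bigD1 j)//= lerDl; apply: sumr_ge0 => k _; have [] := HM k.
Qed.

(** [Cb_smooth] speaks of derivatives along the axes only, so the increment is performed one
    coordinate at a time, by induction on the list of coordinates. *)
Lemma Cb_smooth_lipschitz u : Cb_smooth u -> exists2 M, 0 <= M &
  forall (s : seq 'I_m) y (h : 'I_m -> R),
    `|u (y + \sum_(j <- s) h j *: E j) - u y| <= M * \sum_(j <- s) `|h j|.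
Proof.
move=> su.
have [M M0 HM] := fin_bound (fun j => Cb_smooth_bounded (Cb_smooth_partial j su)).
exists M => //; elim=> [|k s IH] y h; first by rewrite !big_nil addr0 subrr normr0 mulr0.
rewrite !big_cons addrA.
have := mvt_bound (h k) (fun s => @Cb_smooth_line u y k s su) (fun s => HM k (y + s *: E k)).
rewrite scale0r addr0; have := IH (y + h k *: E k) h.
set A := u (_ + \sum_(_ <- _) _); set B := u (y + _ *: _); set S := \sum_(_ <- _) _ => h1 h2.
have -> : A - u y = (A - B) + (B - u y) by lra.
by apply: le_trans (ler_normD _ _) _; lra.
Qed.

(** Again one coordinate at a time. The pure second-order terms come from [mvt_bound2]; moving the
    base point changes the remaining partial derivatives by a Lipschitz amount, which produces the
    mixed terms of the square. *)
Lemma Cb_smooth_quad u : Cb_smooth u -> exists2 M, 0 <= M &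
  forall (s : seq 'I_m) y (h : 'I_m -> R),
    `|u (y + \sum_(j <- s) h j *: E j) - u y - \sum_(j <- s) h j * partial j u y|
      <= M * (\sum_(j <- s) `|h j|) ^+ 2.
Proof.
move=> su.
have [M M0 HM] : exists2 M, 0 <= M & forall k (s : seq 'I_m) y (h : 'I_m -> R),
    `|partial k u (y + \sum_(j <- s) h j *: E j) - partial k u y| <= M * \sum_(j <- s) `|h j|.
  have H k := Cb_smooth_lipschitz (Cb_smooth_partial k su).
  have [M HM] := choice (fun j => let: ex_intro2 M M0 FM := H j in ex_intro (fun M => 0 <= M /\ forall (s : seq 'I_m) y (h : 'I_m -> R), `|partial j u (y + \sum_(j <- s) h j *: E j) - partial j u y| <= M * \sum_(j <- s) `|h j|) M (conj M0 FM)).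
  exists (\sum_j M j); first by apply: sumr_ge0 => j _; have [] := HM j.
  move=> j s y h; have [_ /(_ s y h)] := HM j => /le_trans; apply.
  rewrite ler_wpM2r ?sumr_ge0//.
  by rewrite (bigD1 j)//= lerDl; apply: sumr_ge0 => k _; have [] := HM k.
have [M' M'0 HM'] : exists2 M, 0 <= M & forall j y, `|partial j (partial j u) y| <= M.
  by apply: fin_bound => j; apply: Cb_smooth_bounded; do 2 apply: Cb_smooth_partial.
exists (M + M'); first exact: addr_ge0.
elim=> [|k s IH] y h; first by rewrite !big_nil addr0 !subrr normr0 expr0n/= mulr0.
rewrite !big_cons addrA.
have := mvt_bound2 (h k) (fun s => @Cb_smooth_line u y k s su)
  (fun s => @Cb_smooth_line _ y k s (Cb_smooth_partial k su)) (fun s => HM' k (y + s *: E k)).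
rewrite scale0r addr0; have := IH (y + h k *: E k) h.
set A := u (_ + \sum_(_ <- _) _); set B := u (y + _ *: _); set S := \sum_(_ <- _) `|_|.
set P := \sum_(_ <- _) _; set Q := \sum_(_ <- _) _ => h1 h2.
have h3 : `|P - Q| <= M * `|h k| * S.
  rewrite /P /Q -sumrB; apply: le_trans (ler_norm_sum _ _ _) _.
  rewrite /S mulr_sumr; apply: ler_sum => j _; rewrite -mulrBr normrM mulrC.
  rewrite ler_wpM2r//; have := HM j [:: k] y h.
  by rewrite !big_seq1.
have S0 : 0 <= S by apply: sumr_ge0.
have -> : A - u y - (h k * partial k u y + Q) =
  (A - B - P) + (B - u y - h k * partial k u y) + (P - Q) by lra.
apply: le_trans (ler_normD _ _) _; apply: le_trans (lerD (ler_normD _ _) (lexx _)) _.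
have k0 := normr_ge0 (h k).
have kS : 0 <= `|h k| * S by exact: mulr_ge0.
have MkS : 0 <= M * (`|h k| * S) by exact: mulr_ge0.
have M'kS : 0 <= M' * (`|h k| * S) by exact: mulr_ge0.
have Mkk : 0 <= M * `|h k| ^+ 2 by rewrite mulr_ge0// sqr_ge0.
rewrite sqrrD mulrDr mulrDr; nra.
Qed.

End Cb_smooth_diff.

Section smooth_on_L2.
Variable R : realType.
Implicit Types (f g k a : L2 R).

Lemma is_diff_derive (V : normedModType R) (F dF : V -> R) (x v : V) :
  is_diff x F dF -> is_derive x v F (dF v).
Proof.
move=> [dfx <-]; split; first exact: diff_derivable.
by rewrite deriveE.
Qed.

Lemma dot_continuousl a : continuous (fun g => dot g a).
Proof.
apply: (continuousF_comp (f := fun g : L2 R => (g, a)) _ (@dot_continuous _ _ _ (leb01 R))).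
by apply: continuousF_pair; [move=> ?; exact: cvg_id|exact: cst_continuous].
Qed.

Lemma dot_linear a : linear (fun g => dot g a : R).
Proof. by move=> c f g; rewrite dotDl dotZl. Qed.

Definition sqnorm g : R := `|g| ^+ 2.

Lemma sqnormD g k : sqnorm (g + k) = sqnorm g + 2 * dot g k + sqnorm k.
Proof. by rewrite /sqnorm -!dot_norm !(dotDl, dotDr) (dotC k g); lra. Qed.

Lemma is_diff_sqnorm g : is_diff g sqnorm (fun k => 2 * dot k g).
Proof.
have lL : linear (fun k => 2 * dot k g : R).
  by move=> c x y; rewrite dotDl dotZl mulrDr mulrCA.
pose L : {linear L2 R -> R} := HB.pack (fun k : L2 R => 2 * dot k g : R) (GRing.isLinear.Build _ _ _ _ _ lL).
have cL : continuous L.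
  by apply: continuousFM; [exact: cst_continuous|exact: dot_continuousl].
apply: (@is_diff_quad _ _ _ L g 1 cL) => k.
have -> : sqnorm (g + k) - sqnorm g - L k = `|k| ^+ 2.
  by rewrite sqnormD/= (dotC k) /sqnorm; lra.
by rewrite mul1r ger0_norm.
Qed.

Lemma sqnorm_continuous : continuous sqnorm.
Proof. by move=> g; apply: differentiable_continuous; have [] := is_diff_sqnorm g. Qed.

Lemma coordsD m (h : 'I_m -> L2 R) g k :
  coords h (g + k) = coords h g + \sum_j dot k (h j) *: delta_mx 0 j.
Proof.
apply/rowP => i; rewrite !mxE summxE (bigD1 i)//= big1 ?addr0 => [|j ji].
  by rewrite !mxE !eqxx mulr1 dotDl.
by rewrite !mxE eqxx/= eq_sym (negbTE ji) mulr0.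
Qed.

(** The quadratic remainder of [u] is pulled back to L2 by Cauchy-Schwarz, which bounds the
    increment of each coordinate by [|h j|] times the norm of [k]. *)
Lemma is_diff_coords m (u : 'rV[R]_m -> R) (h : 'I_m -> L2 R) g : Cb_smooth u ->
  is_diff g (u \o coords h) (fun k => \sum_j dot k (h j) * partial j u (coords h g)).
Proof.
move=> su; have [M M0 HM] := Cb_smooth_quad su.
pose L0 (k : L2 R) : R := \sum_j dot k (h j) * partial j u (coords h g).
have lL : linear L0.
  move=> c x y; rewrite /L0 scaler_sumr -big_split; apply: eq_bigr => j _.
  by rewrite dotDl dotZl mulrDl -mulrA.
pose L : {linear L2 R -> R} := HB.pack L0 (GRing.isLinear.Build _ _ _ _ L0 lL).
have cL : continuous L.
  apply: continuousF_sum => j; apply: continuousFM; first exact: dot_continuousl.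
  exact: cst_continuous.
apply: (@is_diff_quad _ _ _ L g (M * (\sum_j `|h j|) ^+ 2) cL) => k.
have := HM (index_enum _) (coords h g) (fun j => dot k (h j)).
rewrite /= -coordsD => /le_trans; apply; rewrite -mulrA ler_wpM2l//.
rewrite -exprMn ler_pXn2r// ?nnegrE ?sumr_ge0 ?mulr_ge0 ?sumr_ge0//.
by rewrite mulr_suml ler_sum// => j _; rewrite mulrC cauchy_schwarz.
Qed.

Lemma coords_comp_continuous m (u : 'rV[R]_m -> R) (h : 'I_m -> L2 R) : Cb_smooth u ->
  continuous (fun g => u (coords h g)).
Proof.
move=> su g; apply: (@differentiable_continuous _ _ _ g (u \o coords h)).
by have [] := is_diff_coords h g su.
Qed.

Section test_function.
Variable phi : R -> R.
Hypothesis sphi : C0_smooth phi.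

Lemma C0_smooth_derivable n t : derivable (derive1n n phi) t 1.
Proof. by have [] := sphi. Qed.

Lemma C0_smooth_continuous n : continuous (derive1n n phi).
Proof.
move=> t; apply: differentiable_continuous.
by apply/derivable1_diffP; exact: C0_smooth_derivable.
Qed.

(** One radius serves all orders: on an open half-line where [phi] vanishes, so do its derivatives.
    Only a right half-line is considered, the argument being a squared norm. *)
Lemma C0_smooth_support : exists2 C, 0 <= C & forall n t, C < t -> derive1n n phi t = 0.
Proof.
have [_ /compact_bounded[M [Mreal HM]]] := sphi.
exists (`|M| + 1) => [|n]; first by rewrite addr_ge0.
elim: n => [|n IH] t Ct.
  apply/eqP/negP => /negP pt.
  have := HM (`|M| + 1) _ t; rewrite ltr_pwDr ?ler_norm//= => /(_ isT) h.
  have := h (@subset_closure _ [set t | phi t != 0] t pt).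
  by apply/negP; rewrite -ltNge (lt_le_trans Ct)// ler_norm.
rewrite derive1nS derive1E (@near_eq_derive _ _ _ _ (cst 0)) ?derive_cst//.
near=> s; apply: IH; near: s.
exact: lt_nbhsr.
Unshelve. all: by end_near. Qed.

Lemma C0_smooth_continuous0 : continuous (fun g => phi (sqnorm g)).
Proof.
apply: (continuousF_comp sqnorm_continuous).
by have := @C0_smooth_continuous 0; rewrite derive1n0.
Qed.

Lemma is_diff_test n g :
  is_diff g (derive1n n phi \o sqnorm)
    (fun k => 2 * dot k g * derive1n n.+1 phi (sqnorm g)).
Proof.
have d : is_diff (sqnorm g) (derive1n n phi) ( *:%R^~ (derive1n n.+1 phi (sqnorm g))).
  split; first by apply/derivable1_diffP; exact: C0_smooth_derivable.
  by rewrite deriv1E ?derive1nS//; exact: C0_smooth_derivable.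
exact: (is_diff_comp (is_diff_sqnorm g) d).
Qed.

Lemma C0_smooth_comp_continuous n : continuous (fun g => derive1n n phi (sqnorm g)).
Proof. exact: continuousF_comp sqnorm_continuous (@C0_smooth_continuous n). Qed.

Lemma C0_smooth_bounded n : exists2 K, 0 <= K &
  forall t, 0 <= t -> `|derive1n n phi t| <= K.
Proof.
have [C C0 HC] := C0_smooth_support.
have cf : {within `[0, C], continuous (fun t => `|derive1n n phi t|)}.
  apply: continuous_subspaceT; apply: continuousF_comp (@norm_continuous _ R).
  exact: C0_smooth_continuous.
have [c _ Hc] := EVT_max C0 cf.
exists `|derive1n n phi c| => // t t0; have [tC|Ct] := leP t C.
  by apply: Hc; rewrite in_itv/= t0.
by rewrite HC// normr0.
Qed.

End test_function.

(* [G] is the gradient of [U], and [H g a] its second derivative at [g] in the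
   direction [a]. *)
Record nice (U : L2 R -> R) (G : L2 R -> L2 R) (H : L2 R -> L2 R -> R) : Prop := Nice {
  nice_diff : forall g, is_diff g U (fun k => dot (G g) k);
  nice_derive : forall g a, is_derive g a (fun f => dot (G f) a) (H g a);
  nice_continuous : continuous G;
  nice_continuous2 : continuous (fun p : L2 R * L2 R => H p.1 p.2);
  nice_bounded : exists K C, [/\ 0 <= K, 0 <= C, forall g, `|U g| <= K,
    (forall g, `|G g| <= K) /\ (forall g a, `|H g a| <= K * `|a| ^+ 2) &
    forall g, C < sqnorm g -> [/\ U g = 0, G g = 0 & forall a, H g a = 0]] }.

Section cylinder.
Variables (m : nat) (u : 'rV[R]_m -> R) (phi : R -> R) (h : 'I_m -> L2 R).
Hypotheses (su : Cb_smooth u) (sphi : C0_smooth phi).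

Let c := coords h.
Let uj j := partial j u.
Let ujk (j k : 'I_m) := partial k (partial j u).
Let suj j : Cb_smooth (uj j). Proof. exact: Cb_smooth_partial. Qed.
Let phi1 := derive1n 1 phi.
Let phi2 := derive1n 2 phi.

Definition cylG g : L2 R := phi (sqnorm g) *: (\sum_j uj j (c g) *: h j) +
  (2 * u (c g) * phi1 (sqnorm g)) *: g.

(** The product rule applied to [cyl_dotG]: the first two terms differentiate [phi] and the partial
    derivatives of [u]; the last three differentiate [u], [phi'] and the linear factor [dot g a]. *)
Definition cylH g a : R :=
  2 * dot a g * phi1 (sqnorm g) * (\sum_j uj j (c g) * dot (h j) a) +
  phi (sqnorm g) * (\sum_j (\sum_k dot a (h k) * ujk j k (c g)) * dot (h j) a) +
  2 * ((\sum_k dot a (h k) * uj k (c g)) * phi1 (sqnorm g) * dot g a +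
       u (c g) * (2 * dot a g * phi2 (sqnorm g)) * dot g a +
       u (c g) * phi1 (sqnorm g) * dot a a).

Lemma cyl_dotG g a : dot (cylG g) a = phi (sqnorm g) * (\sum_j uj j (c g) * dot (h j) a) +
  2 * (u (c g) * phi1 (sqnorm g) * dot g a).
Proof.
rewrite /cylG dotDl !dotZl dot_suml !mulrA; congr (_ * _ + _).
by apply: eq_bigr => j _; rewrite dotZl.
Qed.

Lemma cylf_is_diff g : is_diff g (cylf u phi h) (fun k => dot (cylG g) k).
Proof.
have d1 := is_diff_coords h g su; have d2 := is_diff_test sphi 0 g.
have dd := is_diffM d1 d2; apply: (@is_diff_eq _ _ _ _ _ _ _ dd).
apply/funext => k; rewrite cyl_dotG/= -![(_ + _ : _ -> _) _]/(_ + _) -![(_ *: _ : _ -> _) _]/(_ *: _).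
rewrite -![_ *: _]/(_ * _) /=.
under eq_bigr do rewrite dotC mulrC.
by rewrite (dotC k g) /phi1 /uj /c /=; lra.
Qed.

Lemma cyl_is_derive g a : is_derive g a (fun f => dot (cylG f) a) (cylH g a).
Proof.
have -> : (fun f => dot (cylG f) a : R) =
  (derive1n 0 phi \o sqnorm) * (\sum_j (uj j \o c) * cst (dot (h j) a)) +
  (cst 2) * ((u \o c) * (phi1 \o sqnorm) * (fun f => dot f a)).
  apply/funext => f; rewrite cyl_dotG; congr (_ * _ + _).
  by rewrite fct_sumE; apply: eq_bigr => j _.
have d1 := is_diff_derive a (is_diff_coords h g su).
have d1j j := is_diff_derive a (is_diff_coords h g (suj j)).
have d2 := is_diff_derive a (is_diff_test sphi 0 g).
have d3 := is_diff_derive a (is_diff_test sphi 1 g).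
have d4 : is_derive g a (fun f => dot f a : R) (dot a a).
  pose L : {linear L2 R -> R} := HB.pack (fun k : L2 R => dot k a : R) (GRing.isLinear.Build _ _ _ _ _ (dot_linear a)).
  have dL : is_diff g L L.
    apply: (@is_diff_quad _ _ _ L g 0); first exact: dot_continuousl.
    move=> k; have -> : L (g + k) - L g - L k = 0 by rewrite /= dotDl; lra.
    by rewrite normr0 mul0r.
  exact: (is_diff_derive a dL).
have d5 j : is_derive g a ((uj j \o c) * cst (dot (h j) a : R))
    ((\sum_k dot a (h k) * ujk j k (c g)) * dot (h j) a).
  apply: is_derive_eq (is_deriveM (d1j j) (is_derive_cst (dot (h j) a : R) g a)) _.
  by rewrite scaler0 add0r -[LHS]/(_ * _) mulrC.
have d6 := is_derive_sum d5.
apply: is_derive_eq (is_deriveD (is_deriveM d2 d6) (is_deriveM (is_derive_cst (2 : R) g a)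
  (is_deriveM (is_deriveM d1 d3) d4))) _.
rewrite -![_ *: _]/(_ * _) /cylH/=.
rewrite fct_sumE -![(_ * _ : _ -> _) _]/(_ * _) /=.
rewrite -/phi1 -/phi2 -/c /uj.
have -> : \sum_(i < m) ((uj i \o c) * cst (dot (h i) a)) g = \sum_j uj j (c g) * dot (h j) a by [].
by rewrite /cst/= /uj /phi1 /phi2 /ujk /c /=; lra.
Qed.

Lemma cylG_continuous : continuous cylG.
Proof.
apply: continuousFD; apply: continuousFZ.
- exact: (C0_smooth_continuous0 sphi).
- apply: continuousF_sum => j; apply: continuousFZ; last exact: cst_continuous.
  exact: coords_comp_continuous.
- apply: continuousFM; last exact: (@C0_smooth_comp_continuous _ sphi 1).
  apply: continuousFM; first exact: cst_continuous.
  exact: coords_comp_continuous.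
- by move=> ?; exact: cvg_id.
Qed.

Lemma cylH_continuous : continuous (fun p : L2 R * L2 R => cylH p.1 p.2).
Proof.
have cc (X : topologicalType) (v : R) : continuous (fun _ : X => v) by exact: cst_continuous.
have cu v : Cb_smooth v -> continuous (fun p : L2 R * L2 R => v (c p.1)).
  move=> sv; apply: (@continuousF_comp _ _ _ (@fst (L2 R) (L2 R)) (fun g => v (c g))).
    exact: continuousF_fst.
  exact: coords_comp_continuous.
have cp n : continuous (fun p : L2 R * L2 R => derive1n n phi (sqnorm p.1)).
  apply: (@continuousF_comp _ _ _ (@fst (L2 R) (L2 R)) (fun g => derive1n n phi (sqnorm g))).
    exact: continuousF_fst.
  exact: C0_smooth_comp_continuous.
have c1 : continuous (fun p : L2 R * L2 R => dot p.1 p.2 : R) by exact: dot_continuous.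
have c2 : continuous (fun p : L2 R * L2 R => dot p.2 p.1 : R).
  by under eq_fun do rewrite dotC.
have c3 : continuous (fun p : L2 R * L2 R => dot p.2 p.2 : R).
  apply: (continuousF_comp (f := fun p : L2 R * L2 R => (p.2, p.2)) _ c1).
  by apply: continuousF_pair; exact: continuousF_snd.
have c4 (k : 'I_m) : continuous (fun p : L2 R * L2 R => dot p.2 (h k) : R).
  apply: (@continuousF_comp _ _ _ (@snd (L2 R) (L2 R)) (fun g => dot g (h k) : R)).
    exact: continuousF_snd.
  exact: dot_continuousl.
have c5 (k : 'I_m) : continuous (fun p : L2 R * L2 R => dot (h k) p.2 : R).
  by under eq_fun do rewrite dotC; exact: c4.
have csuj j := cu _ (suj j).
have csujk (j k : 'I_m) := cu _ (Cb_smooth_partial k (suj j)).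
have cs := cu _ su.
have cp0 := cp 0; rewrite derive1n0 in cp0; have cp1 := cp 1; have cp2 := cp 2.
rewrite -/phi1 in cp1; rewrite -/phi2 in cp2.
have cS1 : continuous (fun p : L2 R * L2 R => \sum_j uj j (c p.1) * dot (h j) p.2).
  by apply: continuousF_sum => j; apply: continuousFM; [exact: csuj|exact: c5].
have cS2 : continuous (fun p : L2 R * L2 R =>
    \sum_j (\sum_k dot p.2 (h k) * ujk j k (c p.1)) * dot (h j) p.2).
  apply: continuousF_sum => j; apply: continuousFM; last exact: c5.
  by apply: continuousF_sum => k; apply: continuousFM; [exact: c4|exact: csujk].
have cS3 : continuous (fun p : L2 R * L2 R => \sum_k dot p.2 (h k) * uj k (c p.1)).
  by apply: continuousF_sum => j; apply: continuousFM; [exact: c4|exact: csuj].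
have c22 : continuous (fun p : L2 R * L2 R => 2 * dot p.2 p.1 : R).
  by apply: continuousFM; [exact: cc|exact: c2].
apply: continuousFD; first apply: continuousFD.
- apply: continuousFM; last exact: cS1.
  by apply: continuousFM; [exact: c22|exact: cp1].
- by apply: continuousFM; [exact: cp0|exact: cS2].
- apply: continuousFM; first exact: cc.
  apply: continuousFD; first apply: continuousFD.
  + apply: continuousFM; last exact: c1.
    by apply: continuousFM; [exact: cS3|exact: cp1].
  + apply: continuousFM; last exact: c1.
    apply: continuousFM; first exact: cs.
    by apply: continuousFM; [exact: c22|exact: cp2].
  + apply: continuousFM; last exact: c3.
    by apply: continuousFM; [exact: cs|exact: cp1].
Qed.

Let absM (x y X Y : R) : `|x| <= X -> `|y| <= Y -> `|x * y| <= X * Y.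
Proof. by move=> xX yY; rewrite normrM ler_pM. Qed.

Let absD (x y X Y : R) : `|x| <= X -> `|y| <= Y -> `|x + y| <= X + Y.
Proof. by move=> xX yY; apply: le_trans (ler_normD _ _) _; exact: lerD. Qed.

(** [KK] is the sum of the bounds for the second derivative, the function and the gradient, so that
    one constant dominates all three. *)
Let bound_parts (B K M S : R) (KK := 2 * B * K * M * S + K * M * S * S +
    2 * (M * S * K * B + M * (2 * B * K) * B + M * K) + M * K + (K * (M * S) + 2 * M * K * B)) :
  0 <= B -> 0 <= K -> 0 <= M -> 0 <= S ->
  [/\ 0 <= KK, M * K <= KK, K * (M * S) + 2 * M * K * B <= KK &
    2 * B * K * M * S + K * M * S * S +
    2 * (M * S * K * B + M * (2 * B * K) * B + M * K) <= KK].
Proof.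
move=> B0 K0 M0 S0.
have MK := mulr_ge0 M0 K0; have MKS := mulr_ge0 MK S0; have MKB := mulr_ge0 MK B0.
have := mulr_ge0 MKS B0; have := mulr_ge0 MKS S0; have := mulr_ge0 MKB B0.
by rewrite /KK; split; lra.
Qed.

Lemma cyl_bounded : exists K C, [/\ 0 <= K, 0 <= C, forall g, `|cylf u phi h g| <= K,
    (forall g, `|cylG g| <= K) /\ (forall g a, `|cylH g a| <= K * `|a| ^+ 2) &
    forall g, C < sqnorm g -> [/\ cylf u phi h g = 0, cylG g = 0 & forall a, cylH g a = 0]].
Proof.
have [Mu Mu0 HMu] := Cb_smooth_bounded su.
have [M1 HM1] := choice (fun j => let: ex_intro2 M M0 FM := Cb_smooth_bounded (suj j) in
  ex_intro (fun M => 0 <= M /\ forall y, `|uj j y| <= M) M (conj M0 FM)).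
have [M2 HM2] := choice (fun p : 'I_m * 'I_m =>
  let: ex_intro2 M M0 FM := Cb_smooth_bounded (Cb_smooth_partial p.2 (suj p.1)) in
  ex_intro (fun M => 0 <= M /\ forall y, `|ujk p.1 p.2 y| <= M) M (conj M0 FM)).
pose M := Mu + \sum_j M1 j + \sum_p M2 p.
have s1 : 0 <= \sum_j M1 j by apply: sumr_ge0 => j _; have [] := HM1 j.
have s2 : 0 <= \sum_p M2 p by apply: sumr_ge0 => p _; have [] := HM2 p.
have M0 : 0 <= M by rewrite !addr_ge0.
have bu y : `|u y| <= M by apply: le_trans (HMu y) _; rewrite /M -addrA lerDl addr_ge0.
have buj j y : `|uj j y| <= M.
  have [_ /(_ y) /le_trans] := HM1 j; apply; rewrite /M (bigD1 j)//=.
  have : 0 <= \sum_(i < m | i != j) M1 i by apply: sumr_ge0 => k _; have [] := HM1 k.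
  by lra.
have bujk (j k : 'I_m) y : `|ujk j k y| <= M.
  have [_ /(_ y) /le_trans] := HM2 (j, k); apply; rewrite /M (bigD1 (j, k))//=.
  have : 0 <= \sum_(p | p != (j, k)) M2 p by apply: sumr_ge0 => p _; have [] := HM2 p.
  by lra.
have [K0 K00 HK0] := C0_smooth_bounded sphi 0.
have [K1 K10 HK1] := C0_smooth_bounded sphi 1.
have [K2 K20 HK2] := C0_smooth_bounded sphi 2.
rewrite derive1n0 in HK0.
pose K := K0 + K1 + K2.
have sq0 g : 0 <= sqnorm g by rewrite /sqnorm sqr_ge0.
have bp0 g : `|phi (sqnorm g)| <= K.
  by apply: le_trans (HK0 _ (sq0 g)) _; rewrite /K; lra.
have bp1 g : `|phi1 (sqnorm g)| <= K.
  by apply: le_trans (HK1 _ (sq0 g)) _; rewrite /K; lra.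
have bp2 g : `|phi2 (sqnorm g)| <= K.
  by apply: le_trans (HK2 _ (sq0 g)) _; rewrite /K; lra.
have K_ge0 : 0 <= K by rewrite /K; lra.
have [C C0 HC] := C0_smooth_support sphi.
have phi0 g : C < sqnorm g -> phi (sqnorm g) = 0.
  by move=> Cg; have := HC 0 _ Cg; rewrite derive1n0.
pose S := \sum_j `|h j|.
have S0 : 0 <= S by apply: sumr_ge0.
pose B := 1 + C.
(* On the ball [sqnorm g <= C], [B] bounds the norm of [g] because C <= (1 + C)^2; this avoids a
   square root. *)
have B0 : 0 <= B by rewrite /B; lra.
have gB g : sqnorm g <= C -> `|g| <= B.
  move=> gC; rewrite -(@ler_pXn2r _ 2) ?nnegrE//; apply: le_trans gC _.
  by rewrite /B sqrrD expr1n; nra.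
have bS X (x : 'I_m -> R) a : (forall j, `|x j| <= X) ->
    `|\sum_j x j * dot (h j) a| <= X * S * `|a|.
  move=> xX; apply: le_trans (ler_norm_sum _ _ _) _.
  rewrite /S mulr_sumr mulr_suml; apply: ler_sum => j _.
  by rewrite -mulrA; apply: absM => //; exact: cauchy_schwarz.
have bS' X (x : 'I_m -> R) a : (forall j, `|x j| <= X) ->
    `|\sum_j dot a (h j) * x j| <= X * S * `|a|.
  by move=> /bS -/(_ a); under eq_bigr do rewrite mulrC dotC.
have b2 : `|2 : R| <= 2 by rewrite ger0_norm.
pose KK := 2 * B * K * M * S + K * M * S * S +
  2 * (M * S * K * B + M * (2 * B * K) * B + M * K) + M * K + (K * (M * S) + 2 * M * K * B).
have [KK0 KKU KKG KKH] := bound_parts B0 K_ge0 M0 S0.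
rewrite -/KK in KK0 KKU KKG KKH.
have Z g : C < sqnorm g -> [/\ cylf u phi h g = 0, cylG g = 0 & forall a, cylH g a = 0].
  move=> Cg; have p0 := phi0 g Cg; have p1 := HC 1 _ Cg; have p2 := HC 2 _ Cg.
  split.
  - by rewrite /cylf -/(sqnorm g) p0 mulr0.
  - by rewrite /cylG p0 /phi1 p1 mulr0 !scale0r addr0.
  - by move=> a; rewrite /cylH p0 /phi1 /phi2 p1 p2 !(mulr0, mul0r, addr0).
exists KK, C; split => //.
- by move=> g; apply: le_trans KKU; exact: absM (bu _) (bp0 g).
- split=> [g|g a]; have [gC|Cg] := leP (sqnorm g) C.
  + apply: le_trans KKG; rewrite /cylG; apply: le_trans (ler_normD _ _) _.
    rewrite !normrZ; apply: lerD.
      apply: ler_pM => //; apply: le_trans (ler_norm_sum _ _ _) _.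
      rewrite /S mulr_sumr; apply: ler_sum => j _.
      by rewrite normrZ ler_wpM2r.
    apply: ler_pM => //; last exact: gB.
    by rewrite -!normrM; exact: absM (absM b2 (bu _)) (bp1 g).
  + by have [_ -> _] := Z g Cg; rewrite normr0.
  + have bg := gB g gC.
    have bag : `|dot a g| <= `|a| * B.
      by apply: le_trans (cauchy_schwarz _ _) _; rewrite ler_wpM2l.
    have bga : `|dot g a| <= B * `|a| by rewrite dotC mulrC.
    have baa : `|dot a a| <= `|a| * `|a| by exact: cauchy_schwarz.
    have t1 := absM (absM (absM b2 bag) (bp1 g)) (bS _ _ a (fun j : 'I_m => buj j (c g))).
    have t2 := absM (bp0 g) (bS _ _ a (fun j => bS' _ _ a (fun k : 'I_m => bujk j k (c g)))).
    have t3 := absM (absM (bS' _ _ a (fun k : 'I_m => buj k (c g))) (bp1 g)) bga.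
    have t4 := absM (absM (bu (c g)) (absM (absM b2 bag) (bp2 g))) bga.
    have t5 := absM (absM (bu (c g)) (bp1 g)) baa.
    have t := absD (absD t1 t2) (absM b2 (absD (absD t3 t4) t5)).
    rewrite /cylH; apply: le_trans t _.
    have := ler_wpM2r (mulr_ge0 (normr_ge0 a) (normr_ge0 a)) KKH.
    by rewrite expr2; lra.
  + by have [_ _ ->] := Z g Cg; rewrite normr0 mulr_ge0// sqr_ge0.
Qed.

Lemma cylf_nice : nice (cylf u phi h) cylG cylH.
Proof.
split; [exact: cylf_is_diff|exact: cyl_is_derive|exact: cylG_continuous|
  exact: cylH_continuous|exact: cyl_bounded].
Qed.

End cylinder.

Lemma nice0 : nice (fun=> 0) (fun=> 0) (fun _ _ => 0).
Proof.
split.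
- move=> g; have d := is_diff_cst (0 : R) g; apply: (is_diff_eq d).
  by apply/funext => k; rewrite dot0l.
- by move=> g a; under eq_fun do rewrite dot0l; exact: is_derive_cst.
- exact: cst_continuous.
- exact: cst_continuous.
- exists 0, 0; split => // [g|]; first by rewrite normr0.
  by split=> [g|g a]; rewrite ?normr0 ?mul0r.
Qed.

(** This is the shape of the inductive step along a linear combination; the support radii combine by
    a maximum. *)
Lemma nice_lin (b : R) U G H U' G' H' : nice U G H -> nice U' G' H' ->
  nice (fun g => b * U g + U' g) (fun g => b *: G g + G' g) (fun g a => b * H g a + H' g a).
Proof.
move=> [d1 e1 c1 k1 [K [C [K0 C0 bU [bG bH] Z]]]] [d2 e2 c2 k2 [K' [C' [K'0 C'0 bU' [bG' bH'] Z']]]].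
split.
- move=> g; have d := is_diffD (is_diffZ b (d1 g)) (d2 g); apply: (is_diff_eq d).
  by apply/funext => k; rewrite dotDl dotZl.
- move=> g a; have d := is_deriveD (is_deriveZ b (e1 g a)) (e2 g a).
  rewrite [X in is_derive _ _ X](_ : _ = b *: (fun f => dot (G f) a : R) + (fun f => dot (G' f) a)).
    exact: (is_derive_eq d).
  by apply/funext => f; rewrite dotDl dotZl.
- apply: continuousFD => //; apply: continuousFZ => //; exact: cst_continuous.
- apply: continuousFD => //; apply: continuousFM => //; exact: cst_continuous.
- exists (`|b| * K + K'), (Num.max C C'); split.
  + by rewrite addr_ge0// mulr_ge0.
  + by rewrite le_max C0.
  + by move=> g; apply: le_trans (ler_normD _ _) _; rewrite normrM lerD// ler_wpM2l.
  + split=> [g|g a]; apply: le_trans (ler_normD _ _) _.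
      by rewrite normrZ lerD// ler_wpM2l.
    by rewrite normrM mulrDl -mulrA lerD// ler_wpM2l.
  + move=> g; rewrite gt_max => /andP[/Z[-> -> h1] /Z'[-> -> h2]].
    by split=> [||a]; rewrite ?mulr0 ?scaler0 ?addr0// h1 h2 mulr0 addr0.
Qed.

Lemma FC_nice (xi : L2 R) U : FC xi U -> exists G H, nice U G H.
Proof.
move=> [k [a [F [HF ->]]]].
have {HF} : forall i, exists GH, nice (F i) GH.1 GH.2.
  move=> i; have [m [u [phi [h [su sphi _ ->]]]]] := HF i.
  by exists (cylG u phi h, cylH u phi h); exact: cylf_nice.
elim: k a F => [|k IH] a F HF.
  exists (fun=> 0), (fun _ _ => 0); under eq_fun do rewrite big_ord0; exact: nice0.
have [G [H nGH]] := IH (fun i => a (lift ord0 i)) (fun i => F (lift ord0 i)) (fun i => HF _).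
have [[G0 H0] nGH0] := HF ord0.
have -> : (fun g => \sum_(i < k.+1) a i * F i g) =
    (fun g => a ord0 * F ord0 g + \sum_(i < k) a (lift ord0 i) * F (lift ord0 i) g).
  by apply/funext => g; rewrite big_ord_recl.
by do 2 eexists; exact: (nice_lin (a ord0) nGH0 nGH).
Qed.

End smooth_on_L2.

(** * Tuple measures *)

Section insertion.
Variable T : Type.
Implicit Types (n i j : nat).

(* Junk value: for [i > size y], [s] is appended at the end. *)
Definition ins_seq i (s : T) (y : seq T) : seq T := take i y ++ s :: drop i y.

Lemma size_ins_seq i s y : size (ins_seq i s y) = (size y).+1.
Proof. by rewrite /ins_seq size_cat/= size_take_min size_drop; lia. Qed.

Lemma nth_ins_seq x0 i s y j : (i <= size y)%N ->
  nth x0 (ins_seq i s y) j =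
  if (j < i)%N then nth x0 y j else if j == i then s else nth x0 y j.-1.
Proof.
move=> iy; rewrite /ins_seq nth_cat size_take_min (minn_idPl iy).
case: ltnP => ji; first by rewrite nth_take.
case: eqP => [->|/eqP ij]; first by rewrite subnn.
have [k ->] : exists k, j = (i + k).+1.
  by exists (j - i).-1; lia.
by rewrite subSn ?leq_addr// addKn/= nth_drop.
Qed.

Fact ins_subproof n i (s : T) (y : n.-tuple T) : size (ins_seq i s y) == n.+1.
Proof. by rewrite size_ins_seq size_tuple. Qed.

(** Serves two purposes: to single out the value in which one integrates by parts, and to add a knot
    to a subdivision. *)
Definition ins n i (s : T) (y : n.-tuple T) : n.+1.-tuple T := Tuple (ins_subproof i s y).

Lemma ins0 n (s : T) (y : n.-tuple T) : ins 0 s y = [tuple of s :: y].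
Proof. by apply: val_inj; rewrite /= /ins_seq take0 drop0. Qed.

Lemma insS n i (s x : T) (y : n.-tuple T) :
  ins i.+1 s [tuple of x :: y] = [tuple of x :: ins i s y].
Proof. exact: val_inj. Qed.

End insertion.

Section tuple_measurable.
Context d (T : measurableType d).

Lemma measurable_funT_cons n :
  measurable_fun setT (fun p : T * n.-tuple T => [tuple of p.1 :: p.2]).
Proof. exact: measurable_cons measurable_fst measurable_snd. Qed.

Lemma measurable_ins n i : (i <= n)%N ->
  measurable_fun setT (fun p : T * n.-tuple T => ins i p.1 p.2).
Proof.
move=> ni; apply/measurable_fun_tnthP => j.
have [ji|ij|ji] := ltngtP j i.
- have jn : (j < n)%N by exact: leq_trans ji ni.
  rewrite (_ : _ \o _ = (fun t => tnth t (Ordinal jn)) \o snd).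
    by apply: measurableT_comp => //; exact: measurable_tnth.
  apply/funext => -[s y] /=; rewrite !(tnth_nth s) nth_ins_seq ?size_tuple//.
  by rewrite ji.
- have jn : (j.-1 < n)%N by have := ltn_ord j; lia.
  rewrite (_ : _ \o _ = (fun t => tnth t (Ordinal jn)) \o snd).
    by apply: measurableT_comp => //; exact: measurable_tnth.
  apply/funext => -[s y] /=; rewrite !(tnth_nth s) nth_ins_seq ?size_tuple//.
  by rewrite ltnNge (ltnW ij) gtn_eqF.
- rewrite (_ : _ \o _ = fst)//.
  apply/funext => -[s y] /=; rewrite !(tnth_nth s) nth_ins_seq ?size_tuple//.
  by rewrite ji ltnn eqxx.
Qed.

End tuple_measurable.

(** The exhausting sequences are chosen increasing, so that the products of sets with equal index
    already cover the product space. *)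
Lemma prod_sigma_finite d1 d2 (T1 : measurableType d1) (T2 : measurableType d2)
    (R : realType) (m1 : {sigma_finite_measure set T1 -> \bar R})
    (m2 : {sigma_finite_measure set T2 -> \bar R}) :
  sigma_finite setT (m1 \x m2)%E.
Proof.
have /sigma_finiteP[F [TF ndF Foo]] := sigma_finiteT m1.
have /sigma_finiteP[G [TG ndG Goo]] := sigma_finiteT m2.
exists (fun n => F n `*` G n).
  rewrite -setXTT TF TG; apply/seteqP; split => -[x y]; last by case=> n _ []; split; exists n.
  move=> [/= [n _ Fnx] [k _ Gky]]; exists (maxn n k) => //; split.
  - by move: x Fnx; exact/subsetPset/ndF/leq_maxl.
  - by move: y Gky; exact/subsetPset/ndG/leq_maxr.
move=> k; have [mF Fk] := Foo k; have [mG Gk] := Goo k; split; first exact: measurableX.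
by rewrite product_measure1E// lte_mul_pinfty// ge0_fin_numE.
Qed.

Section sigma_finite_alias.
Context d (T : measurableType d) (R : realType) (m : {measure set T -> \bar R}).
Variable sf : sigma_finite setT m.

(* The proof argument only serves as a key for the canonical instances. *)
Definition sigma_finite_alias (_ : sigma_finite setT m) : set T -> \bar R := m.

HB.instance Definition _ := Measure.copy (sigma_finite_alias sf) m.
HB.instance Definition _ := Measure_isSigmaFinite.Build _ _ _ (sigma_finite_alias sf) sf.

Definition sigma_finite_pack : {sigma_finite_measure set T -> \bar R} := sigma_finite_alias sf.

End sigma_finite_alias.

Section tuple_measure_theory.
Context d (T : measurableType d) (R : realType).
Variable mu : {sigma_finite_measure set T -> \bar R}.
Local Open Scope ereal_scope.

(** [tuple_measure] is a bare set function, and its product with [mu] becomes a measure only once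
    the inner factor is one; the induction therefore builds the structure together with the
    equality. *)
Lemma tuple_measure_sigma_finite n :
  exists M : {sigma_finite_measure set (n.-tuple T) -> \bar R},
    M = tuple_measure mu n :> (set (n.-tuple T) -> \bar R).
Proof.
elim: n => [|n [M IH]].
  by exists [the {sigma_finite_measure set (0.-tuple T) -> \bar R} of dirac ([tuple] : 0.-tuple T)].
pose m := measure_function_pushforward__canonical__measure_function_Measure
  (mu \x M) (@measurable_funT_cons _ T n).
have mE : m = tuple_measure mu n.+1 :> (set _ -> _) by rewrite /m /= IH.
have sf : sigma_finite setT m.
  have [F FT Fo] := prod_sigma_finite mu M.
  pose un (t : n.+1.-tuple T) : T * n.-tuple T := (thead t, [tuple of behead t]).
  have mun : measurable_fun setT un.
    apply/measurable_fun_pairP; split; first exact: measurable_tnth.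
    exact: measurable_behead.
  exists (fun i => un @^-1` F i).
    by rewrite -preimage_bigcup -FT preimage_setT.
  move=> i; have [mFi Fi] := Fo i; split; first by rewrite -[X in measurable X]setTI; exact: mun.
  rewrite /m /= /pushforward (_ : _ @^-1` _ = F i)//.
  have unK (p : T * n.-tuple T) : un [tuple of p.1 :: p.2] = p.
    by case: p => s y; congr pair; exact: val_inj.
  by apply/seteqP; split => p /=; rewrite unK.
by exists (sigma_finite_pack sf); rewrite -mE.
Qed.

Definition tupleM n : {sigma_finite_measure set (n.-tuple T) -> \bar R} :=
  proj1_sig (cid (tuple_measure_sigma_finite n)).

Lemma tupleME n : tuple_measure mu n = tupleM n :> (set _ -> _).
Proof. by rewrite /tupleM; case: cid. Qed.

Lemma tupleMS n A : tupleM n.+1 A =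
  (mu \x tupleM n) ((fun p : T * n.-tuple T => [tuple of p.1 :: p.2]) @^-1` A).
Proof. by rewrite -tupleME /= tupleME. Qed.

Lemma ge0_integral_cons n (f : n.+1.-tuple T -> \bar R) :
  measurable_fun setT f -> (forall x, 0 <= f x) ->
  \int[tupleM n.+1]_x f x = \int[mu]_s \int[tupleM n]_y f [tuple of s :: y].
Proof.
move=> mf f0; pose m := measure_function_pushforward__canonical__measure_function_Measure
  (mu \x tupleM n) (@measurable_funT_cons _ T n).
rewrite (eq_measure_integral m); last by move=> A _ _; exact: tupleMS.
rewrite ge0_integral_pushforward//; last exact: measurable_funT_cons.
rewrite preimage_setT fubini_tonelli1//.
  by apply: measurableT_comp => //; exact: measurable_funT_cons.
by move=> x; exact: f0.
Qed.

(** Any coordinate can be integrated outermost: by induction on its position, with one application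
    of Tonelli to exchange it with the head. *)
Lemma ge0_integral_ins n i (f : n.+1.-tuple T -> \bar R) : (i <= n)%N ->
  measurable_fun setT f -> (forall x, 0 <= f x) ->
  \int[tupleM n.+1]_x f x = \int[mu]_s \int[tupleM n]_y f (ins i s y).
Proof.
elim: i n f => [|i IH] n f ni mf f0.
  rewrite (ge0_integral_cons mf f0); apply: eq_integral => s _; apply: eq_integral => y _.
  by rewrite ins0.
case: n f ni mf f0 => // n f ni mf f0; rewrite ltnS in ni.
have mfc s : measurable_fun setT (fun y : n.+1.-tuple T => f [tuple of s :: y]).
  by apply: measurableT_comp mf _; apply: measurable_cons.
rewrite (ge0_integral_cons mf f0).
under eq_integral do rewrite (IH n _ ni (mfc _))//.
have mins3 : measurable_fun setT (fun p : (T * T) * n.-tuple T =>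
    [tuple of p.1.1 :: ins i p.1.2 p.2]).
  apply: measurable_cons; first exact: measurableT_comp measurable_fst measurable_fst.
  apply: (measurableT_comp (measurable_ins ni) (g := fun p : (T * T) * n.-tuple T => (p.1.2, p.2))).
  apply/measurable_fun_pairP; split => /=; last exact: measurable_snd.
  exact: (measurableT_comp measurable_snd measurable_fst).
have mF : measurable_fun setT (fun p : T * T => \int[tupleM n]_y f [tuple of p.1 :: ins i p.2 y]).
  apply: (@measurable_fun_fubini_tonelli_F _ _ _ _ _ (tupleM n)
    (fun p : (T * T) * n.-tuple T => f [tuple of p.1.1 :: ins i p.1.2 p.2])) => //.
  exact: measurableT_comp mf mins3.
have F0 (p : T * T) : 0 <= \int[tupleM n]_y f [tuple of p.1 :: ins i p.2 y].
  by apply: integral_ge0.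
rewrite (@fubini_tonelli _ _ _ _ _ mu mu _ mF F0).
apply: eq_integral => s _.
have mi : measurable_fun setT (fun y : n.+1.-tuple T => f (ins i.+1 s y)).
  apply: measurableT_comp mf _.
  apply: (measurableT_comp (measurable_ins (ni : i.+1 <= n.+1)%N) (g := fun y : n.+1.-tuple T => (s, y))).
  exact: pair1_measurable.
rewrite (ge0_integral_cons mi (fun y => f0 _)).
by apply: eq_integral => x _; apply: eq_integral => y _; rewrite insS.
Qed.

Definition insM n i (ni : (i <= n)%N) : {measure set (n.+1.-tuple T) -> \bar R} :=
  measure_function_pushforward__canonical__measure_function_Measure
  (mu \x tupleM n) (measurable_ins ni).

(** Tonelli on indicators identifies the tuple measure with an image measure; integrability and
    integrals of signed functions are then transferred by the pushforward formulas. *)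
Lemma tupleM_ins n i (ni : (i <= n)%N) A : measurable A -> tupleM n.+1 A = insM ni A.
Proof.
move=> mA; rewrite -[in LHS](setIT A) -integral_indic//.
rewrite (ge0_integral_ins ni)//; last by apply/measurable_EFinP.
rewrite /insM/= /pushforward/= /product_measure1.
apply: eq_integral => s _ /=.
have mS : measurable (xsection ((fun p : T * n.-tuple T => ins i p.1 p.2) @^-1` A) s).
  by apply: measurable_xsection; rewrite -[X in measurable X]setTI; exact: (measurable_ins ni).
rewrite -[X in _ = tupleM n X]setIT -integral_indic//.
apply: eq_integral => y _; rewrite !indicE mem_xsection.
by congr ((nat_of_bool _)%:R%:E); apply/idP/idP; rewrite !inE.
Qed.

Lemma integrable_ins n i (ni : (i <= n)%N) (f : n.+1.-tuple T -> \bar R) :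
  (tupleM n.+1).-integrable setT f ->
  (mu \x tupleM n).-integrable setT (fun p => f (ins i p.1 p.2)).
Proof.
move=> /integrableP[mf fi]; apply/integrableP; split.
  by apply: measurableT_comp mf _; exact: measurable_ins.
apply: le_lt_trans fi.
rewrite [leRHS](eq_measure_integral (insM ni)); last by move=> A mA _; exact: tupleM_ins.
rewrite [leRHS]ge0_integral_pushforward//; first exact: measurable_ins.
exact: measurableT_comp.
Qed.

Lemma integral_ins n i (ni : (i <= n)%N) (f : n.+1.-tuple T -> \bar R) :
  (tupleM n.+1).-integrable setT f ->
  \int[tupleM n.+1]_x f x = \int[mu \x tupleM n]_p f (ins i p.1 p.2).
Proof.
move=> fi; rewrite [LHS](eq_measure_integral (insM ni)); last first.
  by move=> A mA _; exact: tupleM_ins.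
rewrite [LHS]integral_pushforward//; first exact: measurable_ins.
  by have /integrableP[] := fi.
exact: integrable_ins.
Qed.

End tuple_measure_theory.

Section tuple_topology.
Variable R : realType.

Definition rv n (t : n.-tuple R) : 'rV[R]_n := \row_i tnth t i.

Lemma rvK n : cancel (@rv n) (@tup R n).
Proof. by move=> t; apply: eq_from_tnth => i; rewrite tnth_tup mxE. Qed.

Let box n m (r : n.-tuple rat) (r' : m.-tuple rat) k : set ('rV[R]_n * 'rV[R]_m) :=
  [set p : 'rV[R]_n * 'rV[R]_m | (forall i, `|p.1 0 i - ratr (tnth r i)| < k.+1%:R^-1) /\
           (forall i, `|p.2 0 i - ratr (tnth r' i)| < k.+1%:R^-1)].

Let rat_near n (v : 'rV[R]_n) (e : R) : 0 < e ->
  exists r : n.-tuple rat, forall i, `|v 0 i - ratr (tnth r i)| < e.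
Proof.
move=> e0; have H i : exists q : rat, `|v 0 i - ratr q| < e.
  have [|x [vx [q _ qx]]] := @dense_rat R (ball (v 0 i) e) _ (ball_open (v 0 i) e).
    by exists (v 0 i); exact: ballxx.
  by exists q; rewrite qx.
have [r Hr] := choice H; exists [tuple r i | i < n] => i.
by rewrite tnth_mktuple.
Qed.

Let dist3 (x y z d e : R) : `|x - y| < d -> `|z - y| < d -> d < e / 2 -> `|x - z| < e.
Proof.
by move=> xy zy de; apply: le_lt_trans (ler_distD y x z) _; rewrite (distrC y); lra.
Qed.

Lemma measurable_tnthR n (i : 'I_n) :
  measurable_fun setT (fun t : n.-tuple (measurableTypeR R) => tnth t i : R).
Proof. exact: (@measurable_tnth _ (measurableTypeR R) n i). Qed.

(** An open set is the countable union of the boxes of rational centre and radius 1 / (k + 1) that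
    it contains, and each box is a finite intersection of coordinate conditions. *)
Lemma open_tuple_measurable n m (O : set ('rV[R]_n * 'rV[R]_m)) : open O ->
  measurable [set p : n.-tuple (measurableTypeR R) * m.-tuple (measurableTypeR R) | O (rv p.1, rv p.2)].
Proof.
move=> oO.
pose F (z : n.-tuple rat * m.-tuple rat * nat) : set (n.-tuple (measurableTypeR R) * m.-tuple (measurableTypeR R)) :=
  if `[< box z.1.1 z.1.2 z.2 `<=` O >] then
    [set p | box z.1.1 z.1.2 z.2 (rv p.1, rv p.2)] else set0.
rewrite (_ : [set p | _] = \bigcup_z F z); last first.
  apply/seteqP; split => [[a b] /= Oab|[a b] /= [z _]]; last first.
    by rewrite /F; case: asboolP => // + h; exact.
  move: oO; rewrite openE => /(_ _ Oab) /nbhs_ballP[e /= e0 eO].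
  (* Any two points of a box of radius 1 / (k + 1) < e / 2 are at distance less than [e]. *)
  pose k := Num.truncn (2 / e).
  have ke : k.+1%:R^-1 < e / 2.
    rewrite -[ltRHS]invrK ltf_pV2 ?posrE ?invr_gt0 ?divr_gt0// invf_div.
    exact: truncnS_gt.
  have k0 : 0 < k.+1%:R^-1 :> R by rewrite invr_gt0.
  have [r Hr] := rat_near (rv a) k0; have [r' Hr'] := rat_near (rv b) k0.
  exists (r, r', k) => //; rewrite /F; case: asboolP => [_ //|[]].
  move=> [v w] /= [Hv Hw]; apply: eO; split => /=; split => // i j; rewrite ?(ord1 i) -ball_normE/=.
    exact: dist3 (Hr j) (Hv j) ke.
  exact: dist3 (Hr' j) (Hw j) ke.
apply: countable_bigcupT_measurable; first exact: countableP.
move=> z; rewrite /F; case: asboolP => // _.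
rewrite (_ : [set p | _] =
    (\bigcap_(i in [set: 'I_n]) [set p : n.-tuple (measurableTypeR R) * m.-tuple (measurableTypeR R) | `|tnth p.1 i - ratr (tnth z.1.1 i)| < z.2.+1%:R^-1]) `&`
    (\bigcap_(i in [set: 'I_m]) [set p : n.-tuple (measurableTypeR R) * m.-tuple (measurableTypeR R) | `|tnth p.2 i - ratr (tnth z.1.2 i)| < z.2.+1%:R^-1])); last first.
  apply/seteqP; split => p /= [h1 h2]; split => i; rewrite ?mxE; try move=> _.
  - by have := h1 i; rewrite mxE.
  - by have := h2 i; rewrite mxE.
  - exact: h1.
  - exact: h2.
have mb (f : n.-tuple (measurableTypeR R) * m.-tuple (measurableTypeR R) -> R) (c e : R) : measurable_fun setT f ->
    measurable [set p | `|f p - c| < e].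
  move=> mf; have mg : measurable_fun setT (fun p => `|f p - c|).
    by apply: measurableT_comp => //; exact: measurable_funB.
  have := mg measurableT `]-oo, e[%classic (measurable_itv _); rewrite setTI.
  by congr measurable; apply/seteqP; split => p /=; rewrite in_itv.
apply: measurableI; apply: fin_bigcap_measurable => // i _; apply: mb.
  exact: (measurableT_comp (measurable_tnthR i) measurable_fst).
exact: (measurableT_comp (measurable_tnthR i) measurable_snd).
Qed.

Lemma continuous_tuple_measurable n m (f : 'rV[R]_n * 'rV[R]_m -> R) : continuous f ->
  measurable_fun setT (fun p : n.-tuple (measurableTypeR R) * m.-tuple (measurableTypeR R) => f (rv p.1, rv p.2)).
Proof.
move=> cf; apply: (measurability _ (RGenOpens.measurableE R)).
move=> /= _ [_ [a [b ->]] <-]; rewrite setTI.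
apply: (@open_tuple_measurable n m (f @^-1` `]a, b[%classic)).
by move/continuousP : cf; apply; exact: interval_open.
Qed.

Lemma continuous_tuple_L2_measurable n m (f : 'rV[R]_n * 'rV[R]_m -> L2 R) : continuous f ->
  measurable_fun setT (fun p : n.-tuple (measurableTypeR R) * m.-tuple (measurableTypeR R) => f (rv p.1, rv p.2)).
Proof.
move=> cf; apply: (measurability (@open (L2 R))) => //.
move=> /= _ [B oB <-]; rewrite setTI.
apply: (@open_tuple_measurable n m (f @^-1` B)).
by move/continuousP : cf; apply.
Qed.

End tuple_topology.

(** * Integration off null sets and image measures with density *)

Section nnintegral_null.
Context d (T : measurableType d) (R : realType).
Local Open Scope ereal_scope.
Import HBNNSimple.

(* [Xi] is a mere set function, which is a measure on measurable sets only. *)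
Lemma eq_setfun_integral (m1 m2 : set T -> \bar R) (D : set T) (f : T -> \bar R) :
  (forall A, measurable A -> m1 A = m2 A) ->
  integral m1 D f = integral m2 D f.
Proof.
move=> m12; rewrite /integral.
have e (h : {nnsfun T >-> R}) : sintegral m1 h = sintegral m2 h.
  by apply: eq_fsbigr => r _; rewrite m12.
congr (ereal_sup _ - ereal_sup _); apply/seteqP; split => _ [h hf <-]; exists h => //; exact/esym.
Qed.

Variable mu : {measure set T -> \bar R}.

(* The integrands of the theorem are only known to be measurable on a set of full
   measure, hence no measurability of [f] or [g] is assumed: a simple function
   below [f] can be cut off on the null set, which leaves its integral unchanged. *)
Lemma le_integral_off_null (N : set T) (f g : T -> \bar R) :
  measurable N -> mu N = 0 -> (forall x, 0 <= f x) -> (forall x, 0 <= g x) ->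
  (forall x, ~ N x -> f x = g x) ->
  \int[mu]_x f x <= \int[mu]_x g x.
Proof.
move=> mN N0 f0 g0 fg; rewrite !ge0_integralTE//.
apply: ge_ereal_sup => _ [h hf <-].
have mNC : measurable (~` N) by exact: measurableC.
pose h' : {nnsfun T >-> R} := mul_nnsfun h (indic_nnsfun R mNC).
have -> : sintegral mu h = sintegral mu h'.
  rewrite -!integralT_nnsfun; apply: ge0_ae_eq_integral => //.
  - exact/measurable_EFinP.
  - exact/measurable_EFinP.
  - by move=> x _; rewrite lee_fin.
  - by move=> x _; rewrite lee_fin.
  exists N; split => // x /= hx; apply: contrapT => Nx; apply: hx => _.
  by rewrite /h'/= /mindic indicE mem_set ?mulr1.
apply: ereal_sup_ubound; exists h' => // x.
rewrite /h'/= /mindic indicE; have [xN|xN] := boolP (x \in ~` N).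
  by rewrite mulr1 -fg; [exact: hf|exact/set_mem].
by rewrite mulr0.
Qed.

Lemma eq_integral_off_null (N : set T) (f g : T -> \bar R) :
  measurable N -> mu N = 0 -> (forall x, ~ N x -> f x = g x) ->
  \int[mu]_x f x = \int[mu]_x g x.
Proof.
move=> mN N0 fg; rewrite (integralE _ setT f) (integralE _ setT g).
congr (_ - _); apply/eqP; rewrite eq_le; apply/andP; split;
  apply: (le_integral_off_null mN N0) => // x Nx; by rewrite !(funeposE, funenegE) fg.
Qed.

End nnintegral_null.

Section density.
Context d1 d2 (X : measurableType d1) (Y : measurableType d2) (R : realType).
Variables (P : {measure set X -> \bar R}) (w : X -> R) (t : X -> Y).
Hypotheses (w0 : forall x, 0 <= w x) (mw : measurable_fun setT w) (mt : measurable_fun setT t).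
Local Open Scope ereal_scope.

(* The image by [t] of the measure of density [w]; the proofs are arguments so
   that the measure instance below can be inferred. *)
Definition densityM (_ : forall x, (0 <= w x)%R) (_ : measurable_fun setT w)
  (_ : measurable_fun setT t) (A : set Y) : \bar R := \int[P]_(x in t @^-1` A) (w x)%:E.

Local Notation m := (densityM w0 mw mt).

Let mpre A : measurable A -> measurable (t @^-1` A).
Proof. by move=> mA; rewrite -[X in measurable X]setTI; exact: mt. Qed.

Let m0 : m set0 = 0.
Proof. by rewrite /m preimage_set0 integral_set0. Qed.

Let m_ge0 A : 0 <= m A.
Proof. by apply: integral_ge0 => x _; rewrite lee_fin. Qed.

Let m_sigma : semi_sigma_additive m.
Proof.
move=> F mF tF mUF; rewrite [X in _ --> X](_ : _ = \sum_(k <oo) m (F k)).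
  by apply: is_cvg_ereal_nneg_natsum_cond => k _ _; exact: m_ge0.
rewrite /m preimage_bigcup ge0_integral_bigcup//.
- by move=> k; exact: mpre.
- by apply: measurable_funTS; exact/measurable_EFinP.
- by move=> x _; rewrite lee_fin.
- apply/trivIsetP => /= i j _ _ ij; rewrite -preimage_setI.
  by move/trivIsetP : tF => /(_ _ _ _ _ ij) ->//; rewrite preimage_set0.
Qed.

HB.instance Definition _ := isMeasure.Build _ _ _ m m0 m_ge0 m_sigma.

Definition densityMeasure : {measure set Y -> \bar R} := m.

Lemma densityMeasureE A : measurable A ->
  densityMeasure A = \int[P]_x (w x * \1_A (t x))%:E.
Proof.
move=> mA; rewrite /densityMeasure/= /densityM integral_mkcond; apply: eq_integral => x _.
rewrite patchE indicE (_ : (x \in t @^-1` A) = (t x \in A)).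
  by case: ifPn; rewrite ?mulr1 ?mulr0.
by apply/idP/idP; rewrite !inE.
Qed.

Import HBNNSimple.

Lemma ge0_integral_density (f : Y -> \bar R) : measurable_fun setT f ->
  (forall y, 0 <= f y) -> \int[densityMeasure]_y f y = \int[P]_x ((w x)%:E * f (t x)).
Proof.
move=> mf f0.
pose f_ := nnsfun_approx measurableT mf.
have f_f y : (f_ n y)%:E @[n --> \oo] --> f y by exact: cvg_nnsfun_approx.
have f_nd y : {homo (fun n => (f_ n y)%:E) : a b / (a <= b)%N >-> a <= b}.
  by move=> a b ab; rewrite lee_fin; exact/lefP/nd_nnsfun_approx.
transitivity (limn (fun n => \int[densityMeasure]_y (f_ n y)%:E)).
  rewrite -monotone_convergence//.
  - by apply: eq_integral => y _; apply/esym/cvg_lim => //; exact: f_f.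
  - by move=> n; exact/measurable_EFinP.
  - by move=> n y _; rewrite lee_fin.
have -> : (fun n => \int[densityMeasure]_y (f_ n y)%:E) =
          (fun n => \int[P]_x ((w x)%:E * (f_ n (t x))%:E)).
  apply/funext => n; rewrite integralT_nnsfun sintegralE.
  have e x : (w x)%:E * (f_ n (t x))%:E =
      \sum_(r \in range (f_ n)) ((w x)%:E * (r * \1_(f_ n @^-1` [set r]) (t x))%:E).
    rewrite -ge0_mule_fsumr; last by move=> r; rewrite nnfun_muleindic_ge0.
    by rewrite [in LHS](fimfunE (f_ n)) -fsumEFin.
  under [RHS]eq_integral do rewrite e.
  rewrite ge0_integral_fsum//; last 2 first.
  - move=> r; apply: emeasurable_funM; first exact/measurable_EFinP.
    apply/measurable_EFinP; apply: measurable_funM => //.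
    have : measurable_fun setT (fun y => \1_(f_ n @^-1` [set r]) y : R) by exact: measurable_indic.
    by move=> h; exact: measurableT_comp h mt.
  - by move=> r x _; apply: mule_ge0; [rewrite lee_fin|rewrite nnfun_muleindic_ge0].
  apply: eq_fsbigr => r rr; rewrite densityMeasureE//.
  rewrite -ge0_integralZl//=.
  - by apply: eq_integral => x _; rewrite -!EFinM; congr EFin; rewrite mulrCA.
  - apply/measurable_EFinP; apply: measurable_funM => //.
    have : measurable_fun setT (fun y => \1_(f_ n @^-1` [set r]) y : R) by exact: measurable_indic.
    by move=> h; exact: measurableT_comp h mt.
  - by move=> x _; rewrite lee_fin mulr_ge0.
  - by move: rr; rewrite inE => -[y _ <-]; rewrite lee_fin.
rewrite -monotone_convergence//; last 3 first.
- move=> n; apply: emeasurable_funM; first exact/measurable_EFinP.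
  by apply/measurable_EFinP; exact: measurableT_comp (measurable_funPT (f_ n)) mt.
- by move=> n x _; apply: mule_ge0; rewrite lee_fin.
- by move=> x _ a b ab; apply: lee_wpmul2l; [rewrite lee_fin|exact: f_nd].
apply: eq_integral => x _; apply/cvg_lim => //.
by apply: cvgeZl => //; exact: f_f.
Qed.

Lemma integrable_density (f : Y -> R) : measurable_fun setT f ->
  P.-integrable setT (fun x => (w x * f (t x))%:E) ->
  densityMeasure.-integrable setT (EFin \o f).
Proof.
move=> mf /integrableP[_ fi]; apply/integrableP; split; first exact/measurable_EFinP.
rewrite ge0_integral_density//; last first.
  by apply: measurableT_comp => //; exact/measurable_EFinP.
apply: le_lt_trans fi; rewrite le_eqVlt; apply/orP; left; apply/eqP.
by apply: eq_integral => x _; rewrite /= -EFinM normrM ger0_norm.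
Qed.

Lemma integral_density (f : Y -> R) : measurable_fun setT f ->
  P.-integrable setT (fun x => (w x * f (t x))%:E) ->
  \int[densityMeasure]_y (f y)%:E = \int[P]_x (w x * f (t x))%:E.
Proof.
move=> mf fi; have mfE : measurable_fun setT (EFin \o f) by exact/measurable_EFinP.
rewrite integralE [RHS]integralE; congr (_ - _).
  rewrite ge0_integral_density//; last exact: measurable_funepos.
  apply: eq_integral => x _; rewrite !funeposE /= -!EFin_max -EFinM; congr EFin.
  by rewrite maxr_pMr// mulr0.
rewrite ge0_integral_density//; last exact: measurable_funeneg.
apply: eq_integral => x _; rewrite !funenegE /= -!EFin_max -EFinM; congr EFin.
by rewrite maxr_pMr// mulr0 mulrN.
Qed.

End density.

(** * The measure Xi *)

Section Xi_measure.
Variables (R : realType) (xi : bddDup R).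
Notation mR := (measurableTypeR R).

Definition xiM : {sigma_finite_measure set mR -> \bar R} :=
  lebesgue_stieltjes_measure (ext01 xi).
Definition lebM : {sigma_finite_measure set mR -> \bar R} := lebesgue_measure.
Definition nuM n := tupleM xiM n.
Definition laM n := tupleM lebM n.

Lemma measurable_knot n i : measurable_fun setT (fun q : n.-tuple mR => knot q i : R).
Proof.
have [i0|i0] := eqVneq i 0%N; first by subst i; exact: measurable_cst.
have [k ->] : exists k, i = k.+1 by exists i.-1; lia.
have [kn|nk] := ltnP k n.
  rewrite (_ : (fun q => _) = fun q : n.-tuple mR => tnth q (Ordinal kn) : R).
    exact: measurable_tnthR.
  by apply/funext => q; rewrite knotS// (tnth_nth 0).
have [kn|kn] := eqVneq k n.
  by rewrite (_ : (fun q => _) = cst 1)//; apply/funext => q; rewrite kn knot_last.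
rewrite (_ : (fun q => _) = cst 0)//; apply/funext => q.
by rewrite /knot nth_default//= size_rcons size_tuple; lia.
Qed.

Lemma measurable_gap n i : measurable_fun setT (fun q : n.-tuple mR => gap q i : R).
Proof. by apply: measurable_funB; exact: measurable_knot. Qed.

Lemma measurable_Qn n : measurable (Qn n : set (n.-tuple mR)).
Proof.
rewrite (_ : Qn n = \bigcap_(i in `I_n.+1) [set q : n.-tuple mR | 0 < gap q i]).
  apply: fin_bigcap_measurable => // i _.
  have := @measurable_gap n i measurableT _ (measurable_itv `]0, +oo[); rewrite setTI.
  by congr measurable; apply/seteqP; split => q /=; rewrite in_itv/= andbT.
by apply/seteqP; split => q /= => [/Qn_gapP h i|h]; [exact: h|apply/Qn_gapP => i; exact: h].
Qed.

Lemma EnP n (x : n.-tuple R) : En n x <->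
  forall i j : 'I_n, (i <= j)%N -> tnth x i <= tnth x j.
Proof.
split=> [h i j ij|h].
  rewrite !(tnth_nth 0); apply: (sorted_leq_nth (@le_trans _ _) (@lexx _ _)) => //;
    by rewrite inE size_tuple.
apply/(sortedP 0) => i; rewrite size_tuple => ni.
by have := h (Ordinal (ltnW ni)) (Ordinal ni) (leqnSn i); rewrite !(tnth_nth 0).
Qed.

Lemma measurable_En n : measurable (En n : set (n.-tuple mR)).
Proof.
rewrite (_ : En n = \bigcap_(p in [set: 'I_n * 'I_n])
   [set x : n.-tuple mR | (p.1 <= p.2)%N -> 0 <= (tnth x p.2 : R) - tnth x p.1]).
  apply: fin_bigcap_measurable => // -[i j] _ /=.
  have [ij|ij] := boolP (i <= j)%N; last first.
    by rewrite (_ : [set _ | _] = setT)//; apply/seteqP; split.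
  have mf : measurable_fun setT (fun x : n.-tuple mR => (tnth x j : R) - tnth x i).
    by apply: measurable_funB; exact: measurable_tnthR.
  have := mf measurableT _ (measurable_itv `[0, +oo[); rewrite setTI.
  congr measurable; apply/seteqP; split => q /=; rewrite in_itv/= andbT//.
  by move/(_ isT).
apply/seteqP; split => x /= => [/EnP h [i j] _ /= ij|h]; first by rewrite subr_ge0 h.
by apply/EnP => i j ij; rewrite -subr_ge0; exact: (h (i, j)).
Qed.

Definition wgt n (q : n.-tuple R) : R := \prod_(i < n.+1) gap q i.

Lemma measurable_wgt n : measurable_fun setT (fun q : n.-tuple mR => wgt q : R).
Proof. by apply: measurable_prod => i _; exact: measurable_gap. Qed.

(** The constraints on knots and values are put into the density, so that every stratum is
    integrated over a full product space, where Fubini applies directly. *)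
Definition dens n (p : n.-tuple R * n.+1.-tuple R) : R :=
  \1_(@Qn R n) p.1 * wgt p.1 * \1_(@En R n.+1) p.2.

Lemma dens_ge0 n (p : n.-tuple mR * n.+1.-tuple mR) : 0 <= dens p.
Proof.
rewrite /dens indicE; case: (boolP (_ \in _)) => [/set_mem /Qn_gapP q|_]; last by rewrite !mul0r.
by rewrite mul1r mulr_ge0// ?indicE//; apply: prodr_ge0 => i _; rewrite ltW// q// -ltnS.
Qed.

Lemma measurable_dens n :
  measurable_fun setT (fun p : n.-tuple mR * n.+1.-tuple mR => dens p : R).
Proof.
apply: measurable_funM; first apply: measurable_funM.
- have h : measurable_fun setT (@indic (n.-tuple mR) R (@Qn R n)).
    by apply: measurable_indic; exact: measurable_Qn.
  exact: measurableT_comp h measurable_fst.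
- exact: measurableT_comp (@measurable_wgt n) measurable_fst.
- have h : measurable_fun setT (@indic (n.+1.-tuple mR) R (@En R n.+1)).
    by apply: measurable_indic; exact: measurable_En.
  exact: measurableT_comp h measurable_snd.
Qed.

Lemma measurable_chi n :
  measurable_fun setT (fun p : n.-tuple mR * n.+1.-tuple mR => chi p.1 p.2).
Proof.
have := continuous_tuple_L2_measurable (@chi_continuous R n).
by rewrite (_ : (fun p => _) = (fun p : n.-tuple mR * n.+1.-tuple mR => chi p.1 p.2))//;
  apply/funext => p /=; rewrite !rvK.
Qed.

Definition prodM n : {measure set (n.-tuple mR * n.+1.-tuple mR) -> \bar R} :=
  (nuM n \x laM n.+1)%E.

Definition XinM n : {measure set (L2 R) -> \bar R} :=
  densityMeasure (prodM n) (@dens_ge0 n) (@measurable_dens n) (@measurable_chi n).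

Lemma XinE n (A : set (L2 R)) : measurable A -> Xin xi n A = XinM n A.
Proof.
move=> mA; rewrite densityMeasureE// /prodM.
have mchiA : measurable_fun setT (fun p : n.-tuple mR * n.+1.-tuple mR => \1_A (chi p.1 p.2) : R).
  exact: measurableT_comp (measurable_indic mA) (@measurable_chi n).
rewrite fubini_tonelli1/=; last 2 first.
- by apply/measurable_EFinP; apply: measurable_funM => //; exact: measurable_dens.
- by move=> p; rewrite lee_fin mulr_ge0 ?dens_ge0.
have nuE : tuple_measure (lebesgue_stieltjes_measure (ext01 xi)) n = nuM n :> (set _ -> _).
  exact: (tupleME xiM n).
have laE : tuple_measure lebesgue_measure n.+1 = laM n.+1 :> (set (n.+1.-tuple mR) -> _).
  exact: (tupleME lebM n.+1).
rewrite /Xin nuE [LHS]integral_mkcond; apply: eq_integral => q _.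
rewrite patchE /fubini_F; case: ifPn => [qQ|qQ]; last first.
  by rewrite integral0_eq// => x _; rewrite /dens indicE (negbTE qQ) !mul0r.
rewrite laE.
have w0 : 0 <= wgt q.
  by apply: prodr_ge0 => i _; rewrite ltW//; move/set_mem : qQ => /Qn_gapP; apply; rewrite -ltnS.
set S := [set x | _]; have mS : measurable (S : set (n.+1.-tuple mR)).
  apply: measurableI; first exact: measurable_En.
  have := measurableT_comp (@measurable_chi n) (pair1_measurable q).
  by move=> /(_ measurableT A mA); rewrite setTI.
rewrite -[X in laM n.+1 X]setIT -integral_indic//.
rewrite -ge0_integralZl//; last first.
  apply/measurable_EFinP; have : measurable_fun setT (@indic (n.+1.-tuple mR) R S).
    exact: measurable_indic.
  exact.
apply: eq_integral => x _; rewrite -EFinM; congr EFin.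
rewrite /dens /= [\1_(Qn n) q]indicE qQ mul1r -mulrA; congr (_ * _).
rewrite !indicE; have -> : (x \in S) = (x \in En n.+1) && (chi q x \in A).
  by apply/idP/andP; rewrite !inE.
by case: (_ \in En _); case: (_ \in A); rewrite ?mulr0 ?mul0r ?mul1r.
Qed.

Lemma XiE (A : set (L2 R)) : measurable A -> Xi xi A = mseries XinM 0 A.
Proof. by move=> mA; apply: eq_eseriesr => n _; rewrite XinE. Qed.

End Xi_measure.

Lemma ae_imp2 d (T : measurableType d) (R : realType)
    (mu : {measure set T -> \bar R}) (P1 P2 Q : T -> Prop) :
  (forall t, P1 t -> P2 t -> Q t) ->
  {ae mu, forall t, P1 t} -> {ae mu, forall t, P2 t} -> {ae mu, forall t, Q t}.
Proof. exact: filterS2. Qed.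

Lemma ae_imp3 d (T : measurableType d) (R : realType)
    (mu : {measure set T -> \bar R}) (P1 P2 P3 Q : T -> Prop) :
  (forall t, P1 t -> P2 t -> P3 t -> Q t) ->
  {ae mu, forall t, P1 t} -> {ae mu, forall t, P2 t} -> {ae mu, forall t, P3 t} ->
  {ae mu, forall t, Q t}.
Proof. exact: filterS3. Qed.

Lemma ae_negligible_sub d (T : measurableType d) (R : realType)
    (mu : {measure set T -> \bar R}) (P : T -> Prop) (S : set T) :
  (forall t, P t -> ~ S t) -> {ae mu, forall t, P t} -> mu.-negligible S.
Proof. by move=> PS; apply: negligibleS => t St Pt; exact: PS St. Qed.

Lemma ae_not_null d (T : measurableType d) (R : realType)
    (mu : {measure set T -> \bar R}) (P : T -> Prop) (S : set T) :
  measurable S -> mu S != 0%E -> {ae mu, forall t, P t} -> exists2 t, S t & P t.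
Proof.
move=> mS S0 HP; apply: contrapT => h; move/eqP : S0; apply.
have [N [mN N0 PN]] := HP; apply: subset_measure0 N0 => // t St; apply: PN => Pt.
by apply: h; exists t.
Qed.

Lemma ae_eq_of_le d (T : measurableType d) (R : realType)
    (mu : {measure set T -> \bar R}) (I : set T) (f g : T -> R) :
  measurable I -> mu.-integrable I (EFin \o f) -> mu.-integrable I (EFin \o g) ->
  {ae mu, forall t, I t -> f t <= g t} ->
  \int[mu]_(t in I) f t = \int[mu]_(t in I) g t ->
  {ae mu, forall t, I t -> f t = g t}.
Proof.
move=> mI fi gi fg e.
have gfi := integrableRB mI gi fi.
have mgf := measurable_int _ gfi.
have : (\int[mu]_(t in I) `|(g t - f t)%:E| = 0)%E.
  transitivity (\int[mu]_(t in I) (g t - f t)%:E)%E.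
    apply: ae_eq_integral => //; first exact: measurableT_comp.
    by apply: filterS fg => t fg It; rewrite gee0_abs// lee_fin subr_ge0 fg.
  have := RintegralB mI gi fi; rewrite e subrr /Rintegral => h.
  by rewrite -[LHS]fineK ?h//; exact: integrable_fin_num.
move/(ae_eq_integral_abs mu mI mgf).1; apply: filterS => t h It.
by have [] := h It; lra.
Qed.

(** * The projection and the operators at step functions *)

Section L2_of_chi.
Variable R : realType.
Notation mR := (measurableTypeR R).
Implicit Types (n : nat) (f g h : L2 R).

Lemma knot_locate n (q : n.-tuple R) (t : R) : 0 <= t -> t < 1 ->
  exists i : 'I_n.+1, knot q i <= t < knot q i.+1.
Proof.
move=> t0 t1; apply: contrapT => H.
have : forall i, (i <= n.+1)%N -> knot q i <= t.
  elim=> [|i IH] ni; first by rewrite knot0.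
  rewrite leNgt; apply/negP => ti; apply: H.
  by exists (Ordinal ni); rewrite ti IH// ltnW.
by move=> /(_ n.+1 (leqnn _)); rewrite knot_last leNgt t1.
Qed.

Lemma knot_disjoint n (q : n.-tuple R) (t : R) (i j : 'I_n.+1) : Qn n q ->
  knot q i <= t < knot q i.+1 -> knot q j <= t < knot q j.+1 -> i = j.
Proof.
move=> Q /andP[i1 i2] /andP[j1 j2]; apply: val_inj => /=.
have [ij|ij|//] := ltngtP i j.
  have := @knot_le _ _ q i.+1 j Q ij (ltnW (ltn_ord j)).
  by move=> /(lt_le_trans i2) /lt_le_trans /(_ j1); rewrite ltxx.
have := @knot_le _ _ q j.+1 i Q ij (ltnW (ltn_ord i)).
by move=> /(lt_le_trans j2) /lt_le_trans /(_ i1); rewrite ltxx.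
Qed.

Lemma sum_indic_knot n (q : n.-tuple R) (c : 'I_n.+1 -> R) (t : R) (i : 'I_n.+1) : Qn n q ->
  knot q i <= t < knot q i.+1 ->
  \sum_(j < n.+1) c j * \1_`[knot q j, knot q j.+1[ t = c i.
Proof.
move=> Q ti; rewrite (bigD1 i)//= big1 ?addr0 => [|j ji].
  by rewrite indicE mem_setE in_itv/= ti mulr1.
have [tj|tj] := boolP (knot q j <= t < knot q j.+1).
  by move: ji; rewrite (knot_disjoint Q tj ti) eqxx.
by rewrite indicE mem_setE in_itv/= (negbTE tj) mulr0.
Qed.

Lemma stepf_itv n (q : n.-tuple R) (x : n.+1.-tuple R) (t : R) (i : 'I_n.+1) : Qn n q ->
  knot q i <= t < knot q i.+1 -> stepf q x t = tnth x i.
Proof.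
move=> Q ti; rewrite /stepf (sum_indic_knot _ Q ti) indicE memNset ?mulr0 ?addr0//=.
move=> t1; move: ti; rewrite t1 => /andP[_].
by apply/negP; rewrite -leNgt knot_le1.
Qed.

Lemma comb_ae n (q : n.-tuple R) (c : 'I_n.+1 -> R) : Qn n q ->
  {ae leb01 R, forall t, forall i : 'I_n.+1, knot q i <= t < knot q i.+1 -> comb q c t = c i}.
Proof.
move=> Q.
have H1 : {ae leb01 R, forall t, forall i : 'I_n.+1,
    L2fun (c i *: stepL2 q i) t = c i * \1_`[knot q i, knot q i.+1[ t}.
  apply: ae_forall_ord => i.
  apply: ae_imp2 (L2ZE (c i) (stepL2 q i)) (indicL2E (leb01_lty measurableT) (measurable_itv `[knot q i, knot q i.+1[)).
  by move=> t -> ->.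
apply: ae_imp2 H1 (L2_sumE (fun i => c i *: stepL2 q i)) => t h e i ti.
rewrite /comb e -(sum_indic_knot c Q ti); apply: eq_bigr => j _; exact: h.
Qed.

(** On each step the coefficient is the mean of [h]; this is the orthogonal projection onto the step
    functions with knots [q]. *)
Definition prj n (q : n.-tuple R) (h : L2 R) : L2 R :=
  comb q (fun i => (gap q i)^-1 * dot h (stepL2 q i)).

Lemma gap_gt0 n (q : n.-tuple R) (i : 'I_n.+1) : Qn n q -> 0 < gap q i.
Proof. by move=> /Qn_gapP; apply; rewrite -ltnS. Qed.

Lemma dot_prj_stepL2 n (q : n.-tuple R) h (i : 'I_n.+1) : Qn n q ->
  dot (prj q h) (stepL2 q i) = dot h (stepL2 q i).
Proof.
move=> Q; rewrite /prj dot_comb_stepL2// mulrAC mulVf ?mul1r//.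
by rewrite gt_eqF// gap_gt0.
Qed.

Lemma prj_comb n (q : n.-tuple R) (c : 'I_n.+1 -> R) : Qn n q -> prj q (comb q c) = comb q c.
Proof.
move=> Q; apply: eq_bigr => i _; rewrite dot_comb_stepL2// mulrCA mulVf ?mulr1//.
by rewrite gt_eqF// gap_gt0.
Qed.

Lemma tnth_En0_inj n (x : n.-tuple R) : En0 n x -> injective (tnth x).
Proof.
move=> Ex; apply/tuple_uniqP; apply: sorted_uniq Ex; [exact: lt_trans|exact: ltxx].
Qed.

(** Strictly increasing values identify the step: the steps on which [c] takes values in [Y] are, up
    to a null set, the preimage under [chi q x] of a finite set of values. *)
Lemma comb_L2_of n (q : n.-tuple R) (x : n.+1.-tuple R) (c : 'I_n.+1 -> R) :
  Qn n q -> En0 n.+1 x -> L2_of (chi q x) (comb q c).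
Proof.
move=> Q Ex Y mY; split; first by move=> t [].
pose Z : set mR := tnth x @` [set i | Y (c i)].
exists (`[0, 1] `&` (chi q x : R -> R) @^-1` Z).
  exists Z => //; apply: countable_measurable; first exact: measurable_set1.
  exact/finite_set_countable/finite_image.
rewrite chi_comb in Z *.
apply: ae_negligible_sub (ae_imp3 _ (comb_ae c Q) (comb_ae (tnth x) Q) (@ae_leb01 R)) => [t|t h1 h2 h3]; first exact.
have [i ti] : exists i : 'I_n.+1, knot q i <= t < knot q i.+1.
  by apply: knot_locate; move: h3; rewrite /= in_itv/= => /andP[].
move: (h1 i ti) (h2 i ti) => {}h1 {}h2.
have E : Y (comb q c t) <-> Z (comb q (tnth x) t).
  rewrite h1 h2; split => [Yc|]; first by exists i.
  by move=> [j Yj /(tnth_En0_inj Ex) <-].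
by move=> -[[[A1 A2] B]|[[A1 A2] B]]; apply: B; split => //; apply/E.
Qed.

(* Each level set of [f] agrees a.e. with a union of steps, so on a step either
   [f <= m] a.e. or [m <= f] a.e. for the mean [m] of [f], whence equality. *)
Lemma L2_of_chi_prj n (q : n.-tuple R) (x : n.+1.-tuple R) f :
  Qn n q -> L2_of (chi q x) f -> f = prj q f.
Proof.
move=> Q fx; apply: L2P.
suff H : {ae leb01 R, forall t, forall i : 'I_n.+1, knot q i <= t < knot q i.+1 ->
    f t = (gap q i)^-1 * dot f (stepL2 q i)}.
  apply: ae_imp3 (comb_ae (fun i => (gap q i)^-1 * dot f (stepL2 q i)) Q) H (@ae_leb01 R).
  move=> t h1 h2 h3 _.
  have [i ti] : exists i : 'I_n.+1, knot q i <= t < knot q i.+1.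
    by apply: knot_locate; move: h3; rewrite /= in_itv/= => /andP[].
  by rewrite (h2 i ti) /prj (h1 i ti).
apply: ae_forall_ord => i.
pose m := (gap q i)^-1 * dot f (stepL2 q i); rewrite -/m.
pose I : set mR := `[knot q i, knot q i.+1[%classic.
have mI : measurable I by exact: measurable_itv.
have If : (leb01 R).-integrable I (EFin \o f).
  by apply: integrableS (integrable_L2 (leb01_lty measurableT) f).
have Im : (leb01 R).-integrable I (EFin \o cst m).
  apply: (@bounded_integrable _ _ _ _ _ _ `|m|) => //.
  exact: (leb01_lty mI).
have Iint : \int[leb01 R]_(t in I) f t = \int[leb01 R]_(t in I) cst m t.
  have k0 : 0 <= knot q i by apply: knot_ge0 => //; rewrite ltnW.
  have k1 : knot q i.+1 <= 1 by apply: knot_le1.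
  rewrite -(dot_indicL2 (leb01_lty measurableT) f mI) Rintegral_cst//.
  have k01 : knot q i <= knot q i.+1 by rewrite ltW// -subr_gt0 gap_gt0.
  rewrite (leb01_itv k0 k01 k1)/=.
  rewrite -/(gap q i) /m mulrAC mulVf ?mul1r; last by rewrite gt_eqF// gap_gt0.
  (* The two classes differ only in the proof that the interval is measurable. *)
  by congr (dot f (indicL2 _ _)); exact: Prop_irrelevance.
suff [h|h] : {ae leb01 R, forall t, I t -> f t <= m} \/ {ae leb01 R, forall t, I t -> m <= f t}.
- exact: ae_eq_of_le mI If Im h Iint.
- have := ae_eq_of_le mI Im If h (esym Iint).
  by apply: ae_imp => t e It; rewrite -(e It).
have [_ [B [Z mZ BE] neg]] := fx `]-oo, m]%classic (measurable_itv _).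
rewrite chi_comb in BE.
have H : {ae leb01 R, forall t, I t -> (f t <= m <-> Z (tnth x i))}.
  have {}neg : {ae leb01 R, forall t, ~ (((`[0, 1] `&` f @^-1` `]-oo, m]%classic) `+` B) t)}.
    by move: neg; apply: negligibleS => t /contrapT.
  apply: ae_imp3 neg (comb_ae (tnth x) Q) (@ae_leb01 R) => t tn tx t01 It.
  have {}tx := tx i It; have t01' : `[0, 1]%classic t.
    by move: t01; rewrite /= !in_itv/= => /andP[-> /ltW].
  have tB : B t <-> Z (tnth x i) by rewrite -BE -tx; split => [[]|].
  rewrite -tB; split => [ft|Bt]; apply: contrapT => nt; apply: tn.
    by left; split => //; split => //=; rewrite in_itv.
  by right; split => // -[_] /=; rewrite in_itv.
have [Zi|Zi] := pselect (Z (tnth x i)); [left|right]; apply: ae_imp H => t h It; first exact/(h It).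
by rewrite leNgt; apply/negP => /ltW /(h It).
Qed.

Lemma comb_delta n (q : n.-tuple R) (i : 'I_n.+1) : comb q (fun j => (j == i)%:R) = stepL2 q i.
Proof.
rewrite /comb (bigD1 i)//= eqxx scale1r big1 ?addr0// => j /negbTE ->.
by rewrite scale0r.
Qed.

(** [prj q h] is a witness for the choice in [pr]. Any other candidate is a step function with the
    same knots, determined by its pairings with the steps. *)
Lemma pr_chi n (q : n.-tuple R) (x : n.+1.-tuple R) h :
  Qn n q -> En0 n.+1 x -> pr (chi q x) h = prj q h.
Proof.
move=> Q Ex; rewrite /pr; case: xgetP => [p _ [px hp]|/(_ (prj q h)) H].
  rewrite (L2_of_chi_prj Q px) /prj; apply: eq_bigr => i _; congr (_ * _ *: _).
  have := hp _ (comb_L2_of (fun j => (j == i)%:R) Q Ex).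
  by rewrite comb_delta dotBl => /eqP; rewrite subr_eq0 => /eqP.
exfalso; apply: H; split; first exact: comb_L2_of.
move=> f fx; rewrite (L2_of_chi_prj Q fx) dot_sumr big1 // => i _.
by rewrite dotZr dotBl dot_prj_stepL2// subrr mulr0.
Qed.

(** The symmetry of the right-hand side in [h] and [k] makes the projection self-adjoint; the
    formula also exhibits the weighted Euclidean product of two gradients. *)
Lemma dot_prj_sym n (q : n.-tuple R) h k : dot (prj q h) k = \sum_(i < n.+1) (gap q i)^-1 * dot h (stepL2 q i) * dot k (stepL2 q i).
Proof. by rewrite /prj /comb dot_suml; apply: eq_bigr => i _; rewrite dotZl (dotC k). Qed.

End L2_of_chi.

Section L0_chi.
Variable R : realType.
Notation mR := (measurableTypeR R).
Implicit Types (U : L2 R -> R) (G : L2 R -> L2 R) (H : L2 R -> L2 R -> R).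

Lemma grad_nice U G H g : nice U G H -> grad U g = G g.
Proof.
move=> nU; rewrite /grad; have := nice_diff nU g => dU.
case: xgetP => [v _ [_ vP]|/(_ (G g)) []]; last first.
  by split; [exact: ex_diff|move=> k; rewrite diff_val].
by apply: dot_eq => k; rewrite -vP diff_val.
Qed.

Lemma ae_itv_witness (P : R -> Prop) (a b : R) : 0 <= a -> a < b -> b <= 1 ->
  {ae leb01 R, forall t, P t} -> exists t, (a <= t < b) /\ P t.
Proof.
move=> a0 ab b1 HP.
have [t It Pt] : exists2 t : mR, `[a, b[%classic t & P t.
  apply: ae_not_null HP; first exact: measurable_itv.
  by rewrite (leb01_itv a0 (ltW ab) b1) eqe subr_eq0 gt_eqF.
by exists t; split => //; move: It; rewrite /= in_itv.
Qed.

Lemma chi_eq_ae n m (q : n.-tuple R) (x : n.+1.-tuple R) (p : m.-tuple R) (y : m.+1.-tuple R) :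
  Qn n q -> Qn m p -> chi q x = chi p y ->
  {ae leb01 R, forall t, forall (i : 'I_n.+1) (j : 'I_m.+1),
    knot q i <= t < knot q i.+1 -> knot p j <= t < knot p j.+1 -> tnth x i = tnth y j}.
Proof.
move=> Q P; rewrite !chi_comb => e.
apply: ae_imp2 (comb_ae (tnth x) Q) (comb_ae (tnth y) P) => t h1 h2 i j ti tj.
by rewrite -(h1 i ti) -(h2 j tj) e.
Qed.

(** A knot [t] of [p] that is not a knot of [q] is interior to one step of [q]. Comparing the two
    functions at typical points just before and just after [t] gives equal values on two
    neighbouring steps of [p], against strictness. *)
Lemma chi_knots_sub n m (q : n.-tuple R) (x : n.+1.-tuple R) (p : m.-tuple R) (y : m.+1.-tuple R) :
  Qn n q -> Qn m p -> En0 m.+1 y -> chi q x = chi p y -> {subset p <= q}.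
Proof.
move=> Q P Ey e t /(nthP 0)[j]; rewrite size_tuple => jm.
rewrite -(knotS p jm) => tE.
have j1 : (j.+1 < m.+1)%N by [].
have p0 : knot p j < t by rewrite -tE -subr_gt0 (gap_gt0 (Ordinal (ltnW j1)) P).
have p2 : t < knot p j.+2 by rewrite -tE -subr_gt0 (gap_gt0 (Ordinal j1) P).
have pj0 : 0 <= knot p j by apply: knot_ge0 => //; rewrite ltnW// ltnW.
have pj2 : knot p j.+2 <= 1 by apply: knot_le1.
have [i /andP[qi qi1]] : exists i : 'I_n.+1, knot q i <= t < knot q i.+1.
  by apply: knot_locate; [apply: le_trans (ltW p0)|apply: lt_le_trans p2 _].
have [qit|qit] := eqVneq (knot q i) t.
  case: i qi qi1 qit => [[|i] ni]/= _ _ qit.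
    by move: p0; rewrite -qit knot0 ltNge pj0.
  rewrite -qit knotS; last by move: ni; rewrite ltnS.
  by apply/mem_nth; rewrite size_tuple; move: ni; rewrite ltnS.
have {qit}qi : knot q i < t by rewrite lt_neqAle qit.
have H := chi_eq_ae Q P e.
have q0 : 0 <= knot q i by apply: knot_ge0 => //; rewrite ltnW.
have [s [/andP[]]] : exists s, (Num.max (knot q i) (knot p j) <= s < t) /\
    forall (i : 'I_n.+1) (j : 'I_m.+1),
    knot q i <= s < knot q i.+1 -> knot p j <= s < knot p j.+1 -> tnth x i = tnth y j.
  apply: ae_itv_witness H; first by rewrite le_max q0.
    by rewrite gt_max qi.
  by rewrite (le_trans (ltW p2)).
rewrite ge_max => /andP[s1 s2] st /(_ i (Ordinal (ltnW j1))) /=.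
rewrite s1 s2 tE st (lt_trans st qi1) => /(_ isT isT) e1.
have [r [/andP[]]] : exists r, (t <= r < Num.min (knot q i.+1) (knot p j.+2)) /\
    forall (i : 'I_n.+1) (j : 'I_m.+1),
    knot q i <= r < knot q i.+1 -> knot p j <= r < knot p j.+1 -> tnth x i = tnth y j.
  apply: ae_itv_witness H; first by rewrite (le_trans q0)// ltW.
    by rewrite lt_min qi1.
  by rewrite ge_min pj2 orbT.
rewrite lt_min => r1 /andP[r2 r3] /(_ i (Ordinal j1)) /=.
rewrite r2 r3 tE r1 (le_trans (ltW qi) r1) => /(_ isT isT).
by rewrite e1 => /(tnth_En0_inj Ey) /(congr1 val) /= /eqP; rewrite ltn_eqF.
Qed.

Lemma Qn_sorted n (q : n.-tuple R) : Qn n q -> sorted <%R q.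
Proof. by rewrite /Qn /= rcons_path => /andP[/path_sorted]. Qed.

(** Equality is stated between underlying sequences, since the equality of [n] and [m] is part of
    what is proved. *)
Lemma chi_inj n m (q : n.-tuple R) (x : n.+1.-tuple R) (p : m.-tuple R) (y : m.+1.-tuple R) :
  Qn n q -> Qn m p -> En0 n.+1 x -> En0 m.+1 y -> chi q x = chi p y ->
  tval q = tval p /\ tval x = tval y.
Proof.
move=> Q P Ex Ey e.
have qp : tval q = tval p.
  apply: lt_sorted_eq; [exact: Qn_sorted|exact: Qn_sorted|] => t.
  by apply/idP/idP; [exact: (chi_knots_sub P Q Ex (esym e))|exact: (chi_knots_sub Q P Ey e)].
split => //; have nm : n = m by rewrite -(size_tuple q) qp size_tuple.
subst m; have {qp}pq : q = p by exact: val_inj.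
subst p; congr tval; apply: eq_from_tnth => i.
apply: (mulIf (lt0r_neq0 (gap_gt0 i Q))).
by rewrite -!(dot_comb_stepL2 _ _ Q) -!chi_comb e.
Qed.

Lemma chi_upd n (q : n.-tuple R) (x : n.+1.-tuple R) (i : 'I_n.+1) (s : R) : Qn n q ->
  chi q (upd x i s) = (chi q x - tnth x i *: stepL2 q i) + s *: stepL2 q i.
Proof.
move=> Q; rewrite !chi_comb /comb (bigD1 i)//= [in RHS](bigD1 i)//=.
rewrite [_ *: _ + _ in RHS]addrC addrK tnth_mktuple eqxx addrC; congr (_ + _).
by apply: eq_bigr => j /negbTE ji; rewrite tnth_mktuple ji.
Qed.

Lemma nice_derive1n2 U G H (g a : L2 R) (s : R) : nice U G H ->
  derive1n 2 (fun t => U (g + t *: a)) s = H (g + s *: a) a.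
Proof.
move=> nU.
have e1 : derive1 (fun t => U (g + t *: a)) = (fun t => dot (G (g + t *: a)) a).
  apply/funext => t; have := is_diff_derive a (nice_diff nU (g + t *: a)) => d.
  have := line_is_derive (@ex_derive _ _ _ _ _ _ _ d) => d2.
  by rewrite derive1E (@derive_val _ _ _ _ _ _ _ d2) (@derive_val _ _ _ _ _ _ _ d).
rewrite /derive1n /= e1.
have := nice_derive nU (g + s *: a) a => d.
have := line_is_derive (@ex_derive _ _ _ _ _ _ _ d) => d2.
by rewrite derive1E (@derive_val _ _ _ _ _ _ _ d2) (@derive_val _ _ _ _ _ _ _ d).
Qed.

Lemma L0_chi U G H n (q : n.-tuple R) (x : n.+1.-tuple R) : nice U G H ->
  Qn n q -> En0 n.+1 x ->
  L0 U (chi q x) = \sum_(i < n.+1) (gap q i)^-1 * H (chi q x) (stepL2 q i).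
Proof.
move=> nU Q Ex.
have E m (p : m.-tuple R) (y : m.+1.-tuple R) : Qn m p ->
    \sum_(i < m.+1) (gap p i)^-1 * derive1n 2 (fun s => U (chi p (upd y i s))) (tnth y i) =
    \sum_(i < m.+1) (gap p i)^-1 * H (chi p y) (stepL2 p i).
  move=> P; apply: eq_bigr => i _; congr (_ * _).
  under [X in derive1n 2 X]funext do rewrite chi_upd//.
  by rewrite (nice_derive1n2 _ _ _ nU) subrK.
rewrite /L0; case: xgetP => [v _ [m [p [y [P Ey e ->]]]]|/(_ _) h]; last first.
  exfalso; apply: h; exists n, q, x; split; [exact: Q|exact: Ex|by []|].
  by rewrite E.
rewrite E//; have [qp xy] := chi_inj Q P Ex Ey e.
have nm : n = m by rewrite -(size_tuple q) qp size_tuple.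
subst m; have <- : q = p by exact: val_inj.
by have <- : x = y by exact: val_inj.
Qed.

Lemma Dgrad_chi U G H n (q : n.-tuple R) (x : n.+1.-tuple R) : nice U G H ->
  Qn n q -> En0 n.+1 x -> Dgrad U (chi q x) = prj q (G (chi q x)).
Proof. by move=> nU Q Ex; rewrite /Dgrad pr_chi// (grad_nice _ nU). Qed.

End L0_chi.

(** * Step functions whose knots lie in the support of d xi *)

Section chi_L2up_of.
Variables (R : realType) (xi : bddDup R).
Notation mR := (measurableTypeR R).

Lemma chi_aeE n (q : n.-tuple R) (x : n.+1.-tuple R) : Qn n q ->
  {ae leb01 R, forall t, forall i : 'I_n.+1, knot q i <= t < knot q i.+1 -> chi q x t = tnth x i}.
Proof. by move=> Q; rewrite chi_comb; exact: comb_ae. Qed.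

Lemma stepf1 n (q : n.-tuple R) (x : n.+1.-tuple R) : Qn n q -> stepf q x 1 = tnth x ord_max.
Proof.
move=> Q; rewrite /stepf big1 ?add0r; last first.
  move=> i _; rewrite indicE memNset ?mulr0//= in_itv/= => /andP[_].
  by rewrite ltNge knot_le1.
by rewrite indicE mem_set// mulr1.
Qed.

Lemma knot_locate_left n (q : n.-tuple R) (t : R) : 0 < t -> t <= 1 ->
  exists i : 'I_n.+1, knot q i < t <= knot q i.+1.
Proof.
move=> t0 t1; apply: contrapT => H.
have : forall i, (i <= n.+1)%N -> knot q i < t.
  elim=> [|i IH] ni; first by rewrite knot0.
  rewrite ltNge; apply/negP => ti; apply: H.
  by exists (Ordinal ni); rewrite ti IH// ltnW.
by move=> /(_ n.+1 (leqnn _)); rewrite knot_last ltNge t1.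
Qed.

Lemma knot_index_le n (q : n.-tuple R) (i j : 'I_n.+1) (s t : R) : Qn n q ->
  knot q i <= s -> t < knot q j.+1 -> s <= t -> (i <= j)%N.
Proof.
move=> Q si tj st; rewrite leqNgt; apply/negP => ji.
have := @knot_le _ _ q j.+1 i Q ji (ltnW (ltn_ord i)).
by move=> /(lt_le_trans tj) /lt_le_trans /(_ si); rewrite ltNge st.
Qed.

Lemma stepf_Dup n (q : n.-tuple R) (x : n.+1.-tuple R) : Qn n q -> En n.+1 x ->
  Dup (EFin \o stepf q x).
Proof.
move=> Q Ex; split.
- move=> s t; rewrite !in_itv/= => /andP[s0 s1] /andP[t0 t1] st; rewrite lee_fin.
  have [->|tn1] := eqVneq t 1.
    have [->//|sn1] := eqVneq s 1.
    have {}s1 : s < 1 by rewrite lt_neqAle sn1.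
    have [i si] := knot_locate q s0 s1; rewrite (stepf_itv _ Q si) stepf1//.
    by apply: (EnP x).1 => //; rewrite -ltnS.
  have {}t1 : t < 1 by rewrite lt_neqAle tn1.
  have [i si] := knot_locate q s0 (le_lt_trans st t1).
  have [j tj] := knot_locate q t0 t1.
  rewrite (stepf_itv _ Q si) (stepf_itv _ Q tj); apply: (EnP x).1 => //.
  move: si tj => /andP[si _] /andP[_ tj]; exact: knot_index_le Q si tj st.
- move=> t; rewrite in_itv/= => /andP[t0 t1].
  have [i ti] := knot_locate q t0 t1; apply: cvg_near_cst.
  rewrite /= (stepf_itv _ Q ti); move: ti => /andP[ti1 ti2].
  near=> s; rewrite (@stepf_itv _ _ _ _ s i Q)//; apply/andP; split.
    by apply: le_trans ti1 _; near: s; exact: nbhs_right_ge.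
  by near: s; exact: nbhs_right_lt.
- move=> t; rewrite in_itv/= => /andP[t0 t1].
  have [i /andP[ti1 ti2]] := knot_locate_left q t0 t1.
  apply/cvg_ex; exists (tnth x i)%:E; apply: cvg_near_cst.
  near=> s; rewrite /= (@stepf_itv _ _ _ _ s i Q)//; apply/andP; split.
    by near: s; exact: nbhs_left_ge.
  by apply: lt_le_trans ti2; near: s; exact: nbhs_left_lt.
- apply: cvg_near_cst; rewrite /= stepf1//.
  have gn := gap_gt0 (@ord_max n) Q; rewrite /gap /= knot_last subr_gt0 in gn.
  near=> s; rewrite (@stepf_itv _ _ _ _ s ord_max Q)//=; apply/andP; split.
    by near: s; exact: nbhs_left_ge.
  by rewrite knot_last; near: s; exact: nbhs_left_lt.
Unshelve. all: by end_near. Qed.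

Lemma chi_L2up n (q : n.-tuple R) (x : n.+1.-tuple R) : Qn n q -> En n.+1 x ->
  @L2up R (chi q x).
Proof.
move=> Q Ex; exists (EFin \o stepf q x); first exact: stepf_Dup.
by apply: ae_imp (to_L2E (stepf_Lfun q x)) => t /(_ I) e _; rewrite /= e.
Qed.

(* The complement of the support of [d xi] (in the open line), as a countable
   union of intervals on which [xi] is constant. *)
Definition flat (k : R) : Prop :=
  exists s t : rat, ratr s < k < ratr t /\ ext01 xi (ratr s) = ext01 xi (ratr t).

Lemma not_flatP k : ~ flat k -> forall s t, s < k -> k < t -> ext01 xi s < ext01 xi t.
Proof.
move=> nf s t sk kt; rewrite lt_neqAle ext01_nd ?andbT; last exact: ltW (lt_trans sk kt).
apply/eqP => e; apply: nf.
have [a /[!in_itv]/= /andP[sa ak]] := rat_in_itvoo sk.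
have [b /[!in_itv]/= /andP[kb bt]] := rat_in_itvoo kt.
exists a, b; split; first by rewrite ak.
have ab := ltW (lt_trans ak kb).
apply/eqP; rewrite eq_le ext01_nd//=.
by rewrite (le_trans (ext01_nd xi (ltW bt)))// -e ext01_nd// ltW.
Qed.

(** The half-line before [k] can be read off the value of [xi]. If [xi] is constant on some [s, k],
    it exceeds [xi k] strictly after [k] and a closed half-line of values works; otherwise it is
    below [xi k] strictly before [k] and an open one does. *)
Lemma not_flat_section k : ~ flat k -> exists2 W : set mR, measurable W &
  forall t, t != k -> W (ext01 xi t) <-> t < k.
Proof.
move=> nf; have [[s sk e]|h] := pselect (exists2 s, s < k & ext01 xi s = ext01 xi k).
  exists [set` `]-oo, ext01 xi k]]; first exact: measurable_itv.
  move=> t tk; rewrite /= in_itv/=; split => [|/ltW]; last exact: ext01_nd.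
  move=> h; rewrite lt_neqAle tk /= leNgt; apply/negP => kt.
  by have := not_flatP nf sk kt; rewrite e ltNge h.
exists [set` `]-oo, ext01 xi k[]; first exact: measurable_itv.
move=> t tk; rewrite /= in_itv/=; split => [|kt].
  by apply: contraTT; rewrite -!leNgt => /ext01_nd.
rewrite lt_neqAle ext01_nd ?andbT; last exact: ltW.
by apply/eqP => e; apply: h; exists t.
Qed.

Lemma ae_neq (k : R) : {ae leb01 R, forall t, t != k}.
Proof.
exists [set k]; split; [exact: measurable_set1|exact: leb01_set1|].
by move=> t /= /negP/negPn/eqP.
Qed.

Lemma chi_L2_of n (q : n.-tuple R) (x : n.+1.-tuple R) : Qn n q ->
  (forall i, (i < n)%N -> ~ flat (knot q i.+1)) -> L2_of (bddDup_L2 xi) (chi q x).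
Proof.
move=> Q nf Y mY; split; first by move=> t [].
(* The end knots 0 and 1 are included, with the empty set and the full set of values; a step is then
   the difference of two consecutive sections. *)
have /choice[W HW] : forall i : 'I_n.+2, exists W : set mR, measurable W /\
    {ae leb01 R, forall t, W (ext01 xi t) <-> t < knot q i}.
  move=> [[|i] ni]; rewrite /=.
    exists set0; split => //; apply: ae_imp (@ae_leb01 R) => t.
    by rewrite in_itv/= knot0 => /andP[t0 _]; split => //; rewrite ltNge t0.
  have [in_|ni'] := ltnP i n.
    have [W mW HW] := not_flat_section (nf _ in_); exists W; split => //.
    apply: ae_imp (ae_neq (knot q i.+1)) => t; exact: HW.
  have -> : i = n by apply/eqP; rewrite eqn_leq ni' andbT -2!ltnS.
  exists setT; split => //; apply: ae_imp (@ae_leb01 R) => t.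
  by rewrite in_itv/= knot_last => /andP[_].
pose Z : set mR := \bigcup_(i in [set i : 'I_n.+1 | Y (tnth x i)])
  (W (lift ord0 i) `\` W (widen_ord (leqnSn _) i)).
exists (`[0, 1] `&` (bddDup_L2 xi : R -> R) @^-1` Z).
  exists Z => //; apply: fin_bigcup_measurable => // i _.
  by apply: measurableD; apply: (HW _).1.
have H := ae_forall_ord (fun i => (HW i).2).
apply: ae_negligible_sub (ae_imp3 _ (chi_aeE x Q) H
  (ae_imp2 (fun t a b => conj a b) (@ae_leb01 R) (to_L2E (ext01_Lfun xi)))) => [t|t h1 h2 h3]; first exact.
move: h3 => [t01 /(_ I)]; rewrite -/(bddDup_L2 xi) => xit.
have [i ti] : exists i : 'I_n.+1, knot q i <= t < knot q i.+1.
  by apply: knot_locate; move: t01; rewrite /= in_itv/= => /andP[].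
have E : Y (chi q x t) <-> Z (bddDup_L2 xi t).
  rewrite (h1 i ti) xit; split => [Yi|[j Yj [W1 W2]]].
    exists i => //; move: ti => /andP[ti1 ti2]; split; first exact/h2.
    by move/h2; rewrite /= ltNge ti1.
  rewrite (@knot_disjoint _ _ q t i j)//; apply/andP; split; last exact/(h2 (lift ord0 j)).
  by rewrite leNgt; apply/negP => /(h2 (widen_ord (leqnSn _) j)).
by move=> -[[[A1 A2] B]|[[A1 A2] B]]; apply: B; split => //; apply/E.
Qed.

Lemma chi_L2up_of n (q : n.-tuple R) (x : n.+1.-tuple R) : Qn n q -> En n.+1 x ->
  (forall i, (i < n)%N -> ~ flat (knot q i.+1)) -> L2up_of (bddDup_L2 xi) (chi q x).
Proof. by move=> Q Ex nf; split; [exact: chi_L2_of|exact: chi_L2up]. Qed.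

End chi_L2up_of.

(** * Measurability of the integrands *)

Section measurable_image.
Variable R : realType.
Notation mR := (measurableTypeR R).

Lemma closed_L2_measurable (A : set (L2 R)) : closed A -> measurable A.
Proof.
move=> cA; rewrite -[A]setCK; apply: measurableC.
by apply: sub_sigma_algebra; exact: closed_openC.
Qed.

Lemma closed_ge_cont (T : topologicalType) (f : T -> R) (a : R) : continuous f ->
  closed [set p | a <= f p].
Proof.
move=> cf; have -> : [set p | a <= f p] = f @^-1` `[a, +oo[%classic.
  by apply/seteqP; split => p /=; rewrite in_itv/= andbT.
by move/continuous_closedP : cf; apply; exact: interval_closed.
Qed.

(* Restricting to a compact set makes the image of a superlevel set compact, which
   yields the measurability of [F] on the image of [c] although [c] has no
   continuous inverse. *)
Lemma closed_superlevel_image (T : topologicalType) (C : set T) (c : T -> L2 R) (f : T -> R)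
    (F : L2 R -> R) (a : R) : compact C -> continuous c ->
  (forall p, C p -> {for p, continuous f} /\ F (c p) = f p) ->
  closed [set g | (c @` C) g /\ a <= F g].
Proof.
move=> kC cc Ff; pose Phi (p : T) : L2 R * R := (c p, f p).
have kPhi : compact (Phi @` C).
  apply: continuous_compact kC; apply: continuous_in_subspaceT => p /set_mem Cp.
  have h1 : c z @[z --> p] --> c p := cc p.
  have h2 : f z @[z --> p] --> f p := (Ff p Cp).1.
  exact: (cvg_pair h1 h2).
have cl : closed [set z : L2 R * R | a <= z.2].
  by apply: closed_ge_cont => z; exact: cvg_snd.
have k2 := compact_closedI kPhi cl.
have k3 : compact (fst @` (Phi @` C `&` [set z : L2 R * R | a <= z.2])).
  apply: continuous_compact k2; apply: continuous_subspaceT => z; exact: cvg_fst.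
rewrite (_ : [set g | _] = fst @` (Phi @` C `&` [set z : L2 R * R | a <= z.2])).
  by apply: compact_closed => //; exact: norm_hausdorff.
apply/seteqP; split => g /=.
  move=> [[p Cp <-] aF]; exists (Phi p) => //; split; first by exists p.
  by rewrite /= -(Ff p Cp).2.
by move=> [_ [[p Cp <-] /= af] <-]; split; [exists p|rewrite (Ff p Cp).2].
Qed.

Variable xi : bddDup R.

Lemma open_flat : open (flat xi).
Proof.
have -> : flat xi = \bigcup_(p in [set p : rat * rat | ext01 xi (ratr p.1) = ext01 xi (ratr p.2)])
    `](ratr p.1 : R), (ratr p.2 : R)[%classic.
  apply/seteqP; split => k /=.
    by move=> [s [t [kst e]]]; exists (s, t) => //=; rewrite in_itv.
  by move=> [[s t] /= e]; rewrite in_itv/= => kst; exists s, t.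
by apply: bigcup_open => p _; exact: interval_open.
Qed.

Definition good n (p : n.-tuple R * n.+1.-tuple R) : Prop :=
  [/\ Qn n p.1, En0 n.+1 p.2 & forall i, (i < n)%N -> ~ flat xi (knot p.1 i.+1)].

(** The strict inequalities of [good] are replaced by margins 1 / (k + 1) and the values are bounded
    by [k]. All conditions are closed, the one on [flat] because that set is open. *)
Definition good_compact n (k : nat) : set ('rV[R]_n * 'rV[R]_n.+1) :=
  [set p | ([set q : 'rV[R]_n | forall i, `[(0 : R), 1]%classic (q 0 i)] `*`
            [set x : 'rV[R]_n.+1 | forall i, `[(- k%:R : R), k%:R]%classic (x 0 i)]) p /\
    [/\ (forall i : 'I_n.+1, k.+1%:R^-1 <= gap (tup p.1) i),
        (forall i : 'I_n, ~ flat xi (knot (tup p.1) i.+1)) &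
        forall i : 'I_n, k.+1%:R^-1 <= p.2 0 (lift ord0 i) - p.2 0 (widen_ord (leqnSn _) i)]].

Lemma good_compact_compact n k : compact (@good_compact n k).
Proof.
apply: compact_closedI.
  apply: compact_setX.
    by apply: (@rV_compact R n (fun=> `[0, 1]%classic)) => i; exact: segment_compact.
  apply: (@rV_compact R n.+1 (fun=> `[- k%:R, k%:R]%classic)) => i; exact: segment_compact.
have c1 (i : 'I_n.+1) : closed [set p : 'rV[R]_n * 'rV[R]_n.+1 | k.+1%:R^-1 <= gap (tup p.1) i].
  apply: closed_ge_cont; exact: (continuousF_comp (@continuousF_fst _ _) (@gap_continuous R n i)).
have c2 (i : 'I_n) : closed [set p : 'rV[R]_n * 'rV[R]_n.+1 | ~ flat xi (knot (tup p.1) i.+1)].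
  apply: open_closedC.
  have : continuous (fun p : 'rV[R]_n * 'rV[R]_n.+1 => knot (tup p.1) i.+1)
    by exact: (continuousF_comp (@continuousF_fst _ _) (@knot_continuous R n i.+1)).
  by move/continuousP; apply; exact: open_flat.
have c3 (i : 'I_n) : closed [set p : 'rV[R]_n * 'rV[R]_n.+1 | k.+1%:R^-1 <= p.2 0 (lift ord0 i) - p.2 0 (widen_ord (leqnSn _) i)].
  apply: closed_ge_cont; apply: continuousFB.
    exact: (continuousF_comp (@continuousF_snd _ _) (@rv_continuous R _ _)).
  exact: (continuousF_comp (@continuousF_snd _ _) (@rv_continuous R _ _)).
rewrite (_ : (fun p => _) = (\bigcap_(i in [set: 'I_n.+1]) [set p : 'rV[R]_n * 'rV[R]_n.+1 | k.+1%:R^-1 <= gap (tup p.1) i]) `&`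
  (\bigcap_(i in [set: 'I_n]) [set p : 'rV[R]_n * 'rV[R]_n.+1 | ~ flat xi (knot (tup p.1) i.+1)]) `&`
  (\bigcap_(i in [set: 'I_n]) [set p : 'rV[R]_n * 'rV[R]_n.+1 | k.+1%:R^-1 <= p.2 0 (lift ord0 i) - p.2 0 (widen_ord (leqnSn _) i)])).
  apply: closedI; first apply: closedI; apply: closed_bigI => i _; [exact: c1|exact: c2|exact: c3].
apply/seteqP; split => p /=.
  by move=> [h1 h2 h3]; split; [split|] => i _ /=.
by move=> [[h1 h2] h3]; split => i; [exact: (h1 i I)|exact: (h2 i I)|exact: (h3 i I)].
Qed.

Lemma inv_nat_le m (a : 'I_m -> R) : (forall i, 0 < a i) ->
  exists k, forall i, k.+1%:R^-1 <= a i.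
Proof.
move=> a0; have s0 : 0 <= \sum_i (a i)^-1 by apply: sumr_ge0 => i _; rewrite invr_ge0 ltW.
exists (Num.bound (\sum_i (a i)^-1)) => i; rewrite invf_ple ?posrE//.
apply: le_trans (_ : \sum_i (a i)^-1 <= _); last first.
  by apply: le_trans (ltW (archi_boundP s0)) _; rewrite ler_nat.
by rewrite (bigD1 i)//= lerDl sumr_ge0// => j _; rewrite invr_ge0 ltW.
Qed.

Lemma good_compactP n (p : 'rV[R]_n * 'rV[R]_n.+1) :
  good (tup p.1, tup p.2) <-> exists k, good_compact k p.
Proof.
split => [[/= Q Ex nf]|[k [[/= b1 b2] [/= h1 h2 h3]]]]; last first.
  have k0 : 0 < k.+1%:R^-1 :> R by rewrite invr_gt0.
  split => /=; last by move=> i ni; exact: (h2 (Ordinal ni)).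
    by apply/Qn_gapP => i ni; apply: lt_le_trans k0 (h1 (Ordinal (ni : (i < n.+1)%N))).
  apply/(sortedP 0) => i; rewrite size_tuple => ni.
  have := h3 (Ordinal (ni : (i < n)%N)).
  rewrite -!(tnth_tup p.2) !(tnth_nth 0) /= => h.
  by rewrite -subr_gt0; exact: lt_le_trans k0 h.
have [k1 H1] := inv_nat_le (fun i => gap_gt0 i Q).
have [k2 H2] : exists k, forall i : 'I_n, k.+1%:R^-1 <= p.2 0 (lift ord0 i) - p.2 0 (widen_ord (leqnSn _) i).
  apply: inv_nat_le => i; rewrite -!(tnth_tup p.2) !(tnth_nth 0) subr_gt0 /=.
  by move/(sortedP 0) : Ex => /(_ i); apply; rewrite size_tuple ltnS.
pose k3 := Num.bound (\sum_i `|p.2 0 i|).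
have H3 i : `|p.2 0 i| <= k3%:R.
  apply: le_trans (ltW (archi_boundP _)); last by apply: sumr_ge0.
  by rewrite (bigD1 i)//= lerDl sumr_ge0.
pose k := (k1 + k2 + k3)%N.
have le (j : nat) : (j <= k)%N -> k.+1%:R^-1 <= j.+1%:R^-1 :> R.
  by move=> jk; rewrite lef_pV2 ?posrE// ler_nat.
exists k; split; [split => /= i|split => i].
- rewrite in_itv/= -(tnth_tup p.1) (tnth_nth 0) -knotS//.
  have i1 : (i.+1 <= n.+1)%N by rewrite ltnS ltnW.
  by rewrite knot_ge0// knot_le1.
- rewrite in_itv/= -ler_norml; apply: le_trans (H3 i) _.
  by rewrite ler_nat /k; lia.
- by apply: le_trans (H1 i); apply: le; rewrite /k; lia.
- exact: nf.
- by apply: le_trans (H2 i); apply: le; rewrite /k; lia.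
Qed.

(* [core] carries [Xi], is contained in [L2up_of xi], and is a countable union of
   compact sets on which the integrands are continuous. *)
Definition core : set (L2 R) := [set g | exists n (p : n.-tuple R * n.+1.-tuple R), good p /\ g = chi p.1 p.2].

Let chiv n (p : 'rV[R]_n * 'rV[R]_n.+1) := chi (tup p.1) (tup p.2).

Lemma core_bigcup (P : set (L2 R)) :
  core `&` P = \bigcup_n \bigcup_k [set g | (@chiv n @` @good_compact n k) g /\ P g].
Proof.
apply/seteqP; split => g.
  move=> [[n [[q x] [gp ->]]] Pg].
  have : good (tup (rv q), tup (rv x)) by rewrite !rvK.
  move/(good_compactP (rv q, rv x)) => -[k Ck]; exists n => //; exists k => //; split => //.
  by exists (rv q, rv x) => //; rewrite /chiv !rvK.
move=> [n _ [k _ [[p Cp <-] Pg]]]; split => //.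
by exists n, (tup p.1, tup p.2); split => //; apply/good_compactP; exists k.
Qed.

Lemma measurable_core : measurable core.
Proof.
rewrite -[core]setIT core_bigcup.
apply: bigcupT_measurable => n; apply: bigcupT_measurable => k.
apply: closed_L2_measurable.
have := @closed_superlevel_image _ _ (@chiv n) (fun=> 0) (fun=> 0) 0
  (@good_compact_compact n k) (@chi_continuous R n).
have -> : [set g | (@chiv n @` @good_compact n k) g /\ (0 : R) <= 0] =
          [set g | (@chiv n @` @good_compact n k) g /\ [set: L2 R] g].
  by apply/seteqP; split => g [].
by apply => p _; split => //; exact: cst_continuous.
Qed.

(** Continuity is asked at good parameters only, because the factors [(gap q i)^-1] are
    discontinuous where a step collapses. *)
Lemma measurable_on_core (F : L2 R -> R) :
  (forall n, exists f : 'rV[R]_n * 'rV[R]_n.+1 -> R, forall p, good (tup p.1, tup p.2) ->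
    {for p, continuous f} /\ F (chiv p) = f p) ->
  measurable_fun setT (F \_ core).
Proof.
move=> HF; apply/(measurable_restrictT _ measurable_core) => _.
apply: (measurability _ (RGenCInfty.measurableE R)).
  2: exact: measurable_core.
move=> _ [_ [a ->] <-]; rewrite core_bigcup.
apply: bigcupT_measurable => n; apply: bigcupT_measurable => k.
apply: closed_L2_measurable; have [f Hf] := HF n.
have := @closed_superlevel_image _ _ (@chiv n) f F a
  (@good_compact_compact n k) (@chi_continuous R n).
have -> : [set g | (@chiv n @` @good_compact n k) g /\ a <= F g] =
          [set g | (@chiv n @` @good_compact n k) g /\ (F @^-1` `[a, +oo[) g].
  by apply/seteqP; split => g [h] /=; rewrite in_itv/= andbT.
by apply => p Cp; apply: Hf; apply/good_compactP; exists k.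
Qed.

End measurable_image.

Section tuple_null.
Context d (T : measurableType d) (R : realType).
Variable mu : {sigma_finite_measure set T -> \bar R}.
Local Open Scope ereal_scope.

Lemma tupleM_null n (i : 'I_n) (A : set T) : measurable A -> mu A = 0 ->
  tupleM mu n ((fun x => tnth x i) @^-1` A) = 0.
Proof.
case: n i => [[]//|n] i mA A0.
have mB : measurable ((fun x : n.+1.-tuple T => tnth x i) @^-1` A).
  by rewrite -[X in measurable X]setTI; apply: measurable_tnth.
rewrite -[X in tupleM mu _ X]setIT -integral_indic//.
have i_n : (i <= n)%N by rewrite -ltnS.
rewrite (ge0_integral_ins mu i_n)//; last first.
  by apply/measurable_EFinP; apply: measurable_indic.
rewrite (@eq_integral_off_null _ _ _ mu A _ (cst 0) mA A0) ?integral0// => s As.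
rewrite (eq_integral (cst 0)) ?integral0// => y _.
rewrite indicE memNset//= (tnth_nth s) /= nth_ins_seq ?size_tuple//.
by rewrite ltnn eqxx.
Qed.

End tuple_null.

(** * Reduction of integrals against Xi to sums over the strata *)

Section core_full.
Variables (R : realType) (xi : bddDup R).
Notation mR := (measurableTypeR R).

Lemma measurable_eq_tnth n (i j : 'I_n) :
  measurable [set x : n.-tuple mR | (tnth x i : R) = tnth x j].
Proof.
have mf : measurable_fun setT (fun x : n.-tuple mR => (tnth x i : R) - tnth x j).
  by apply: measurable_funB; exact: measurable_tnthR.
have := mf measurableT _ (measurable_set1 0); rewrite setTI.
congr measurable; apply/seteqP; split => x /=; last by move=> ->; rewrite subrr.
by move=> /eqP; rewrite subr_eq0 => /eqP.
Qed.

(** Once the other coordinates are fixed, the section in coordinate [i] is a single point. *)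
Lemma diagonal_null n (i : 'I_n) (ni : (i.+1 < n)%N) :
  laM R n [set x : n.-tuple mR | (tnth x i : R) = tnth x (Ordinal ni)] = 0%E.
Proof.
case: n i ni => [[]//|n] i ni.
have i_n : (i <= n)%N by rewrite ltnW.
have i_n' : (i < n)%N by [].
set D := [set x | _]; have mD : measurable (D : set (n.+1.-tuple mR)).
  exact: measurable_eq_tnth.
rewrite -[X in laM R _ X]setIT -integral_indic// (ge0_integral_ins (lebM R) i_n)//; last first.
  apply/measurable_EFinP; have : measurable_fun setT (@indic (n.+1.-tuple mR) R D).
    exact: measurable_indic.
  exact.
have mF : measurable_fun setT (fun p : mR * n.-tuple mR => (@indic (n.+1.-tuple mR) R D (ins i p.1 p.2))%:E).
  apply/measurable_EFinP; have : measurable_fun setT (@indic (n.+1.-tuple mR) R D).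
    exact: measurable_indic.
  by move=> h; apply: measurableT_comp h (measurable_ins i_n).
rewrite (@fubini_tonelli _ _ _ _ _ (lebM R) (laM R n) _ mF); last first.
  by move=> p; rewrite lee_fin.
rewrite (eq_integral (cst 0%E)) ?integral0// => y _ /=.
pose t : R := tnth y (Ordinal i_n').
rewrite (eq_integral (fun s : mR => (\1_[set t] s : R)%:E)); last first.
  move=> s _; congr (_%:E); rewrite !indicE; congr ((nat_of_bool _)%:R).
  have e : D (ins i s y) = (s = t).
    rewrite /D /= !(tnth_nth (0 : R)) /= !nth_ins_seq ?size_tuple//.
    by rewrite ltnn eqxx ltnNge leqnSn /= gtn_eqF// /t (tnth_nth 0).
  by apply/idP/idP => /set_mem h; apply/mem_set; move: h; rewrite /= e.
by rewrite integral_indic ?setIT//; exact: lebesgue_measure_set1.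
Qed.

Lemma xiM_ocitv (a b : R) : a <= b ->
  xiM xi `]a, b]%classic = (ext01 xi b - ext01 xi a)%:E.
Proof.
move=> ab; rewrite /xiM /= /lebesgue_stieltjes_measure /measure_extension.
rewrite measurable_mu_extE/=; last exact: is_ocitv.
by rewrite wlength_itv_bnd.
Qed.

Lemma measurable_flat : measurable (flat xi : set mR).
Proof. by have := open_measurable (@open_flat _ xi). Qed.

(** [flat] is a countable union of rational intervals, and the mass of each is at most the increment
    of [xi] between its ends, which is 0. *)
Lemma flat_null : xiM xi (flat xi) = 0%E.
Proof.
pose F k : set mR := if unpickle k is Some (s, t) then
  [set x | ratr s < x < ratr t /\ ext01 xi (ratr s) = ext01 xi (ratr t)] else set0.
suff : (xiM xi).-negligible (\bigcup_k F k).
  have -> : \bigcup_k F k = flat xi.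
    apply/seteqP; split => x.
      move=> [k _]; rewrite /F; case: unpickle => [[s t] Hx|//].
      by exists s, t.
    move=> [s [t Hx]].
    have [k kE] : exists k, unpickle k = Some (s, t) by exists (pickle (s, t)); rewrite pickleK.
    by exists k; [exact: I|rewrite /F kE].
  by move/(measure_negligible measurable_flat).
apply: negligible_bigcup => k; rewrite /F; case: unpickle => [[s t]|]; last first.
  exact: negligible_set0.
have [st|st] := leP (ratr t : R) (ratr s).
  exists set0; split => // x [/andP[sx xt] _].
  by have := lt_trans sx xt; rewrite ltNge st.
have [e|ne] := eqVneq (ext01 xi (ratr s)) (ext01 xi (ratr t)).
  exists `](ratr s : R), (ratr t : R)]%classic; split.
  - exact: measurable_itv.
  - by have := xiM_ocitv (ltW st); rewrite e subrr.
  - by move=> x [/andP[sx xt] _]; rewrite /= in_itv/= sx ltW.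
by exists set0; split => // x [_ e]; rewrite e eqxx in ne.
Qed.

(** A nonzero density already gives strictly ordered knots and weakly ordered values; what remains
    are ties between neighbouring values, null for Lebesgue measure, and flat knots, null for d
    xi. *)
Lemma dens_good_ae n : {ae prodM xi n, forall p, dens p != 0 -> good xi p}.
Proof.
pose A (i : 'I_n) : set (n.-tuple mR) := (fun q : n.-tuple mR => tnth q i : mR) @^-1` (flat xi).
pose B (i : 'I_n) : set (n.+1.-tuple mR) :=
  [set x | (tnth x (widen_ord (leqnSn n) i) : R) = tnth x (lift ord0 i)].
have mA i : measurable (A i).
  rewrite -[X in measurable X]setTI; apply: (measurable_tnth i) => //; exact: measurable_flat.
have mB i : measurable (B i).
  exact: measurable_eq_tnth.
have A0 i : (prodM xi n) (A i `*` setT) = 0%E.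
  have := product_measure1E (nuM xi n) (laM R n.+1) (mA i) measurableT.
  move=> h; refine (eq_trans h _); apply/eqP; rewrite mule_eq0; apply/orP; left; apply/eqP.
  exact (@tupleM_null _ mR R (xiM xi) n i (flat xi) measurable_flat flat_null).
have B0 i : (prodM xi n) (setT `*` B i) = 0%E.
  have := product_measure1E (nuM xi n) (laM R n.+1) measurableT (mB i).
  have -> : B i = [set x : n.+1.-tuple mR | (tnth x (widen_ord (leqnSn n) i) : R) =
      tnth x (Ordinal (ltn_ord (lift ord0 i) : ((widen_ord (leqnSn n) i).+1 < n.+1)%N))].
    by apply/seteqP; split => x; rewrite /B /= !(tnth_nth (0 : R)).
  by rewrite diagonal_null mule0.
have HA : {ae prodM xi n, forall p, forall i, ~ A i p.1}.
  apply: ae_forall_ord => i; exists (A i `*` setT); split => //; first exact: measurableX.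
  by move=> p /= /contrapT.
have HB : {ae prodM xi n, forall p, forall i, ~ B i p.2}.
  apply: ae_forall_ord => i; exists (setT `*` B i); split => //; first exact: measurableX.
  by move=> p /= /contrapT.
apply: ae_imp2 HA HB => -[q x] /= nA nB; rewrite /dens /=.
case: (boolP (q \in Qn n)) => [/set_mem Q|nQ]; last by rewrite indicE (negbTE nQ) !mul0r eqxx.
case: (boolP (x \in En n.+1)) => [/set_mem Ex|nE]; last by rewrite [\1_(En n.+1) x]indicE (negbTE nE) mulr0 eqxx.
move=> _; split => //=.
  apply/(sortedP 0) => i; rewrite size_tuple => ni.
  have i_n : (i < n)%N by [].
  rewrite lt_neqAle; apply/andP; split; last first.
    by move/(sortedP 0) : Ex; apply; rewrite size_tuple.
  apply/eqP => e; apply: (nB (Ordinal i_n)).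
  by rewrite /B /= !(tnth_nth 0).
move=> i ni fl; apply: (nA (Ordinal ni)).
by rewrite /A /= (tnth_nth 0) -knotS.
Qed.

Lemma XiM_core0 : mseries (XinM xi) 0 (~` core xi) = 0%E.
Proof.
apply: eseries0 => n _ _; rewrite densityMeasureE; last first.
  by apply: measurableC; exact: measurable_core.
have [N [mN N0 HN]] := dens_good_ae n.
rewrite (@eq_integral_off_null _ _ _ (prodM xi n) N _ (cst 0%E) mN N0) ?integral0// => p Np.
have [->|d0] := eqVneq (dens p) 0; first by rewrite mul0r.
rewrite indicE memNset ?mulr0//= => h; apply: h; exists n, p; split => //.
by apply: contrapT => g; apply: Np; apply: HN => /(_ d0).
Qed.

Lemma core_L2up_of : core xi `<=` L2up_of (bddDup_L2 xi).
Proof.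
move=> g [n [p [[Q Ex nf] ->]]]; apply: chi_L2up_of => //.
by apply: sub_sorted Ex => a b; exact: ltW.
Qed.

(** [core] is measurable, lies in the domain of integration and has a null complement; this replaces
    any statement on the measurability of [L2up_of] itself. *)
Lemma integral_XiE (F : L2 R -> R) :
  (\int[Xi xi]_(g in L2up_of (bddDup_L2 xi)) (F g)%:E =
   \int[mseries (XinM xi) 0]_g ((F \_ (core xi)) g)%:E)%E.
Proof.
rewrite (@eq_setfun_integral _ _ _ (Xi xi) (mseries (XinM xi) 0)); last exact: XiE.
rewrite integral_mkcond; apply: (@eq_integral_off_null _ _ _ _ (~` core xi)).
- by apply: measurableC; exact: measurable_core.
- exact: XiM_core0.
- move=> g /contrapT gc; rewrite !patchE.
  by rewrite !mem_set//; exact: core_L2up_of.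
Qed.

Section series.
Variables (F : L2 R -> R) (f : forall n, n.-tuple R * n.+1.-tuple R -> R).
Hypothesis mF : measurable_fun setT (F \_ (core xi)).
Hypothesis Ff : forall n (p : n.-tuple R * n.+1.-tuple R), good xi p -> F (chi p.1 p.2) = f p.
Hypothesis intf : forall n, (prodM xi n).-integrable setT (fun p => (dens p * f p)%:E).
Hypothesis sumf : (\sum_(0 <= n <oo) \int[prodM xi n]_p `|dens p * f p|%:E < +oo)%E.

Let Ff_ae n : {ae prodM xi n, forall p, dens p * (F \_ (core xi)) (chi p.1 p.2) = dens p * f p}.
Proof.
apply: ae_imp (dens_good_ae n) => p h.
have [->|/h g] := eqVneq (dens p) 0; first by rewrite !mul0r.
by rewrite patchE mem_set ?Ff//; exists n, p.
Qed.

Let intF n : (prodM xi n).-integrable setT (fun p => (dens p * (F \_ (core xi)) (chi p.1 p.2))%:E).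
Proof.
have mFc : measurable_fun setT (fun p : n.-tuple mR * n.+1.-tuple mR =>
    (F \_ (core xi)) (chi p.1 p.2) : R).
  exact: measurableT_comp mF (@measurable_chi R n).
apply/integrableP; split.
  by apply/measurable_EFinP; apply: measurable_funM => //; exact: measurable_dens.
have [N [mN N0 HN]] := Ff_ae n; have /integrableP[_] := intf n.
rewrite (@eq_integral_off_null _ _ _ (prodM xi n) N _
  (fun p => `|(dens p * (F \_ (core xi)) (chi p.1 p.2))%:E|%E) mN N0)// => p Np.
by congr (`|_%:E|)%E; apply: contrapT => e; apply/Np/HN => /esym.
Qed.

Lemma integral_Xi_series :
  (\int[Xi xi]_(g in L2up_of (bddDup_L2 xi)) (F g)%:E =
   \sum_(0 <= n <oo) \int[prodM xi n]_p (dens p * f p)%:E)%E.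
Proof.
have mFE : measurable_fun setT (EFin \o (F \_ (core xi))) by exact/measurable_EFinP.
have intX n : (XinM xi n).-integrable setT (EFin \o (F \_ (core xi))).
  by apply: integrable_density => //; exact: intF.
have absX n : (\int[XinM xi n]_g `|((F \_ (core xi)) g)%:E| = \int[prodM xi n]_p `|dens p * f p|%:E)%E.
  rewrite ge0_integral_density//; last exact: measurableT_comp.
  have [N [mN N0 HN]] := Ff_ae n.
  apply: (eq_integral_off_null mN N0) => p Np; rewrite -EFinM.
  have <- : dens p * (F \_ (core xi)) (chi p.1 p.2) = dens p * f p.
    by apply: contrapT => /HN.
  by rewrite normrM (ger0_norm (dens_ge0 p)).
rewrite integral_XiE integral_measure_series//; last 2 first.
- apply: le_lt_trans sumf; apply: lee_nneseries => // n _.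
  rewrite -absX gee0_abs ?integral_ge0//; apply: ge0_le_integral => //.
  + exact: measurable_funeneg.
  + exact: measurableT_comp.
  + by move=> g _; rewrite funenegE ge_max abse_ge0 andbT lee_fin ler_normr lexx orbT.
- apply: le_lt_trans sumf; apply: lee_nneseries => // n _.
  rewrite -absX gee0_abs ?integral_ge0//; apply: ge0_le_integral => //.
  + exact: measurable_funepos.
  + exact: measurableT_comp.
  + by move=> g _; rewrite funeposE ge_max abse_ge0 andbT lee_fin ler_normr lexx.
apply: eq_eseriesr => n _; rewrite (integral_density _ _ _ mF (intF n)).
have [N [mN N0 HN]] := Ff_ae n.
apply: (eq_integral_off_null mN N0) => p Np; congr EFin.
by apply: contrapT => /HN.
Qed.

End series.

End core_full.

Section tonelli_bounds.
Context d1 d2 (T1 : measurableType d1) (T2 : measurableType d2) (R : realType).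
Variables (m1 : {sigma_finite_measure set T1 -> \bar R}) (m2 : {sigma_finite_measure set T2 -> \bar R}).

Lemma abs_prod_integral_le (f : T1 * T2 -> R) (A : set T1) (M : R) :
  measurable_fun setT f -> measurable A ->
  (forall x, \int[m2]_y `|f (x, y)|%:E <= (M * \1_A x)%:E)%E ->
  (\int[m1 \x m2]_p `|f p|%:E <= M%:E * m1 A)%E.
Proof.
move=> mf mA fM; rewrite fubini_tonelli1//; last first.
  by apply/measurable_EFinP; exact: measurableT_comp.
have mg : measurable_fun setT (fun x => (M * \1_A x)%:E).
  by apply/measurable_EFinP; apply: measurable_funM => //; exact: measurable_indic.
apply: (@le_trans _ _ (\int[m1]_x (M * \1_A x)%:E)%E).
  apply: ge0_le_integral => //=.
  - by move=> x _; exact: integral_ge0.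
  - apply: measurable_fun_fubini_tonelli_F => //.
    by apply/measurable_EFinP; exact: measurableT_comp.
  - by move=> x _; exact: fM.
have M0 x : 0 <= M * \1_A x.
  by rewrite -lee_fin; apply: le_trans (fM x); exact: integral_ge0.
(* The hypothesis gives the sign of [M] only through a point of [A]. *)
have [A0|/set0P[x Ax]] := eqVneq A set0.
  by rewrite A0 measure0 mule0 integral0_eq// => x _; rewrite indic0 mulr0.
have {x Ax}M00 : 0 <= M by have := M0 x; rewrite indicE mem_set// mulr1.
under eq_integral do rewrite EFinM.
by rewrite ge0_integralZl//= ?integral_indic ?setIT//; apply/measurable_EFinP; exact: measurable_indic.
Qed.

Lemma prod_integrable_of_bound (f : T1 * T2 -> R) (A : set T1) (M : R) :
  measurable_fun setT f -> measurable A -> (m1 A < +oo)%E ->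
  (forall x, \int[m2]_y `|f (x, y)|%:E <= (M * \1_A x)%:E)%E ->
  (m1 \x m2)%E.-integrable setT (EFin \o f).
Proof.
move=> mf mA A_fin fM; apply/integrableP; split; first exact/measurable_EFinP.
apply: le_lt_trans (abs_prod_integral_le mf mA fM) _.
have : m1 A \is a fin_num by rewrite ge0_fin_numE.
by move=> /fineK <-; rewrite -EFinM ltry.
Qed.

End tonelli_bounds.

Section tuple_product.
Context d (T : measurableType d) (R : realType).
Variable mu : {sigma_finite_measure set T -> \bar R}.
Local Open Scope ereal_scope.

Lemma ge0_integral_tuple_prod n (f : 'I_n -> T -> R) :
  (forall i, measurable_fun setT (f i)) -> (forall i s, (0 <= f i s)%R) ->
  \int[tupleM mu n]_x (\prod_(i < n) f i (tnth x i))%R%:E =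
  \prod_(i < n) \int[mu]_s (f i s)%:E.
Proof.
elim: n f => [|n IH] f mf f0.
  rewrite big_ord0 (eq_integral (cst 1)); last by move=> x _; rewrite big_ord0.
  have h : tupleM mu 0 setT = 1 by rewrite -tupleME /= diracE in_setT.
  by rewrite integral_cst// mul1e.
have mprod m (g : 'I_m -> T -> R) : (forall i, measurable_fun setT (g i)) ->
    measurable_fun setT (fun x : m.-tuple T => (\prod_(i < m) g i (tnth x i))%R).
  move=> mg; apply: measurable_prod => i _.
  exact: measurableT_comp (mg i) (measurable_tnth i).
rewrite ge0_integral_cons; last 2 first.
- by apply/measurable_EFinP; exact: mprod.
- by move=> x; rewrite lee_fin; apply: prodr_ge0.
rewrite big_ord_recl -(IH (fun i => f (lift ord0 i)))//.
rewrite -ge0_integralZr//; last 3 first.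
- exact/measurable_EFinP.
- by move=> x _; rewrite lee_fin.
- by apply: integral_ge0 => x _; rewrite lee_fin; apply: prodr_ge0.
apply: eq_integral => s _; rewrite -ge0_integralZl//; last 3 first.
- by apply/measurable_EFinP; apply: (mprod n (fun i => f (lift ord0 i))).
- by move=> x _; rewrite lee_fin; apply: prodr_ge0.
- by rewrite lee_fin.
apply: eq_integral => y _; rewrite -EFinM big_ord_recl; congr (_ * _)%:E.
by apply: eq_bigr => i _; rewrite tnthS.
Qed.

End tuple_product.

(** * Bounds and convergence *)

Section slab.
Variables (R : realType) (xi : bddDup R).
Notation mR := (measurableTypeR R).

Definition gauss_cst : R := Num.sqrt (pi *+ 2).

(** The integrand is a multiple of the centred normal density of standard deviation
    [s / Num.sqrt a]. *)
Lemma integral_gauss_gap (s a : R) : 0 < s -> 0 < a ->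
  (\int[lebM R]_x (expR (- (a * x ^+ 2) / (s ^+ 2 *+ 2)))%:E = (s * gauss_cst / Num.sqrt a)%:E)%E.
Proof.
move=> s0 a0; pose sg := s / Num.sqrt a.
have sg0 : 0 < sg by rewrite divr_gt0// sqrtr_gt0.
have e x : expR (- (a * x ^+ 2) / (s ^+ 2 *+ 2)) = normal_pdf 0 sg x * (normal_peak sg)^-1.
  rewrite normal_pdfE ?gt_eqF// mulrAC mulfV ?mul1r ?gt_eqF ?normal_peak_gt0 ?gt_eqF//.
  rewrite /normal_fun subr0; congr expR; rewrite !mulNr; congr (- _).
  have -> : sg ^+ 2 *+ 2 = (s ^+ 2 *+ 2) / a.
    by rewrite /sg expr_div_n sqr_sqrtr ?(ltW a0)// mulrnAl.
  by rewrite [in RHS]invf_div; rewrite [in RHS]mulrA; rewrite [x ^+ 2 * a]mulrC.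
under eq_integral do rewrite e EFinM.
rewrite ge0_integralZr//; last 3 first.
- by apply/measurable_EFinP; exact: measurable_normal_pdf.
- by move=> x _; rewrite lee_fin normal_pdf_ge0.
- by rewrite lee_fin invr_ge0 normal_peak_ge0.
have -> : (\int[lebM R]_x (normal_pdf 0 sg x)%:E = 1)%E by exact: integral_normal_pdf.
rewrite mul1e /normal_peak invrK; congr EFin.
rewrite -mulrnAr sqrtrM ?sqr_ge0// sqrtr_sqr ger0_norm ?ltW// /sg /gauss_cst.
by rewrite mulrAC.
Qed.

(* From [1 <= expR (C / (2 s^2)) * expR (- sqnorm (chi q x) / (2 s^2))] on the set
   [sqnorm (chi q x) <= C]; the variance [s] is free, and is chosen small in
   [slab_series_lty] to make the series geometric. *)
Definition slab_bound (s C : R) (n : nat) : R :=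
  expR (C / (s ^+ 2 *+ 2)) * (s * gauss_cst) ^+ n.+1.

Lemma slab_bound_ge0 s C n : 0 < s -> 0 <= slab_bound s C n.
Proof. by move=> s0; rewrite mulr_ge0 ?expR_ge0 ?exprn_ge0 ?mulr_ge0 ?sqrtr_ge0// ltW. Qed.

Lemma measurable_slab n (q : n.-tuple mR) (C : R) :
  measurable [set x : n.+1.-tuple mR | sqnorm (chi q x) <= C].
Proof.
have m1 : measurable_fun setT (fun g : L2 R => sqnorm g : R).
  apply: (measurability _ (RGenOpens.measurableE R)).
  move=> /= _ [_ [a [b ->]] <-]; rewrite setTI; apply: sub_sigma_algebra.
  move/continuousP : (@sqnorm_continuous R); apply; exact: interval_open.
have := measurableT_comp m1 (measurableT_comp (@measurable_chi R n) (pair1_measurable q)).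
move=> /(_ measurableT _ (measurable_itv `]-oo, C])); rewrite setTI.
by congr measurable; apply/seteqP; split => x /=; rewrite in_itv/=.
Qed.

(** The Gaussian factorizes because [sqnorm (chi q x)] is diagonal in the values. Each factor
    integrates to s * gauss_cst / sqrt(gap); the gap supplied by [wgt] turns this into s * gauss_cst
    * sqrt(gap), and the gap is at most 1. *)
Lemma slab_le n (q : n.-tuple R) (s C : R) : Qn n q -> 0 < s ->
  ((wgt q)%:E * laM R n.+1 [set x : n.+1.-tuple mR | (sqnorm (chi q x) <= C)%R] <= (slab_bound s C n)%:E)%E.
Proof.
move=> Q s0; pose S : set (n.+1.-tuple mR) := [set x | (sqnorm (chi q x) <= C)%R]; rewrite -/S.
have g0 i : 0 < gap q (i : 'I_n.+1) by exact: gap_gt0.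
have w0 : 0 <= wgt q by apply: prodr_ge0 => i _; exact: ltW.
pose G (x : n.+1.-tuple R) := \prod_(i < n.+1) expR (- (gap q i * tnth x i ^+ 2) / (s ^+ 2 *+ 2)).
have mS : measurable S := measurable_slab q C.
have mG1 (i : 'I_n.+1) : measurable_fun setT (fun t : mR => expR (- (gap q i * t ^+ 2) / (s ^+ 2 *+ 2)) : R).
  apply: measurableT_comp => //; apply: measurable_funM => //.
  by apply: measurableT_comp => //; apply: measurable_funM => //; exact: measurable_funX.
have mG : measurable_fun setT (fun x : n.+1.-tuple mR => (G x)%:E).
  apply/measurable_EFinP; apply: measurable_prod => i _.
  exact: measurableT_comp (mG1 i) (measurable_tnth i).
have -> : laM R n.+1 S = (\int[laM R n.+1]_x (@indic (n.+1.-tuple mR) R S x)%:E)%E.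
  by rewrite integral_indic// setIT.
apply: (@le_trans _ _ ((wgt q)%:E * \int[laM R n.+1]_x (expR (C / (s ^+ 2 *+ 2)) * G x)%:E)%E).
  apply: lee_wpmul2l; first by rewrite lee_fin.
  apply: ge0_le_integral => //=.
  - apply/measurable_EFinP; have : measurable_fun setT (@indic (n.+1.-tuple mR) R S).
      exact: measurable_indic.
    exact.
  - apply/measurable_EFinP; apply: measurable_funM => //; exact/measurable_EFinP.
  move=> x _; rewrite lee_fin indicE; have [/set_mem Sx|_] := boolP (x \in S); last first.
    by rewrite mulr_ge0 ?expR_ge0//; apply: prodr_ge0 => i _; exact: expR_ge0.
  rewrite /G -expR_sum -expRD -[leLHS]expR0 ler_expR -mulr_suml -mulrDl.
  rewrite mulr_ge0 ?invr_ge0 ?mulrn_wge0 ?sqr_ge0//.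
  by rewrite sumrN subr_ge0 -(norm_chi _ Q).
have mul0 : (0 <= expR (C / (s ^+ 2 *+ 2)))%R by exact: expR_ge0.
under eq_integral do rewrite EFinM.
rewrite ge0_integralZl//; last first.
  by move=> x _; rewrite lee_fin; apply: prodr_ge0 => i _; exact: expR_ge0.
rewrite muleCA /slab_bound EFinM; apply: lee_wpmul2l; first by rewrite lee_fin.
rewrite /G (ge0_integral_tuple_prod (lebM R) (f := fun i t => expR (- (gap q i * t ^+ 2) / (s ^+ 2 *+ 2))))//.
under eq_bigr do rewrite integral_gauss_gap//.
rewrite prodEFin -EFinM lee_fin /wgt -big_split/=.
have c0 : 0 <= gauss_cst := sqrtr_ge0 _.
rewrite -[leRHS]/((s * gauss_cst) ^+ n.+1) -[X in _ ^+ X](card_ord n.+1) -prodr_const.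
apply: ler_prod => i _; apply/andP; split.
  by rewrite mulr_ge0 ?divr_ge0 ?mulr_ge0 ?sqrtr_ge0 ?ltW.
rewrite mulrCA ler_piMr ?mulr_ge0 ?(ltW s0)//.
have gs : gap q i = Num.sqrt (gap q i) ^+ 2 by rewrite sqr_sqrtr// ltW.
rewrite {1}gs expr2 mulfK ?gt_eqF ?sqrtr_gt0//.
rewrite -sqrtr1 ler_sqrt//; rewrite -(sum_gap q) (bigD1 i)//= lerDl.
by apply: sumr_ge0 => j _; exact: ltW.
Qed.

Lemma slab_integral_le n (q : n.-tuple R) (s C K : R) (f : n.+1.-tuple R -> R) : Qn n q -> 0 < s -> 0 <= K ->
  measurable_fun setT (f : n.+1.-tuple mR -> R) ->
  (forall x, `|f x| <= K * wgt q) -> (forall x, C < sqnorm (chi q x) -> f x = 0) ->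
  (\int[laM R n.+1]_x `|f x|%:E <= (K * slab_bound s C n)%:E)%E.
Proof.
move=> Q s0 K0 mf fK f0; pose S : set (n.+1.-tuple mR) := [set x | (sqnorm (chi q x) <= C)%R].
have mS : measurable S := measurable_slab q C.
have w0 : 0 <= wgt q by apply: prodr_ge0 => i _; apply: ltW; exact: gap_gt0.
apply: (@le_trans _ _ (\int[laM R n.+1]_x (K * wgt q * \1_S x)%:E)%E).
  have mI : measurable_fun setT (@indic (n.+1.-tuple mR) R S) by exact: measurable_indic.
  apply: ge0_le_integral => //=.
  - by apply/measurable_EFinP; exact: measurableT_comp.
  - by apply/measurable_EFinP; exact: measurable_funM.
  move=> x _; rewrite lee_fin indicE; have [|/negP xS] := boolP (x \in S); first by rewrite mulr1.
  rewrite mulr0 f0 ?normr0// ltNge; apply/negP => h; apply: xS; exact/mem_set.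
under eq_integral do rewrite EFinM.
rewrite ge0_integralZl//; last 2 first.
- have mI : measurable_fun setT (@indic (n.+1.-tuple mR) R S) by exact: measurable_indic.
  exact/measurable_EFinP.
- by rewrite lee_fin mulr_ge0.
rewrite integral_indic// setIT EFinM -muleA EFinM; apply: lee_wpmul2l; first by rewrite lee_fin.
exact: slab_le.
Qed.

Lemma slab_integrable n (q : n.-tuple R) (C K : R) (f : n.+1.-tuple R -> R) : Qn n q ->
  measurable_fun setT (f : n.+1.-tuple mR -> R) ->
  (forall x, `|f x| <= K) -> (forall x, C < sqnorm (chi q x) -> f x = 0) ->
  (laM R n.+1).-integrable setT (EFin \o f).
Proof.
move=> Q mf fK f0; apply/integrableP; split; first exact/measurable_EFinP.
have w0 : 0 < wgt q by apply: prodr_gt0 => i _; exact: gap_gt0.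
have K0 : 0 <= K by apply: le_trans (fK [tuple of nseq n.+1 0]).
(* At fixed [q] only finiteness matters, so the missing weight is put into the constant and the
   deviation is taken to be 1. *)
apply: le_lt_trans (_ : _ <= (K / wgt q * slab_bound 1 C n)%:E)%E _; last exact: ltry.
have K1 : 0 <= K / wgt q by rewrite divr_ge0// ltW.
by apply: (slab_integral_le Q ltr01 K1 mf _ f0) => x; rewrite divfK ?gt_eqF.
Qed.

Definition xi_mass : R := ext01 xi 1 - ext01 xi 0.

(** Comparison with the cube ]0, 1]^n, whose mass is a product. *)
Lemma nuM_Qn_le n : (nuM xi n (Qn n) <= (xi_mass ^+ n)%:E)%E.
Proof.
have mQ := @measurable_Qn R n.
have -> : nuM xi n (Qn n) = (\int[nuM xi n]_q (@indic (n.-tuple mR) R (Qn n) q)%:E)%E.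
  by rewrite integral_indic// setIT.
pose I1 : set mR := `]0, 1]%classic.
have mI1 : measurable I1 by exact: measurable_itv.
apply: (@le_trans _ _ (\int[nuM xi n]_q (\prod_(i < n) (\1_I1 (tnth q i) : R))%:E)%E).
  apply: ge0_le_integral => //=.
  - have mI : measurable_fun setT (@indic (n.-tuple mR) R (Qn n)) by exact: measurable_indic.
    exact/measurable_EFinP.
  - apply/measurable_EFinP; apply: measurable_prod => i _.
    exact: measurableT_comp (measurable_indic mI1) (measurable_tnth i).
  move=> q _; rewrite lee_fin [leLHS]indicE; have [/set_mem Q|_] := boolP (q \in Qn n); last first.
    by apply: prodr_ge0.
  rewrite big1// => i _; rewrite indicE mem_set// /I1 /= in_itv/=.
  rewrite (tnth_nth 0) -knotS// knot_le1//; last by rewrite ltnS ltnW.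
  rewrite andbT; apply: le_lt_trans (knot_ge0 Q (leqW (ltnW (ltn_ord i)))) _.
  by rewrite -subr_gt0; exact: (gap_gt0 (widen_ord (leqnSn n) i) Q).
rewrite (ge0_integral_tuple_prod (xiM xi) (f := fun _ => \1_I1))//.
under eq_bigr do rewrite integral_indic// setIT.
rewrite (eq_bigr (fun=> xi_mass%:E)); last first.
  by move=> i _; have := xiM_ocitv xi (@ler01 R).
by rewrite prodEFin prodr_const card_ord.
Qed.

End slab.

Section series_bound.
Variables (R : realType) (xi : bddDup R).
Notation mR := (measurableTypeR R).

Lemma xi_mass_ge0 : 0 <= xi_mass xi.
Proof. by rewrite subr_ge0 ext01_nd. Qed.

Lemma nuM_Qn_lty n : (nuM xi n (Qn n) < +oo)%E.
Proof. by apply: le_lt_trans (nuM_Qn_le xi n) _; exact: ltry. Qed.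

Section fixed_n.
Variables (n : nat) (f : n.-tuple R * n.+1.-tuple R -> R) (K C : R).
Hypothesis mf : measurable_fun setT (fun p : n.-tuple mR * n.+1.-tuple mR => f p).
Hypothesis fK : forall q x, Qn n q -> `|f (q, x)| <= K.
Hypothesis f0 : forall q x, Qn n q -> C < sqnorm (chi q x) -> f (q, x) = 0.
Hypothesis K0 : 0 <= K.

Let mdf : measurable_fun setT (fun p : n.-tuple mR * n.+1.-tuple mR => dens p * f p).
Proof. by apply: measurable_funM => //; exact: measurable_dens. Qed.

Let bound s q : 0 < s ->
  (\int[laM R n.+1]_x `|dens (q, x) * f (q, x)|%:E <=
   (K * slab_bound s C n * @indic (n.-tuple mR) R (Qn n) q)%:E)%E.
Proof.
move=> s0; rewrite indicE; have [/set_mem Q|nQ] := boolP (q \in Qn n); last first.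
  rewrite mulr0 integral0_eq// => x _; rewrite /dens /= indicE (negbTE nQ).
  by rewrite !mul0r normr0.
have w0 : 0 <= wgt q by apply: prodr_ge0 => i _; apply: ltW; exact: gap_gt0.
rewrite mulr1; apply: (slab_integral_le Q s0 K0).
- exact: measurableT_comp mdf (pair1_measurable q).
- move=> x; rewrite normrM (ger0_norm (dens_ge0 (q, x))) mulrC.
  apply: ler_pM => //; first exact: dens_ge0.
    exact: fK.
  rewrite /dens /= indicE mem_set// mul1r ler_piMr// indicE.
- by move=> x h; rewrite f0// mulr0.
Qed.

Lemma dens_integrable : (prodM xi n).-integrable setT (fun p => (dens p * f p)%:E).
Proof.
apply: (prod_integrable_of_bound mdf (@measurable_Qn R n) (nuM_Qn_lty n) (M := K * slab_bound 1 C n)).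
by move=> q; exact: bound.
Qed.

Lemma dens_abs_le s : 0 < s ->
  (\int[prodM xi n]_p `|dens p * f p|%:E <= (K * slab_bound s C n * xi_mass xi ^+ n)%:E)%E.
Proof.
move=> s0; have := @abs_prod_integral_le _ _ _ _ _ (nuM xi n) (laM R n.+1) _ _ _ mdf (@measurable_Qn R n) (fun q => bound q s0).
move=> h; apply: (le_trans h); rewrite [leRHS]EFinM; apply: lee_wpmul2l.
  by rewrite lee_fin mulr_ge0// slab_bound_ge0.
exact: nuM_Qn_le.
Qed.

End fixed_n.

(** The integrands are sums over the steps, whence the factor [n.+1]; it is absorbed by half of the
    geometric decay, since (n + 1) / 4^(n + 1) <= 1 / 2^(n + 1). *)
Lemma slab_series_lty (a : nat -> \bar R) (K C : R) : 0 <= K ->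
  (forall n, 0 <= a n)%E ->
  (forall n s, 0 < s -> (a n <= (n.+1%:R * K * slab_bound s C n * xi_mass xi ^+ n)%:E)%E) ->
  (\sum_(0 <= n <oo) a n < +oo)%E.
Proof.
move=> K0 a0 aK; have D0 := xi_mass_ge0; have c0 : 0 <= gauss_cst R := sqrtr_ge0 _.
set D := xi_mass xi in aK D0; set c := gauss_cst R in c0.
(* Makes [s * c * (D + 1)] at most 1/4; the added 1 keep the denominator positive. *)
pose s := (4 * (c + 1) * (D + 1))^-1.
have s0 : 0 < s by rewrite invr_gt0 !mulr_gt0// ltr_wpDl.
have sD : s * c * (D + 1) <= 4^-1.
  have sE : s * ((c + 1) * (D + 1)) = 4^-1.
    by rewrite /s -mulrA invfM mulfVK// gt_eqF// mulr_gt0// ltr_wpDl.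
  have h : c * (D + 1) <= (c + 1) * (D + 1) by lra.
  by rewrite -sE -mulrA; exact: (ler_wpM2l (ltW s0) h).
pose e := expR (C / (s ^+ 2 *+ 2)).
have e0 : 0 <= K * e by rewrite mulr_ge0// expR_ge0.
apply: le_lt_trans (_ : \sum_(0 <= n <oo) (K * e / (2 ^ n.+1)%:R)%:E < +oo)%E; last first.
  by apply: le_lt_trans (epsilon_trick0 _ e0) _; exact: ltry.
apply: lee_nneseries => // n _; apply: le_trans (aK n s s0) _; rewrite lee_fin.
rewrite /slab_bound -/e -/c.
have h1 : (s * c) ^+ n.+1 * D ^+ n <= (4 ^+ n.+1)^-1.
  rewrite -exprVn; apply: (@le_trans _ _ ((s * c * (D + 1)) ^+ n.+1)); last first.
    apply: lerXn2r => //; rewrite nnegrE ?invr_ge0//.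
    exact: mulr_ge0 (mulr_ge0 (ltW s0) c0) (addr_ge0 D0 ler01).
  rewrite [leRHS]exprMn; apply: ler_wpM2l; first by rewrite exprn_ge0 ?mulr_ge0// ltW.
  have D1 : D <= D + 1 by rewrite lerDl.
  have D10 := le_trans D0 D1.
  apply: (@le_trans _ _ ((D + 1) ^+ n)); first by apply: lerXn2r; rewrite ?nnegrE.
  by rewrite ler_weXn2l// lerDr.
have h2 : n.+1%:R * (4 ^+ n.+1)^-1 <= (2 ^+ n.+1)^-1 :> R.
  have -> : 4 ^+ n.+1 = 2 ^+ n.+1 * 2 ^+ n.+1 :> R by rewrite -exprMn -natrM.
  rewrite invfM mulrA ler_piMl ?invr_ge0 ?exprn_ge0//.
  rewrite ler_pdivrMr ?exprn_gt0// mul1r -natrX ler_nat.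
  by apply: ltnW; exact: ltn_expl.
rewrite natrX.
have -> : n.+1%:R * K * (e * (s * c) ^+ n.+1) * D ^+ n =
    K * e * (n.+1%:R * ((s * c) ^+ n.+1 * D ^+ n)) by lra.
by rewrite ler_wpM2l//; apply: le_trans h2; rewrite ler_wpM2l.
Qed.

End series_bound.

Section Rfubini.
Context d1 d2 (T1 : measurableType d1) (T2 : measurableType d2) (R : realType).
Variables (m1 : {sigma_finite_measure set T1 -> \bar R}) (m2 : {sigma_finite_measure set T2 -> \bar R}).
Variable f : T1 * T2 -> R.
Hypothesis fi : (m1 \x m2)%E.-integrable setT (EFin \o f).

(** The real inner integral is [fine] of the extended one; the two are identified where the section
    is integrable, which is almost everywhere. *)
Let F_ae : {ae m1, forall x, fubini_F m2 (EFin \o f) x = (\int[m2]_y f (x, y))%:E}.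
Proof.
apply: ae_imp (ae_integrable1 fi) => x fx.
by rewrite /Rintegral fineK//; exact: integrable_fin_num.
Qed.

Let G_ae : {ae m2, forall y, fubini_G m1 (EFin \o f) y = (\int[m1]_x f (x, y))%:E}.
Proof.
apply: ae_imp (ae_integrable2 fi) => y fy.
by rewrite /Rintegral fineK//; exact: integrable_fin_num.
Qed.

Lemma measurable_Rfubini1 : measurable_fun setT (fun x => \int[m2]_y f (x, y)).
Proof. exact: measurableT_comp (fine_measurable measurableT) (measurable_fubini_F fi). Qed.

Lemma measurable_Rfubini2 : measurable_fun setT (fun y => \int[m1]_x f (x, y)).
Proof. exact: measurableT_comp (fine_measurable measurableT) (measurable_fubini_G fi). Qed.

Lemma integrable_Rfubini1 : m1.-integrable setT (fun x => (\int[m2]_y f (x, y))%:E).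
Proof.
apply/integrableP; split; first by apply/measurable_EFinP; exact: measurable_Rfubini1.
have [N [mN N0 HN]] := F_ae; have /integrableP[_] := integrable_fubini_F fi.
rewrite (@eq_integral_off_null _ _ _ m1 N _ (fun x => `|(\int[m2]_y f (x, y))%:E|%E) mN N0)// => x Nx.
by congr (`|_|)%E; apply: contrapT => /HN.
Qed.

Lemma integrable_Rfubini2 : m2.-integrable setT (fun y => (\int[m1]_x f (x, y))%:E).
Proof.
apply/integrableP; split; first by apply/measurable_EFinP; exact: measurable_Rfubini2.
apply: le_lt_trans ((integrable21ltyP _ _ (measurable_int _ fi)).1 fi).
have mf : measurable_fun setT (abse \o (EFin \o f)) by exact: measurableT_comp (measurable_int _ fi).
have [N [mN N0 HN]] := G_ae.
rewrite (@eq_integral_off_null _ _ _ m2 N _ (fun y => `|fubini_G m1 (EFin \o f) y|%E) mN N0); last first.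
  by move=> y Ny; congr (`|_|)%E; apply: contrapT => h; apply/Ny/HN => /esym.
apply: ge0_le_integral => //.
- by apply: measurableT_comp => //; exact: (measurable_fubini_G fi).
- by apply: (measurable_fun_fubini_tonelli_G (abse \o (EFin \o f))) => // p; exact: abse_ge0.
- move=> y _; apply: le_abse_integral => //.
  exact: measurableT_comp (measurable_int _ fi) (pair2_measurable y).
Qed.

Lemma Rfubini1 : \int[(m1 \x m2)%E]_p f p = \int[m1]_x \int[m2]_y f (x, y).
Proof.
rewrite [LHS]/Rintegral -(integral12_prod_meas1 fi) [RHS]/Rintegral; congr fine.
have [N [mN N0 HN]] := F_ae.
by apply: (eq_integral_off_null mN N0) => x Nx; apply: contrapT => /HN.
Qed.

Lemma Rfubini2 : \int[(m1 \x m2)%E]_p f p = \int[m2]_y \int[m1]_x f (x, y).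
Proof.
rewrite [LHS]/Rintegral -(integral21_prod_meas1 fi) [RHS]/Rintegral; congr fine.
have [N [mN N0 HN]] := G_ae.
by apply: (eq_integral_off_null mN N0) => x Nx; apply: contrapT => /HN.
Qed.

End Rfubini.

(** * Integration by parts *)

Section box_ibp.
Variable R : realType.
Notation mR := (measurableTypeR R).

Lemma En_ins n i (s : R) (y : n.-tuple R) : (i <= n)%N ->
  En n.+1 (ins i s y) <->
  [/\ En n y, (0 < i)%N -> nth 0 y i.-1 <= s & (i < n)%N -> s <= nth 0 y i].
Proof.
move=> i_n; split.
  move/(sortedP 0); rewrite size_tuple => H.
  have Hi k : (k.+1 < n.+1)%N -> nth 0 (ins_seq i s y) k <= nth 0 (ins_seq i s y) k.+1 by exact: H.
  have NE k := nth_ins_seq 0 s (y := y) k; rewrite size_tuple in NE.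
  have h2 : (0 < i)%N -> nth 0 y i.-1 <= s.
    case: i i_n H Hi NE => [//|i] i_n _ Hi NE _; have := Hi i i_n.
    by rewrite !NE// ltnSn ltnn eqxx.
  have h3 : (i < n)%N -> s <= nth 0 y i.
    move=> ni; have := Hi i ni; rewrite !NE// ltnn eqxx ltnNge leqnSn /=.
    by rewrite gtn_eqF.
  split => //; apply/(sortedP 0) => k; rewrite size_tuple => kn.
  have [ki|ik] := ltnP k.+1 i.
    by have := Hi k (ltnW kn); rewrite !NE// ki (ltnW ki).
  have [kE|ki] := eqVneq k.+1 i.
    by apply: (@le_trans _ _ s); [rewrite -[k]/(k.+1.-1) kE h2// -kE|rewrite kE h3// -kE].
  have {}ik : (i < k.+1)%N by rewrite ltn_neqAle eq_sym ki.
  have := Hi k.+1 kn; rewrite !NE//.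
  have -> : (k.+1 < i)%N = false by lia.
  have -> : (k.+2 < i)%N = false by lia.
  have -> : (k.+1 == i) = false by lia.
  by have -> : (k.+2 == i) = false by lia.
move=> [/(sortedP 0) Ey h2 h3]; apply/(sortedP 0) => k; rewrite size_tuple => kn.
rewrite size_tuple in Ey.
have NE j := nth_ins_seq 0 s (y := y) j; rewrite size_tuple in NE.
rewrite /= !NE//; have [ki|ki|kE] := ltngtP k i.
- have [k1i|k1i|k1E] := ltngtP k.+1 i; [|by lia|].
    by apply: Ey; lia.
  by move: h2; rewrite -k1E; apply.
- have -> : (k.+1 < i)%N = false by lia.
  have -> : (k.+1 == i) = false by lia.
  have -> : k = k.-1.+1 by rewrite prednK//; lia.
  by apply: Ey; lia.
- rewrite kE ltnNge leqnSn /= gtn_eqF//; apply: h3; lia.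
Qed.

Lemma FTC2_is_derive (f f' : R -> R) (a b : R) :
  (forall s : R, is_derive s 1 f (f' s)) -> continuous f' -> a <= b ->
  \int[lebM R]_(s in `[a, b]%classic) f' s = f b - f a.
Proof.
move=> df cf'; rewrite le_eqVlt => /predU1P[->|ab].
  rewrite set_itv1 subrr /Rintegral integral_set1//.
have cf : continuous f.
  by move=> s; apply: differentiable_continuous; apply/derivable1_diffP; exact: ex_derive.
have h := @continuous_FTC2 _ f' f a b ab.
rewrite /Rintegral [X in fine X]h//.
- exact: continuous_subspaceT.
- split.
  + by move=> s _; exact: ex_derive.
  + by apply: cvg_at_right_filter; exact: cf.
  + by apply: cvg_at_left_filter; exact: cf.
- by move=> s _; rewrite derive1E; exact: derive_val.
Qed.

(** In coordinate [i] the section of the cone is the interval between the neighbouring values. For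
    an extreme coordinate a side is unbounded and contributes nothing, because [W] vanishes far out;
    the boolean coefficients record this. *)
Lemma box_ibp n i (W dW : n.+1.-tuple R -> R) (M : R) : (i <= n)%N ->
  (forall (y : n.-tuple R) (s : R), is_derive s 1 (fun t => W (ins i t y)) (dW (ins i s y))) ->
  (forall y, continuous (fun s => dW (ins i s y))) ->
  (forall y s, M < `|s| -> W (ins i s y) = 0 /\ dW (ins i s y) = 0) ->
  (laM R n.+1).-integrable setT (fun x => (\1_(@En R n.+1) x * dW x)%:E) ->
  \int[laM R n.+1]_x (\1_(@En R n.+1) x * dW x) =
  \int[laM R n]_y (\1_(@En R n) y * ((i < n)%:R * W (ins i (nth 0 y i) y) -
                                     (0 < i)%:R * W (ins i (nth 0 y i.-1) y))).
Proof.
move=> i_n HW cW W0 Wi.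
have e1 : \int[laM R n.+1]_x (\1_(@En R n.+1) x * dW x) =
    \int[(lebM R \x laM R n)%E]_p (\1_(@En R n.+1) (ins i p.1 p.2) * dW (ins i p.1 p.2)).
  by rewrite /Rintegral (integral_ins i_n Wi).
rewrite {}e1 Rfubini2; last exact: (integrable_ins i_n Wi).
apply: eq_Rintegral => y _ /=.
have [Ey|nEy] := pselect (En n y); last first.
  rewrite [in RHS]indicE memNset// mul0r /Rintegral integral0_eq// => s _.
  by rewrite indicE memNset ?mul0r// => /(En_ins _ _ i_n)[].
rewrite [in RHS]indicE mem_set// mul1r.
(* A finite substitute for infinity: beyond the support of [W] and [dW], and beyond the neighbours,
   so that [a <= b] in every case. *)
pose N := `|M| + (`|nth 0 y i.-1| + `|nth 0 y i|) + 1.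
pose a := if (0 < i)%N then nth 0 y i.-1 else - N.
pose b := if (i < n)%N then nth 0 y i else N.
have N0 : 0 <= N by rewrite !addr_ge0.
have MN : M < `|N|.
  rewrite ger0_norm//; apply: le_lt_trans (ler_norm _) _.
  have := normr_ge0 (nth 0 y i.-1); have := normr_ge0 (nth 0 y i); rewrite /N; lra.
have y1N : - N <= nth 0 y i.-1 <= N.
  by rewrite -ler_norml /N; have := normr_ge0 M; have := normr_ge0 (nth 0 y i); lra.
have y2N : - N <= nth 0 y i <= N.
  by rewrite -ler_norml /N; have := normr_ge0 M; have := normr_ge0 (nth 0 y i.-1); lra.
have ab : a <= b.
  rewrite /a /b; case: ifP => i0; case: ifP => ni.
  - move/(sortedP 0) : Ey => /(_ i.-1); rewrite size_tuple prednK//; exact.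
  - by case/andP: y1N.
  - by case/andP: y2N.
  - by lra.
transitivity (\int[lebM R]_(s in `[a, b]%classic) dW (ins i s y)).
  rewrite [RHS]Rintegral_mkcond; apply: eq_Rintegral => s _; rewrite patchE.
  have -> : (s \in `[a, b]%classic) = (a <= s <= b) by rewrite mem_setE in_itv.
  have [sN|sN] := leP `|s| N; last first.
    have [|_ ->] := W0 y s; last by rewrite mulr0 if_same.
    by move: MN; rewrite (ger0_norm N0) => /lt_trans; exact.
  move: sN; rewrite ler_norml => /andP[sN1 sN2].
  rewrite indicE; have -> : (ins i s y \in En n.+1) = (a <= s <= b).
    apply/idP/idP => [/set_mem /(En_ins _ _ i_n) [_ h2 h3]|/andP[h2 h3]].
      by rewrite /a /b; apply/andP; split; case: ifP.
    apply/mem_set/(En_ins _ _ i_n); split => // ii; move: h2 h3; rewrite /a /b ii//.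
  by case: ifP; rewrite ?mul1r ?mul0r.
rewrite (FTC2_is_derive (f := fun s => W (ins i s y)))//; congr (_ - _).
  rewrite /b; case: ifP; rewrite ?mul1r ?mul0r// => _.
  by have [] := W0 y N MN.
rewrite /a; case: ifP; rewrite ?mul1r ?mul0r// => _.
by have [|->] := W0 y (- N); rewrite ?normrN.
Qed.

End box_ibp.

Section xi_ibp.
Variables (R : realType) (xi : bddDup R).
Notation mR := (measurableTypeR R).

Lemma leb01_sigma_finite : sigma_finite setT (leb01 R).
Proof. by exists (fun=> setT); [rewrite bigcup_const|move=> i; split => //; exact: leb01_lty]. Qed.

Definition leb01M : {sigma_finite_measure set mR -> \bar R} := sigma_finite_pack leb01_sigma_finite.

Lemma ext01_measurable : measurable_fun setT (ext01 xi : mR -> R).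
Proof. by apply: nondecreasing_measurable => //; exact: ext01_nd. Qed.

Lemma ext01_bounded : exists2 M, 0 <= M & forall t, `|ext01 xi t| <= M.
Proof.
have [M HM] := bddDup_bounded xi.
have H (t : R) : `|ext01 xi t| <= M.
  have t01 : Num.max 0 (Num.min t 1) \in `[0, 1].
    by rewrite in_itv/= le_max lexx/= ge_max ler01/= ge_min lexx orbT.
  have := HM _ t01; rewrite /ext01; case: (bddDup_fun xi _) => [r|//|//] /=; by rewrite lee_fin.
by exists M => //; apply: le_trans (H 0).
Qed.

(** The kernel is the integral of [G - m] over [a, r[. Exchanging the integrals leaves, for each
    [t], the increment xi(b) - xi(t), and the part with xi(b) drops out because [G - m] has mean
    zero on [a, b[. *)
Lemma xi_ibp (a b m : R) (G : L2 R) : 0 <= a -> a < b -> b <= 1 ->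
  m = (b - a)^-1 * dot G (itvL2 a b) ->
  \int[xiM xi]_r (\1_`]a, b[%classic r * (dot G (itvL2 a r) - (r - a) * m)) =
  - \int[leb01 R]_(t in `[a, b[%classic) ((G t - m) * ext01 xi t).
Proof.
move=> a0 ab b1 mE.
pose I : set mR := `[a, b[%classic; pose J : set mR := `]a, b]%classic.
have mI : measurable I by exact: measurable_itv.
have mJ : measurable J by exact: measurable_itv.
pose k (t : mR) : R := \1_I t * (G t - m).
have mk : measurable_fun setT k.
  apply: measurable_funM; first exact: measurable_indic.
  by apply: measurable_funB => //; exact: L2fun_measurable.
have ik : (leb01 R).-integrable setT (EFin \o k).
  have h : (leb01 R).-integrable setT (EFin \o (fun t => G t - m)).
    apply: integrableRB => //; first exact: (integrable_L2 (leb01_lty measurableT)).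
    by apply: (@bounded_integrable _ _ _ _ _ _ `|m|) => //; exact: leb01_lty.
  apply: le_integrable h => //; first exact/measurable_EFinP.
  move=> t _; rewrite lee_fin /k normrM ler_piMl// indicE.
  by case: (_ \in _); rewrite ?normr1 ?normr0.
have k_itv (r : R) : r \in `[a, b] -> \int[leb01 R]_t (\1_`]-oo, r[%classic t * k t) = dot G (itvL2 a r) - (r - a) * m.
  rewrite in_itv/= => /andP[ar rb].
  pose A : set mR := `[a, r[%classic; have mA : measurable A by exact: measurable_itv.
  have iA h : (leb01 R).-integrable setT (EFin \o h) -> (leb01 R).-integrable A (EFin \o h).
    by move=> hi; apply: integrableS hi.
  transitivity (\int[leb01 R]_(t in A) (G t - m)).
    rewrite [RHS]Rintegral_mkcond; apply: eq_Rintegral => t _.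
    rewrite patchE /k !indicE !mem_setE !in_itv/=.
    have [ta|ta] := leP a t; rewrite /= ?mul0r ?mulr0//.
    have [tr|tr] := ltP t r; rewrite /= ?mul0r ?mulr0//.
    by rewrite (lt_le_trans tr rb) !mul1r.
  rewrite RintegralB//; last 2 first.
  - by apply: iA; exact: (integrable_L2 (leb01_lty measurableT)).
  - by apply: iA; apply: (@bounded_integrable _ _ _ _ _ _ `|m|) => //; exact: leb01_lty.
  rewrite Rintegral_cst// (leb01_itv a0 ar (le_trans rb b1))/= mulrC; congr (_ - _).
  rewrite -(dot_indicL2 (leb01_lty measurableT) G mA).
  by congr (dot G (indicL2 _ _)); exact: Prop_irrelevance.
pose f (p : mR * mR) : R := \1_J p.1 * ((if p.2 < p.1 then 1 else 0) * k p.2).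
have mlt : measurable_fun setT (fun p : mR * mR => (if p.2 < p.1 then 1 else 0) : R).
  pose S : set (mR * mR) := [set p | (p.2 : R) < p.1].
  have mS : measurable S.
    have md : measurable_fun setT (fun p : mR * mR => (p.1 : R) - p.2) by apply: measurable_funB.
    have := md measurableT _ (measurable_itv `]0, +oo[); rewrite setTI.
    by congr measurable; apply/seteqP; split => p /=; rewrite in_itv/= andbT subr_gt0.
  rewrite (_ : (fun p => _) = (\1_S : mR * mR -> R)); first exact: measurable_indic.
  apply/funext => p; rewrite indicE; case: ifPn => h; first by rewrite mem_set.
  by rewrite memNset// => /(negP h).
have mf : measurable_fun setT f.
  apply: measurable_funM; first exact: measurableT_comp (measurable_indic mJ) measurable_fst.
  by apply: measurable_funM => //; exact: measurableT_comp mk measurable_snd.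
have iltE (r t : R) : (if t < r then 1 else 0) = \1_`]-oo, r[%classic t :> R.
  by rewrite indicE mem_setE in_itv/=; case: ifP.
have if_ : (xiM xi \x leb01M)%E.-integrable setT (EFin \o f).
  apply: (prod_integrable_of_bound mf mJ (M := \int[leb01 R]_t `|k t|)).
    by have := xiM_ocitv xi (ltW ab) => ->; exact: ltry.
  move=> r; rewrite indicE; have [rJ|rJ] := boolP (r \in J); last first.
    by rewrite mulr0 integral0_eq// => t _; rewrite /f /= indicE (negbTE rJ) mul0r normr0.
  rewrite mulr1 /Rintegral fineK; last exact: integrable_fin_num (integrable_norm ik).
  apply: ge0_le_integral => //.
  - apply/measurable_EFinP/measurableT_comp => //.
    exact: measurableT_comp mf (pair1_measurable r).
  - by apply/measurable_EFinP/measurableT_comp.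
  move=> t _; rewrite lee_fin /f /= indicE rJ mul1r.
  by case: ifP => _; rewrite ?mul1r// mul0r normr0.
have lE (h : mR -> R) : \int[leb01M]_t h t = \int[leb01 R]_t h t by [].
(* The kernel vanishes at [r = b], so []a, b[] may be exchanged with [J] even if d xi has an atom at
   [b]. *)
have bE : dot G (itvL2 a b) - (b - a) * m = 0.
  by rewrite mE mulrA mulfV ?mul1r ?subrr// gt_eqF// subr_gt0.
transitivity (\int[xiM xi]_r \int[leb01M]_t f (r, t)).
  apply: eq_Rintegral => r _; rewrite /f /= lE.
  rewrite [in RHS]indicE; have [rJ|rJ] := boolP (r \in J); last first.
    rewrite [RHS](_ : _ = 0); last first.
      by rewrite /Rintegral integral0_eq// => t _; rewrite mul0r.
    rewrite indicE memNset ?mul0r// => /=; rewrite in_itv/= => /andP[ar rb].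
    by move/negP : rJ; apply; rewrite mem_setE in_itv/= ar ltW.
  move: rJ; rewrite mem_setE in_itv/= => /andP[ar rb].
  transitivity (\int[leb01 R]_t (\1_`]-oo, r[%classic t * k t)); last first.
    by apply: eq_Rintegral => t _; rewrite mul1r iltE.
  rewrite k_itv ?in_itv/= ?rb ?ltW// indicE mem_setE in_itv/= ar.
  move: rb; rewrite le_eqVlt => /predU1P[->|->]; rewrite ?mul1r//.
  by rewrite bE mulr0.
rewrite -Rfubini1// Rfubini2//.
transitivity (\int[leb01 R]_t (ext01 xi b * k t - k t * ext01 xi t)).
  apply: eq_Rintegral => t _; rewrite /f /=.
  have [tI|tI] := boolP (t \in I); last first.
    rewrite [in RHS]/k indicE (negbTE tI) mul0r mulr0 mul0r subrr.
    rewrite /Rintegral integral0_eq// => r _.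
    by rewrite /k [\1_I t]indicE (negbTE tI) mul0r !mulr0.
  move: (tI); rewrite mem_setE in_itv/= => /andP[at_ tb].
  transitivity (\int[xiM xi]_(r in `]t, b]%classic) k t).
    rewrite [RHS]Rintegral_mkcond; apply: eq_Rintegral => r _.
    rewrite patchE indicE !mem_setE !in_itv/=.
    have [tr|tr] := ltP t r; rewrite ?mul1r ?mul0r ?mulr0//= (le_lt_trans at_ tr)/=.
    by case: (r <= b); rewrite ?mul1r ?mul0r.
  have e : fine (xiM xi `]t, b]%classic) = ext01 xi b - ext01 xi t by rewrite xiM_ocitv// ltW.
  rewrite Rintegral_cst//; transitivity (k t * (ext01 xi b - ext01 xi t)); last by lra.
  by congr (_ * _); exact: e.
have ke_int : (leb01 R).-integrable setT (EFin \o (fun t => k t * ext01 xi t)).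
  have [M M0 HM] := ext01_bounded.
  have h : (leb01 R).-integrable setT (EFin \o (fun t => M * k t)) by apply: integrableRZ.
  apply: le_integrable h => //.
    by apply/measurable_EFinP; apply: measurable_funM => //; exact: ext01_measurable.
  by move=> t _; rewrite lee_fin /= !normrM (ger0_norm M0) mulrC ler_wpM2r.
rewrite RintegralB//; last by apply: integrableRZ.
rewrite RintegralZl// [X in _ * X](_ : _ = 0) ?mulr0 ?sub0r; last first.
  rewrite -bE -k_itv ?in_itv/= ?lexx ?andbT ?(ltW ab)//.
  apply: eq_Rintegral => t _; rewrite /k !indicE !mem_setE !in_itv/=.
  by case: (t < b); rewrite ?mul1r ?andbF ?mul0r.
congr (- _); rewrite [RHS]Rintegral_mkcond; apply: eq_Rintegral => t _.
by rewrite patchE /k indicE; case: ifP; rewrite ?mul1r ?mul0r.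
Qed.

End xi_ibp.

Section insertion.
Variables (R : realType).
Notation mR := (measurableTypeR R).
Implicit Types (n j k : nat) (r : R).

Lemma knot_ins n j r (p : n.-tuple R) k : (j <= n)%N ->
  knot (ins j r p) k = if (k < j.+1)%N then knot p k else if k == j.+1 then r else knot p k.-1.
Proof.
move=> jn; rewrite /knot.
(* Position [j] among the interior knots is position [j.+1] in the full list, which starts with the
   knot 0. *)
have -> : 0 :: rcons (ins j r p) 1 = ins_seq j.+1 r (0 :: rcons p 1).
  rewrite /ins /= /ins_seq /= rcons_cat /=; congr (0 :: _ ++ r :: _).
    by rewrite -cats1 takel_cat// size_tuple.
  by rewrite -!cats1 drop_cat size_tuple; case: ltngtP jn => // -> _; rewrite subnn drop0 drop_oversize ?size_tuple.
by rewrite nth_ins_seq//= size_rcons size_tuple; lia.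
Qed.

Lemma ins_surj n j (q : n.+1.-tuple R) : (j <= n)%N -> exists r p, q = ins j r p.
Proof.
move=> jn; have sz : size (take j q ++ drop j.+1 q) == n.
  by rewrite size_cat size_take_min size_drop size_tuple; lia.
exists (nth 0 q j), (Tuple sz); apply: val_inj; rewrite /= /ins_seq.
have st : size (take j q) = j by rewrite size_take_min size_tuple; lia.
rewrite take_cat drop_cat st ltnn subnn take0 drop0 cats0.
by rewrite -drop_nth ?cat_take_drop// size_tuple.
Qed.

Lemma gap_ins_lt n j r (p : n.-tuple R) k : (j <= n)%N -> (k < j)%N ->
  gap (ins j r p) k = gap p k.
Proof. by move=> jn kj; rewrite /gap !knot_ins// ltnS kj ltnW// ltnS ltnW. Qed.

Lemma gap_ins_l n j r (p : n.-tuple R) : (j <= n)%N -> gap (ins j r p) j = r - knot p j.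
Proof. by move=> jn; rewrite /gap !knot_ins// ltnS ltnn eqxx ltnS leqnn. Qed.

Lemma gap_ins_r n j r (p : n.-tuple R) : (j <= n)%N -> gap (ins j r p) j.+1 = knot p j.+1 - r.
Proof.
move=> jn; rewrite /gap !knot_ins// ltnn eqxx.
have -> : (j.+2 < j.+1)%N = false by lia.
by have -> : (j.+2 == j.+1) = false by lia.
Qed.

Lemma gap_ins_gt n j r (p : n.-tuple R) k : (j <= n)%N -> (j < k)%N ->
  gap (ins j r p) k.+1 = gap p k.
Proof.
move=> jn kj; rewrite /gap !knot_ins//.
have -> : (k.+2 < j.+1)%N = false by lia.
have -> : (k.+1 < j.+1)%N = false by lia.
have -> : (k.+1 == j.+1) = false by lia.
by have -> : (k.+2 == j.+1) = false by lia.
Qed.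

Lemma Qn_ins n j r (p : n.-tuple R) : (j <= n)%N ->
  Qn n.+1 (ins j r p) <-> Qn n p /\ knot p j < r < knot p j.+1.
Proof.
move=> jn; split => [/Qn_gapP Q|[/Qn_gapP P /andP[pr rp]]].
  have h1 : knot p j < r by rewrite -subr_gt0 -gap_ins_l//; apply: Q; lia.
  have h2 : r < knot p j.+1 by rewrite -subr_gt0 -gap_ins_r//; apply: Q.
  split; last by rewrite h1.
  apply/Qn_gapP => i ni; have [ij|ji|->] := ltngtP i j.
  - by rewrite -(gap_ins_lt r p jn ij); apply: Q; lia.
  - by rewrite -(gap_ins_gt r p jn ji); apply: Q; lia.
  - by rewrite /gap subr_gt0 (lt_trans h1).
apply/Qn_gapP => i ni; have [ij|ji|->] := ltngtP i j.
- by rewrite gap_ins_lt//; apply: P; lia.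
- have [->|ij] := eqVneq i j.+1; first by rewrite gap_ins_r// subr_gt0.
  have iE : i = i.-1.+1 by lia.
  by rewrite iE gap_ins_gt//; [apply: P; lia|lia].
- by rewrite gap_ins_l// subr_gt0.
Qed.

(** All other gaps are unchanged, while the new knot replaces one gap by two. The form without
    division holds wherever [r] lies. *)
Lemma wgt_ins n j r (p : n.-tuple R) : (j <= n)%N ->
  wgt (ins j r p) * gap p j = wgt p * ((r - knot p j) * (knot p j.+1 - r)).
Proof.
move=> jn; rewrite /wgt -!(big_mkord xpredT (fun i => gap _ i)).
rewrite (@big_cat_nat _ _ _ j)//=; last by lia.
rewrite [X in _ * X * _](@big_cat_nat _ _ _ j.+2)//=; last by lia.
rewrite [X in _ = X * _](@big_cat_nat _ _ _ j)//=; last by lia.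
rewrite [X in _ = _ * X * _]big_ltn//.
rewrite [X in _ * (X * _) * _]big_ltn// big_nat1 gap_ins_l// gap_ins_r//.
rewrite (eq_big_nat _ _ (F2 := fun i => gap p i)); last by move=> i /andP[_ ij]; exact: gap_ins_lt.
rewrite [X in _ * (_ * X) * _]big_add1/=.
have -> : \prod_(j.+1 <= i < n.+1) gap (ins j r p) i.+1 = \prod_(j.+1 <= i < n.+1) gap p i.
  by apply: eq_big_nat => i /andP[ji _]; exact: gap_ins_gt.
set A := \prod_(_ <= _ < _) _; set B := \prod_(_ <= _ < _) _; lra.
Qed.

Lemma stepL2_ins_l n j r (p : n.-tuple R) : (j <= n)%N ->
  stepL2 (ins j r p) j = itvL2 (knot p j) r.
Proof. by move=> jn; rewrite /stepL2 !knot_ins// ltnSn ltnn eqxx. Qed.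

Lemma itvL2_cat (a b c : R) : a <= b -> b <= c -> itvL2 a b + itvL2 b c = itvL2 a c.
Proof.
move=> ab bc; apply: L2P.
have H := ae_imp3 _ (indicL2E (leb01_lty measurableT) (measurable_itv `[a, b[))
  (indicL2E (leb01_lty measurableT) (measurable_itv `[b, c[))
  (indicL2E (leb01_lty measurableT) (measurable_itv `[a, c[)).
apply: ae_imp2 (H _ (fun t h1 h2 h3 => conj h1 (conj h2 h3))) (L2D (itvL2 a b) (itvL2 b c)).
move=> t [h1 [h2 h3]] /(_ I) h4 _; rewrite h4 /itvL2 h1 h2 h3.
rewrite !indicE !mem_setE !in_itv/=.
have [ta|ta] := leP a t; have [tb|tb] := ltP t b; have [tc|tc] := ltP t c;
  rewrite /= ?addr0 ?add0r//; lra.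
Qed.

Lemma stepL2_ins_r n j r (p : n.-tuple R) : (j <= n)%N -> Qn n.+1 (ins j r p) ->
  stepL2 (ins j r p) j.+1 = stepL2 p j - itvL2 (knot p j) r.
Proof.
move=> jn /(Qn_ins _ _ jn)[_ /andP[/ltW pr /ltW rp]].
rewrite /stepL2 -(itvL2_cat pr rp) addrAC subrr add0r !knot_ins// ltnn eqxx.
have -> : (j.+2 < j.+1)%N = false by lia.
by have -> : (j.+2 == j.+1) = false by lia.
Qed.

(* With equal values on both sides of the inserted knot [r], the knot is invisible. *)
Lemma chi_dup n j r (p : n.-tuple R) (y : n.+1.-tuple R) : (j <= n)%N -> Qn n.+1 (ins j r p) ->
  chi (ins j r p) (ins j (nth 0 y j) y) = chi p y.
Proof.
move=> jn Q; have [P /andP[pr rp]] := (Qn_ins _ _ jn).1 Q; apply: L2P.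
apply: ae_imp3 (chi_aeE (ins j (nth 0 y j) y) Q) (chi_aeE y P) (@ae_leb01 R) => t h1 h2 h3 _.
have [i ti] : exists i : 'I_n.+2, knot (ins j r p) i <= t < knot (ins j r p) i.+1.
  by apply: knot_locate; move: h3; rewrite in_itv/= => /andP[].
rewrite (h1 i ti) (tnth_nth 0) /= nth_ins_seq ?size_tuple; last by lia.
have i_n := ltn_ord i.
have [ij|ij|ij] := ltngtP i j.
- have i1 : (i < n.+1)%N by lia.
  rewrite (h2 (Ordinal i1)) ?(tnth_nth 0)//=.
  by move: ti; rewrite !knot_ins// ltnS (ltnW ij) ltnS ij.
- have i1 : (i.-1 < n.+1)%N by lia.
  rewrite (h2 (Ordinal i1)) ?(tnth_nth 0)//=.
  move: ti; rewrite !knot_ins//.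
  have -> : (i.+1 < j.+1)%N = false by lia.
  have -> : (i.+1 == j.+1) = false by lia.
  have -> : (i < j.+1)%N = false by lia.
  have -> : i.-1.+1 = i by lia.
  case: eqP => [iE|//]; rewrite iE /= => /andP[rt ->]; rewrite andbT.
  by rewrite (le_trans (ltW pr)).
- have j1 : (j < n.+1)%N by lia.
  rewrite (h2 (Ordinal j1)) ?(tnth_nth 0)//=.
  move: ti; rewrite ij !knot_ins// ltnSn ltnn eqxx => /andP[-> tr] /=.
  exact: lt_trans tr rp.
Qed.

End insertion.

Lemma measurable_funinv d (T : measurableType d) (R : realType) (f : T -> R) :
  measurable_fun setT f -> measurable_fun setT (fun x => (f x)^-1).
Proof.
move=> mf; have mV : measurable_fun setT (fun x : R => x^-1).
  (* Reduces the inverse to a real power of the absolute value; both sides are 0 at 0. *)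
  rewrite (_ : (fun x => _) = fun x : R => x * (`|x| `^ (-1)) ^+ 2); last first.
    apply/funext => x; rewrite powR_inv1// exprVn -normrX ger0_norm ?sqr_ge0//.
    have [->|x0] := eqVneq x 0; first by rewrite invr0 mul0r.
    by rewrite expr2 invfM mulrA mulfV// mul1r.
  apply: measurable_funM => //; apply: measurable_funX.
  apply: (@measurableT_comp _ _ _ _ _ _ (@powR R ^~ (-1))) => //.
exact: measurableT_comp mV mf.
Qed.

(** * Boundary terms on the faces of a stratum *)

Section ibp.
Variables (R : realType) (xi : bddDup R).
Notation mR := (measurableTypeR R).
Variables (U V : L2 R -> R) (GU GV : L2 R -> L2 R) (HU HV : L2 R -> L2 R -> R).
Hypotheses (nU : nice U GU HU) (nV : nice V GV HV).
Variables (K C : R).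
Hypothesis K0 : 0 <= K.
Hypothesis GUK : forall g, `|GU g| <= K.
Hypothesis HUK : forall g a, `|HU g a| <= K * `|a| ^+ 2.
Hypothesis VK : forall g, `|V g| <= K.
Hypothesis GVK : forall g, `|GV g| <= K.
Hypothesis U0 : forall g, C < sqnorm g -> GU g = 0 /\ forall a, HU g a = 0.
Implicit Types (n i j : nat).

Lemma continuousF_dot (X : topologicalType) (f g : X -> L2 R) :
  continuous f -> continuous g -> continuous (fun x => dot (f x) (g x) : R).
Proof.
move=> cf cg; apply: (@continuousF_comp _ _ _ (fun x => (f x, g x)) (fun p : L2 R * L2 R => dot p.1 p.2 : R));
  last exact: dot_continuous.
exact: continuousF_pair.
Qed.

Lemma nice_fun_continuous : continuous V.
Proof. by move=> g; apply: differentiable_continuous; have [] := nice_diff nV g. Qed.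

(** Since [chi] is affine in each value, differentiating in a value means differentiating along
    [stepL2 q i]. *)
Lemma chi_ins n i (q : n.-tuple R) (s : R) (y : n.-tuple R) : (i <= n)%N ->
  chi q (ins i s y) = chi q (ins i 0 y) + s *: stepL2 q i.
Proof.
move=> i_n; have i1 : (i < n.+1)%N by [].
rewrite !chiE (bigD1 (Ordinal i1))//= [in RHS](bigD1 (Ordinal i1))//=.
have nE t (k : 'I_n.+1) : tnth (ins i t y) k = if (k < i)%N then nth 0 y k else if k == i :> nat then t else nth 0 y k.-1.
  by rewrite (tnth_nth 0) /= nth_ins_seq ?size_tuple.
rewrite !nE /= ltnn eqxx scale0r add0r addrC; congr (_ + _).
apply: eq_bigr => k ki; rewrite !nE.
by have -> : (k == i :> nat) = false by apply/negbTE.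
Qed.

(** The first factor is the partial derivative of [U] composed with [chi] in the value [i]. The
    derivative of the flux in that value is [ibp_dflux]. *)
Definition ibp_flux n (q : n.-tuple R) i (x : n.+1.-tuple R) : R :=
  dot (GU (chi q x)) (stepL2 q i) * V (chi q x).

Definition ibp_dflux n (q : n.-tuple R) i (x : n.+1.-tuple R) : R :=
  HU (chi q x) (stepL2 q i) * V (chi q x) +
  dot (GU (chi q x)) (stepL2 q i) * dot (GV (chi q x)) (stepL2 q i).

Lemma ibp_flux_derive n (q : n.-tuple R) i (y : n.-tuple R) (s : R) : (i <= n)%N ->
  is_derive s 1 (fun t => ibp_flux q i (ins i t y)) (ibp_dflux q i (ins i s y)).
Proof.
move=> i_n; set e := stepL2 q i; set g := chi q (ins i 0 y).
have -> : (fun t => ibp_flux q i (ins i t y)) =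
    (fun t => dot (GU (g + t *: e)) e) * (fun t => V (g + t *: e)).
  by apply/funext => t; rewrite /ibp_flux chi_ins.
have d1 := nice_derive nU (g + s *: e) e.
have d1' := line_is_derive (@ex_derive _ _ _ _ _ _ _ d1).
have d2 := is_diff_derive e (nice_diff nV (g + s *: e)).
have d2' := line_is_derive (@ex_derive _ _ _ _ _ _ _ d2).
apply: is_derive_eq (is_deriveM d1' d2') _.
rewrite (@derive_val _ _ _ _ _ _ _ d1) (@derive_val _ _ _ _ _ _ _ d2).
rewrite /ibp_dflux chi_ins// -/e -/g [RHS]addrC (mulrC (HU _ _)).
by [].
Qed.

Lemma ibp_dflux_continuous_line n (q : n.-tuple R) i (y : n.-tuple R) : (i <= n)%N ->
  continuous (fun s => ibp_dflux q i (ins i s y)).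
Proof.
move=> i_n; set e := stepL2 q i; set g := chi q (ins i 0 y).
have cl : continuous (fun s : R => g + s *: e).
  apply: continuousFD; first exact: cst_continuous.
  by apply: continuousFZ; [move=> s; exact: cvg_id|exact: cst_continuous].
have -> : (fun s => ibp_dflux q i (ins i s y)) = (fun s => HU (g + s *: e) e * V (g + s *: e) +
    dot (GU (g + s *: e)) e * dot (GV (g + s *: e)) e).
  by apply/funext => s; rewrite /ibp_dflux chi_ins.
have ce : continuous (fun _ : R => e) by exact: cst_continuous.
apply: continuousFD; apply: continuousFM.
- apply: (@continuousF_comp _ _ _ (fun s : R => (g + s *: e, e)) (fun p : L2 R * L2 R => HU p.1 p.2));
    last exact: nice_continuous2 nU.
  exact: continuousF_pair.
- exact: (continuousF_comp cl nice_fun_continuous).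
- apply: continuousF_dot ce; exact: (continuousF_comp cl (nice_continuous nU)).
- apply: continuousF_dot ce; exact: (continuousF_comp cl (nice_continuous nV)).
Qed.

Lemma stepL2_pair_continuous n i :
  continuous (fun p : 'rV[R]_n * 'rV[R]_n.+1 => stepL2 (tup p.1) i).
Proof. exact: (continuousF_comp (@continuousF_fst _ _) (@stepL2_continuous R n i)). Qed.

Lemma continuous_chi_comp n (X : topologicalType) (F : L2 R -> X) : continuous F ->
  continuous (fun p : 'rV[R]_n * 'rV[R]_n.+1 => F (chi (tup p.1) (tup p.2))).
Proof. by move=> cF; exact: (continuousF_comp (@chi_continuous R n) cF). Qed.

Lemma measurable_of_rv n m (f : n.-tuple R * m.-tuple R -> R) :
  continuous (fun p : 'rV[R]_n * 'rV[R]_m => f (tup p.1, tup p.2)) ->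
  measurable_fun setT (f : n.-tuple mR * m.-tuple mR -> R).
Proof.
move/continuous_tuple_measurable; congr measurable_fun.
by apply/funext => -[q x]; rewrite !rvK.
Qed.

Lemma nice_H_pair_continuous n i :
  continuous (fun p : 'rV[R]_n * 'rV[R]_n.+1 => HU (chi (tup p.1) (tup p.2)) (stepL2 (tup p.1) i)).
Proof.
apply: (@continuousF_comp _ _ _ (fun p : 'rV[R]_n * 'rV[R]_n.+1 =>
  (chi (tup p.1) (tup p.2), stepL2 (tup p.1) i)) (fun p : L2 R * L2 R => HU p.1 p.2));
  last exact: nice_continuous2 nU.
by apply: continuousF_pair; [exact: chi_continuous|exact: stepL2_pair_continuous].
Qed.

Lemma ibp_flux_measurable n i :
  measurable_fun setT (fun p : n.-tuple mR * n.+1.-tuple mR => ibp_flux p.1 i p.2 : R).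
Proof.
apply: (@measurable_of_rv _ _ (fun p => ibp_flux p.1 i p.2)); apply: continuousFM.
  by apply: continuousF_dot (@stepL2_pair_continuous n i); apply: continuous_chi_comp; exact: nice_continuous nU.
by apply: continuous_chi_comp; exact: nice_fun_continuous.
Qed.

Lemma ibp_dflux_measurable n i :
  measurable_fun setT (fun p : n.-tuple mR * n.+1.-tuple mR => ibp_dflux p.1 i p.2 : R).
Proof.
apply: (@measurable_of_rv _ _ (fun p => ibp_dflux p.1 i p.2)); apply: continuousFD; apply: continuousFM.
- exact: nice_H_pair_continuous.
- by apply: continuous_chi_comp; exact: nice_fun_continuous.
- by apply: continuousF_dot (@stepL2_pair_continuous n i); apply: continuous_chi_comp; exact: nice_continuous nU.
- by apply: continuousF_dot (@stepL2_pair_continuous n i); apply: continuous_chi_comp; exact: nice_continuous nV.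
Qed.

Lemma gap_le1 n (q : n.-tuple R) i : Qn n q -> (i <= n)%N -> gap q i <= 1.
Proof.
move=> Q i_n; have h1 : knot q i.+1 <= 1 by exact: knot_le1.
have h0 : 0 <= knot q i by apply: knot_ge0 => //; exact: leqW.
by rewrite /gap; lra.
Qed.

Lemma norm_stepL2_le1 n (q : n.-tuple R) i : Qn n q -> (i <= n)%N -> `|stepL2 q i| <= 1.
Proof.
by move=> Q i_n; rewrite -(@expr_le1 _ 2)// norm_stepL2// gap_le1.
Qed.

Lemma ibp_flux_bound n (q : n.-tuple R) i x : Qn n q -> (i <= n)%N -> `|ibp_flux q i x| <= K * K.
Proof.
move=> Q i_n; rewrite /ibp_flux normrM ler_pM//.
apply: le_trans (cauchy_schwarz _ _) _; rewrite -[leRHS]mulr1.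
by apply: ler_pM => //; exact: norm_stepL2_le1.
Qed.

(** Both terms are quadratic in the step, whose squared norm is the gap; this cancels the inverse
    gap in [ibp_sum]. The flux is only linear in the step, so the faces need another argument. *)
Lemma ibp_dflux_bound n (q : n.-tuple R) i x : Qn n q -> (i <= n)%N ->
  `|ibp_dflux q i x| <= 2 * K * K * gap q i.
Proof.
move=> Q i_n; rewrite /ibp_dflux; apply: le_trans (ler_normD _ _) _.
rewrite !normrM -norm_stepL2//; set e := stepL2 q i; set g := chi q x.
have h1 : `|HU g e| * `|V g| <= K * `|e| ^+ 2 * K by apply: ler_pM.
have h2 : `|dot (GU g) e| <= K * `|e|.
  by apply: le_trans (cauchy_schwarz _ _) _; exact: ler_wpM2r.
have h3 : `|dot (GV g) e| <= K * `|e|.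
  by apply: le_trans (cauchy_schwarz _ _) _; exact: ler_wpM2r.
have h4 := ler_pM (normr_ge0 _) (normr_ge0 _) h2 h3.
by rewrite expr2 in h1 *; lra.
Qed.

Lemma ibp_vanish n (q : n.-tuple R) i x : C < sqnorm (chi q x) -> ibp_flux q i x = 0 /\ ibp_dflux q i x = 0.
Proof.
move=> /U0[G0 H0]; rewrite /ibp_flux /ibp_dflux G0 H0 dot0l !mul0r; split => //; lra.
Qed.

(** The single value [s] already contributes gap * s^2 to the squared norm; the added 1 ensures s^2
    >= |s|. *)
Lemma ibp_vanish_line n (q : n.-tuple R) i (y : n.-tuple R) (s : R) : Qn n q -> (i <= n)%N ->
  `|C| / gap q i + 1 < `|s| -> ibp_flux q i (ins i s y) = 0 /\ ibp_dflux q i (ins i s y) = 0.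
Proof.
move=> Q i_n hs; apply: ibp_vanish; rewrite /sqnorm norm_chi//.
have i1 : (i < n.+1)%N by [].
have g0 := gap_gt0 (Ordinal i1) Q.
apply: (@lt_le_trans _ _ (gap q i * s ^+ 2)); last first.
  rewrite (bigD1 (Ordinal i1))//= (tnth_nth 0) /= nth_ins_seq ?size_tuple// ltnn eqxx lerDl.
  by apply: sumr_ge0 => k _; rewrite mulr_ge0 ?sqr_ge0// ltW// gap_gt0.
have s1 : 1 <= `|s|.
  by apply: le_trans (ltW hs); rewrite lerDr divr_ge0// ltW.
rewrite -[s ^+ 2]ger0_norm ?sqr_ge0// normrX.
apply: (@lt_le_trans _ _ (gap q i * `|s|)); last first.
  by rewrite ler_pM2l// expr2 ler_peMl.
apply: (@le_lt_trans _ _ (gap q i * (`|C| / gap q i))).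
  by rewrite mulrC divfK ?gt_eqF// ler_norm.
rewrite ltr_pM2l//; apply: le_lt_trans hs; lra.
Qed.

(** At a step function in [core] this is [L0 U * V] plus the product of the two projected
    gradients. *)
Definition ibp_sum n (p : n.-tuple R * n.+1.-tuple R) : R :=
  \sum_(i < n.+1) (gap p.1 i)^-1 * ibp_dflux p.1 i p.2.

(* The contribution of the face [x_j = x_(j+1)], parametrized by merging the two
   equal values. *)
Definition ibp_jump n (p : n.+1.-tuple R * n.+1.-tuple R) j : R :=
  (gap p.1 j)^-1 * ibp_flux p.1 j (ins j (nth 0 p.2 j) p.2) -
  (gap p.1 j.+1)^-1 * ibp_flux p.1 j.+1 (ins j (nth 0 p.2 j) p.2).

Lemma measurable_indic_En n : measurable_fun setT (@indic (n.-tuple mR) R (En n)).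
Proof. by apply: measurable_indic; exact: measurable_En. Qed.

Lemma measurable_indic_Qn n : measurable_fun setT (@indic (n.-tuple mR) R (Qn n)).
Proof. by apply: measurable_indic; exact: measurable_Qn. Qed.

Lemma norm_indic_le1 (T : Type) (A : set T) (t : T) (a : R) : `|\1_A t * a| <= `|a|.
Proof. by rewrite normrM ler_piMl// indicE ger0_norm// lern1 leq_b1. Qed.

Lemma ibp_dflux_integrable n (q : n.-tuple R) i : Qn n q -> (i <= n)%N ->
  (laM R n.+1).-integrable setT (fun x => (\1_(@En R n.+1) x * ibp_dflux q i x)%:E).
Proof.
move=> Q i_n; apply: (@slab_integrable R n q C (2 * K * K * gap q i) (fun x => \1_(@En R n.+1) x * ibp_dflux q i x) Q).
- apply: measurable_funM; first exact: measurable_indic_En.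
  exact: (measurableT_comp (@ibp_dflux_measurable n i) (pair1_measurable q)).
- by move=> x; apply: le_trans (norm_indic_le1 _ _ _) _; exact: ibp_dflux_bound.
- by move=> x /(@ibp_vanish n q i)[_ ->]; rewrite mulr0.
Qed.

Lemma inner_ibp n (q : n.-tuple R) : Qn n q ->
  \int[laM R n.+1]_x (\1_(@En R n.+1) x * ibp_sum (q, x)) =
  \sum_(i < n.+1) (gap q i)^-1 * \int[laM R n]_y (\1_(@En R n) y *
    ((i < n)%:R * ibp_flux q i (ins i (nth 0 y i) y) - (0 < i)%:R * ibp_flux q i (ins i (nth 0 y i.-1) y))).
Proof.
move=> Q; have i_n (i : 'I_n.+1) : (i <= n)%N by rewrite -ltnS.
have h (i : 'I_n.+1) := ibp_dflux_integrable Q (i_n i).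
transitivity (\int[laM R n.+1]_x (\sum_(i < n.+1) (gap q i)^-1 * (\1_(@En R n.+1) x * ibp_dflux q i x))).
  by apply: eq_Rintegral => x _; rewrite mulr_sumr; apply: eq_bigr => i _; rewrite mulrCA.
rewrite Rintegral_sum//; last by move=> i; apply: integrableRZ => //; exact: h.
apply: eq_bigr => i _; rewrite RintegralZl//; last exact: h.
congr (_ * _).
apply: (box_ibp (M := `|C| / gap q i + 1) (i_n i)) => //.
- by move=> y s; exact: ibp_flux_derive.
- by move=> y; exact: ibp_dflux_continuous_line.
- by move=> y s; exact: ibp_vanish_line.
Qed.

Lemma measurable_dup n j : (j <= n)%N ->
  measurable_fun setT (fun y : n.+1.-tuple mR => ins j (nth (0 : R) y j : mR) y).
Proof.
move=> jn; have j1 : (j < n.+1)%N by [].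
have h : measurable_fun setT (fun y : n.+1.-tuple mR => (tnth y (Ordinal j1), y)).
  by apply/measurable_fun_pairP; split; [exact: measurable_tnth|exact: measurable_id].
have := measurableT_comp (@measurable_ins _ mR n.+1 j (leqW jn)) h.
by congr measurable_fun; apply/funext => y /=; rewrite (tnth_nth (0 : R)).
Qed.

(** On the face the function has one knot fewer, so the support condition becomes a ball of the
    stratum of [p], to which the slab estimate applies. *)
Lemma ibp_flux_dup_integrable n j i (q : n.+1.-tuple R) : Qn n.+1 q -> (j <= n)%N -> (i <= n.+1)%N ->
  (laM R n.+1).-integrable setT (fun y => (\1_(@En R n.+1) y * ibp_flux q i (ins j (nth 0 y j) y))%:E).
Proof.
move=> Q jn i_n; have [r [p qE]] := ins_surj q jn.
have [P _] : Qn n p /\ knot p j < r < knot p j.+1 by apply/Qn_ins; rewrite -?qE.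
apply: (@slab_integrable R n p C (K * K) (fun y => \1_(@En R n.+1) y * ibp_flux q i (ins j (nth 0 y j) y)) P).
- apply: measurable_funM; first exact: measurable_indic_En.
  have := measurableT_comp (@ibp_flux_measurable n.+1 i) (pair1_measurable q).
  by move=> /measurableT_comp /(_ (measurable_dup jn)).
- by move=> x; apply: le_trans (norm_indic_le1 _ _ _) _; exact: ibp_flux_bound.
- move=> y; rewrite -(chi_dup (r := r) y jn) -?qE// => /(@ibp_vanish n.+1 q i)[-> _].
  by rewrite mulr0.
Qed.

(** Inserting a copy before or after its original gives the same tuple: the upper face of one value
    is the lower face of the next. *)
Lemma ins_dup n j (y : n.-tuple R) : (j < n)%N ->
  ins j.+1 (nth 0 y j) y = ins j (nth 0 y j) y.
Proof.
move=> jn; apply: val_inj; rewrite /= /ins_seq (take_nth 0) ?size_tuple//.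
by rewrite [in RHS](drop_nth 0) ?size_tuple// cat_rcons.
Qed.

(** The boundary terms come with a boolean telling whether the face exists, and integrability is
    available only when it does. *)
Lemma Rintegral_natb d (T : measurableType d) (mu : {measure set T -> \bar R}) (b : bool) (f : T -> R) :
  (b -> mu.-integrable setT (EFin \o f)) ->
  mu.-integrable setT (EFin \o (fun t => b%:R * f t)) /\
  \int[mu]_t (b%:R * f t) = b%:R * \int[mu]_t f t.
Proof.
case: b => [/(_ isT) fi|_]; first by split; [exact: integrableRZ|rewrite RintegralZl].
have e : (fun t => false%:R * f t) = cst 0 by apply/funext => t; rewrite mul0r.
rewrite e mul0r; split; first exact: integrable0.
by rewrite /Rintegral integral0.
Qed.

(** Regroups by faces: face [j] receives the upper term of the value [j] and the lower term of the
    value [j.+1]. *)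
Lemma sum_shift n (c : nat -> R) (A : nat -> nat -> R) :
  \sum_(i < n.+2) (c i * ((i < n.+1)%:R * A i i) - c i * ((0 < i)%:R * A i.-1 i)) =
  \sum_(j < n.+1) (c j * A j j - c j.+1 * A j j.+1).
Proof.
rewrite sumrB big_ord_recr/= ltnn mul0r mulr0 addr0.
rewrite [X in _ - X]big_ord_recl/= mul0r mulr0 add0r -sumrB.
by apply: eq_bigr => j _; rewrite ltn_ord !mul1r.
Qed.

Lemma inner_ibpS n (q : n.+1.-tuple R) : Qn n.+1 q ->
  \int[laM R n.+2]_x (\1_(@En R n.+2) x * ibp_sum (q, x)) =
  \sum_(j < n.+1) \int[laM R n.+1]_y (\1_(@En R n.+1) y * ibp_jump (q, y) j).
Proof.
move=> Q; rewrite inner_ibp//.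
have int_ j i : (j <= n)%N -> (i <= n.+1)%N -> _ := fun a b => ibp_flux_dup_integrable Q a b.
pose A j i := \int[laM R n.+1]_y (\1_(@En R n.+1) y * ibp_flux q i (ins j (nth 0 y j) y)).
transitivity (\sum_(i < n.+2) ((gap q i)^-1 * ((i < n.+1)%:R * A i i) -
                               (gap q i)^-1 * ((0 < i)%:R * A i.-1 i))).
  apply: eq_bigr => i _; rewrite -mulrBr; congr (_ * _).
  have i2 : (i <= n.+1)%N by rewrite -ltnS.
  have [ii1 e1] := @Rintegral_natb _ _ (laM R n.+1) (i < n.+1)%N
    (fun y => \1_(@En R n.+1) y * ibp_flux q i (ins i (nth 0 y i) y)) (fun h => int_ i i h i2).
  have h0 : (0 < i)%N -> (i.-1 <= n)%N by move=> i0; lia.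
  have [ii2 e2] := @Rintegral_natb _ _ (laM R n.+1) (0 < i)%N
    (fun y => \1_(@En R n.+1) y * ibp_flux q i (ins i.-1 (nth 0 y i.-1) y)) (fun h => int_ i.-1 i (h0 h) i2).
  rewrite -/(A i i) -/(A i.-1 i) in e1 e2; rewrite -e1 -e2 -RintegralB//.
  apply: eq_Rintegral => y _; case: (posnP i) => [->|i0]; first by rewrite /=; lra.
  have -> : ins i (nth 0 y i.-1) y = ins i.-1 (nth 0 y i.-1) y.
    by rewrite -ins_dup ?prednK//; lia.
  by lra.
rewrite (sum_shift n (fun i => (gap q i)^-1) A); apply: eq_bigr => j _.
have jn : (j <= n)%N by rewrite -ltnS.
rewrite /A -!RintegralZl//; [|exact: int_|by apply: int_ => //; exact: leqW].
rewrite -RintegralB//; last 2 first.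
- by apply: integrableRZ => //; apply: int_ => //; exact: leqW.
- by apply: integrableRZ => //; exact: int_.
by apply: eq_Rintegral => y _; rewrite /ibp_jump /=; lra.
Qed.

Definition ibp_mean n (p : n.-tuple R) j (G : L2 R) : R := (gap p j)^-1 * dot G (stepL2 p j).

(** Up to the length of the step, the covariance of [G] and [xi] over it. *)
Definition ibp_cov n (p : n.-tuple R) j (G : L2 R) : R :=
  \int[leb01 R]_(t in `[knot p j, knot p j.+1[%classic) ((G t - ibp_mean p j G) * ext01 xi t).

Lemma sum_ibp_cov n (p : n.-tuple R) (G : L2 R) : Qn n p ->
  \sum_(j < n.+1) ibp_cov p j G = dot (G - prj p G) (bddDup_L2 xi).
Proof.
move=> P; pose Ij j : set mR := `[knot p j, knot p j.+1[%classic.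
pose f (j : 'I_n.+1) (t : mR) : R := ((G t - ibp_mean p j G) * ext01 xi t) * \1_(Ij j) t.
have mI j : measurable (Ij j) by exact: measurable_itv.
have mf (j : 'I_n.+1) : measurable_fun setT (f j).
  apply: measurable_funM; last exact: measurable_indic.
  apply: measurable_funM; last exact: ext01_measurable.
  by apply: measurable_funB => //; exact: L2fun_measurable.
have fi (j : 'I_n.+1) : (leb01 R).-integrable setT (EFin \o f j).
  have [M M0 HM] := ext01_bounded xi.
  have h : (leb01 R).-integrable setT (EFin \o (fun t => M * (G t - ibp_mean p j G))).
    apply: integrableRZ => //; apply: integrableRB => //; first exact: (integrable_L2 (leb01_lty measurableT)).
    by apply: (@bounded_integrable _ _ _ _ _ _ `|ibp_mean p j G|) => //; exact: leb01_lty.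
  apply: le_integrable h => //; first exact/measurable_EFinP.
  move=> t _; rewrite lee_fin /f mulrC; apply: le_trans (norm_indic_le1 _ _ _) _.
  by rewrite !normrM (ger0_norm M0) mulrC ler_wpM2r.
transitivity (\int[leb01 R]_t \sum_(j < n.+1) f j t).
  rewrite Rintegral_sum//; apply: eq_bigr => j _; rewrite /ibp_cov Rintegral_mkcond.
  apply: eq_Rintegral => t _; rewrite patchE /f indicE.
  by case: ifP => _; rewrite ?mulr1 ?mulr0.
rewrite /dot; apply: ae_eq_Rintegral; [exact: measurable_sum|exact: measurable_dot|].
have H := ae_imp3 _ (L2BE G (prj p G)) (comb_ae (fun j : 'I_n.+1 => (gap p j)^-1 * dot G (stepL2 p j)) P) (to_L2E (ext01_Lfun xi)).
apply: ae_imp2 (H _ (fun t h1 h2 h3 => conj h1 (conj h2 h3))) (@ae_leb01 R).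
move=> t [h1 [h2 /(_ I) h3]] h4 _; rewrite /bddDup_L2 h3 h1.
have [i ti] : exists i : 'I_n.+1, knot p i <= t < knot p i.+1.
  by apply: knot_locate; move: h4; rewrite in_itv/= => /andP[].
rewrite /f (sum_indic_knot (fun j : 'I_n.+1 => (G t - ibp_mean p j G) * ext01 xi t) P ti).
by rewrite /prj (h2 i ti).
Qed.

Definition ibp_wjump n j (p : n.+1.-tuple R * n.+1.-tuple R) : R :=
  \1_(@Qn R n.+1) p.1 * wgt p.1 * (\1_(@En R n.+1) p.2 * ibp_jump p j).

(* The factor [wgt] vanishes as [r] reaches either end of the merged step, which
   cancels the singular factors [(gap _ _)^-1] of the jump. *)
Lemma wgt_jump n j r (p : n.-tuple R) (y : n.+1.-tuple R) : (j <= n)%N ->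
  Qn n.+1 (ins j r p) ->
  wgt (ins j r p) * ibp_jump (ins j r p, y) j =
  wgt p * (V (chi p y) * (dot (GU (chi p y)) (itvL2 (knot p j) r) -
                          (r - knot p j) * ibp_mean p j (GU (chi p y)))).
Proof.
move=> jn Q; have [P /andP[pr rp]] := (Qn_ins _ _ jn).1 Q.
rewrite /ibp_jump /ibp_flux /= chi_dup// gap_ins_l// gap_ins_r// stepL2_ins_l//.
rewrite (stepL2_ins_r jn Q) dotBr /ibp_mean.
have wE := wgt_ins r p jn.
set G := GU _; set v := V _; set X := dot G (itvL2 _ _); set Z := dot G (stepL2 _ _).
have c0 : gap p j != 0 by rewrite gt_eqF// /gap subr_gt0 (lt_trans pr).
have a0 : r - knot p j != 0 by rewrite gt_eqF// subr_gt0.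
have b0 : knot p j.+1 - r != 0 by rewrite gt_eqF// subr_gt0.
apply: (mulIf c0); rewrite mulrAC wE.
set a := r - _ in a0 wE *; set b := _ - r in b0 wE *; have cE : gap p j = a + b by rewrite /gap /a /b; lra.
(* With c = a + b, the weights give a b (X / a - (Z - X) / b) = b X - a (Z - X) = c X - a Z. *)
transitivity (wgt p * v * (b * X * (a / a) - a * (Z - X) * (b / b))); first by lra.
rewrite !mulfV//; transitivity (wgt p * v * (gap p j * X - a * Z * (gap p j / gap p j))); last by lra.
by rewrite mulfV// cE; lra.
Qed.

(** The inserted knot [r] is isolated in the last factor, which is the kernel of [xi_ibp]; the rest
    depends on [p] and [y] only. *)
Lemma ibp_wjump_ins n j r (p : n.-tuple R) (y : n.+1.-tuple R) : (j <= n)%N ->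
  ibp_wjump j (ins j r p, y) =
  \1_(@Qn R n) p * wgt p * (\1_(@En R n.+1) y * V (chi p y)) *
  (\1_`]knot p j, knot p j.+1[%classic r * (dot (GU (chi p y)) (itvL2 (knot p j) r) -
     (r - knot p j) * ibp_mean p j (GU (chi p y)))).
Proof.
move=> jn; rewrite /ibp_wjump /=.
have [Q|nQ] := pselect (Qn n.+1 (ins j r p)); last first.
  rewrite [\1_(Qn n.+1) _]indicE memNset// !mul0r.
  have [P|nP] := pselect (Qn n p); last by rewrite indicE memNset// !mul0r.
  rewrite [\1_`]_, _[%classic r]indicE memNset ?mul0r ?mulr0// => h.
  by apply: nQ; apply/(Qn_ins _ _ jn); split => //; move: h; rewrite /= in_itv.
have [P pr] := (Qn_ins _ _ jn).1 Q.
have -> : \1_(Qn n.+1) (ins j r p) = 1 :> R by rewrite indicE mem_set.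
have -> : \1_(Qn n) p = 1 :> R by rewrite indicE mem_set.
have -> : \1_`]knot p j, knot p j.+1[%classic r = 1 :> R by rewrite indicE mem_set//= in_itv.
by rewrite !mul1r mulrCA wgt_jump//; lra.
Qed.

Lemma ibp_wjump_measurable n j : (j <= n)%N ->
  measurable_fun setT (fun p : n.+1.-tuple mR * n.+1.-tuple mR => ibp_wjump j p : R).
Proof.
move=> jn; apply: measurable_funM; first apply: measurable_funM.
- exact: measurableT_comp (@measurable_indic_Qn n.+1) measurable_fst.
- exact: measurableT_comp (@measurable_wgt R n.+1) measurable_fst.
apply: measurable_funM.
  exact: measurableT_comp (@measurable_indic_En n.+1) measurable_snd.
have md : measurable_fun setT (fun p : n.+1.-tuple mR * n.+1.-tuple mR => (p.1, ins j (nth (0 : R) p.2 j : mR) p.2)).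
  apply/measurable_fun_pairP; split; first exact: measurable_fst.
  exact: measurableT_comp (measurable_dup jn) measurable_snd.
have mg i : measurable_fun setT (fun p : n.+1.-tuple mR * n.+1.-tuple mR => (gap p.1 i)^-1 : R).
  exact: measurableT_comp (measurable_funinv (@measurable_gap R n.+1 i)) measurable_fst.
apply: measurable_funB; apply: measurable_funM => //.
  exact: measurableT_comp (@ibp_flux_measurable n.+1 j) md.
exact: measurableT_comp (@ibp_flux_measurable n.+1 j.+1) md.
Qed.

Lemma ibp_mean_bound n (p : n.-tuple R) j (G : L2 R) : Qn n p -> (j <= n)%N -> `|G| <= K ->
  `|gap p j * ibp_mean p j G| <= K.
Proof.
move=> P jn GK; have j1 : (j < n.+1)%N by [].
rewrite /ibp_mean mulrA mulfV ?mul1r ?gt_eqF//; last exact: (gap_gt0 (Ordinal j1) P).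
apply: le_trans (cauchy_schwarz _ _) _; rewrite -[leRHS]mulr1.
by apply: ler_pM => //; exact: norm_stepL2_le1.
Qed.

(** In the factored form [V] contributes one [K] and each of the two terms of the kernel another;
    the slab is that of the merged subdivision [p], so the bound is uniform in the removed knot. *)
Lemma ibp_wjump_bound n j (q : n.+1.-tuple R) : (j <= n)%N ->
  (\int[laM R n.+1]_y `|ibp_wjump j (q, y)|%:E <=
   (2 * K * K * slab_bound 1 C n * @indic (n.+1.-tuple mR) R (Qn n.+1) q)%:E)%E.
Proof.
move=> jn; rewrite indicE; have [/set_mem Q|nQ] := boolP (q \in Qn n.+1); last first.
  rewrite mulr0 integral0_eq// => y _.
  by rewrite /ibp_wjump /= indicE (negbTE nQ) !mul0r normr0.
have [r [p qE]] := ins_surj q jn.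
have [P /andP[pr rp]] : Qn n p /\ knot p j < r < knot p j.+1 by apply/Qn_ins; rewrite -?qE.
have K1 : 0 <= 2 * K * K by rewrite !mulr_ge0.
rewrite mulr1; apply: (slab_integral_le P ltr01 K1).
- exact: measurableT_comp (ibp_wjump_measurable jn) (pair1_measurable q).
- move=> y; rewrite qE ibp_wjump_ins// [\1_(Qn n) p]indicE mem_set// mul1r -mulrA.
  have w0 : 0 <= wgt p by apply: prodr_ge0 => i _; apply: ltW; exact: gap_gt0.
  rewrite normrM (ger0_norm w0) mulrC ler_wpM2r// normrM.
  have h1 : `|\1_(@En R n.+1) y * V (chi p y)| <= K by apply: le_trans (norm_indic_le1 _ _ _) (VK _).
  set G := GU (chi p y); have GK : `|G| <= K := GUK _.
  have k0 : 0 <= knot p j by apply: knot_ge0 => //; exact: leqW.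
  have k1 : knot p j.+1 <= 1 by exact: knot_le1.
  have h2 : `|dot G (itvL2 (knot p j) r)| <= K.
    apply: le_trans (cauchy_schwarz _ _) _; rewrite -[leRHS]mulr1.
    apply: ler_pM => //; rewrite -(@expr_le1 _ 2)// norm_itvL2//.
    - by lra.
    - exact: ltW.
    - by lra.
  have h3 : `|(r - knot p j) * ibp_mean p j G| <= K.
    apply: le_trans (ibp_mean_bound P jn GK); rewrite !normrM; apply: ler_wpM2r => //.
    by rewrite !ger0_norm /gap; lra.
  have h4 := le_trans (norm_indic_le1 `]knot p j, knot p j.+1[%classic r
    (dot G (itvL2 (knot p j) r) - (r - knot p j) * ibp_mean p j G)) (ler_normB _ _).
  have h5 := ler_pM (normr_ge0 _) (normr_ge0 _) h1 (le_trans h4 (lerD h2 h3)).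
  by apply: le_trans h5 _; lra.
- move=> y hy; rewrite qE ibp_wjump_ins//; have [G0 _] := U0 hy.
  by rewrite /ibp_mean G0 !dot0l !mulr0 subrr !mulr0.
Qed.

Lemma ibp_wjump_integrable n j : (j <= n)%N ->
  (nuM xi n.+1 \x laM R n.+1)%E.-integrable setT (EFin \o @ibp_wjump n j).
Proof.
move=> jn; apply: (prod_integrable_of_bound (ibp_wjump_measurable jn) (@measurable_Qn R n.+1) (nuM_Qn_lty xi n.+1)).
by move=> q; exact: ibp_wjump_bound.
Qed.

Lemma xi_kernel_integrable (a b m : R) (G : L2 R) : 0 <= a -> a < b -> b <= 1 ->
  (xiM xi).-integrable setT (fun r => (\1_`]a, b[%classic r * (dot G (itvL2 a r) - (r - a) * m))%:E).
Proof.
move=> a0 ab b1; pose J : set mR := `]a, b]%classic.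
have mJ : measurable J by exact: measurable_itv.
have h : (xiM xi).-integrable setT (EFin \o (fun r : mR => (`|G| + `|m|) * \1_J r)).
  apply: integrableRZ => //; apply/integrableP; split.
    by apply/measurable_EFinP; exact: measurable_indic.
  under eq_integral do rewrite /= ger0_norm//.
  rewrite integral_indic// setIT; have := xiM_ocitv xi (ltW ab) => /= ->; exact: ltry.
apply: le_integrable h => //.
  apply/measurable_EFinP; apply: measurable_funM; first by apply: measurable_indic; exact: measurable_itv.
  apply: measurable_funB; last by apply: measurable_funM => //; exact: measurable_funB.
  apply: continuous_measurable_fun; apply: continuousF_dot; first exact: cst_continuous.
  apply: (@continuousF_comp _ _ _ (fun r : R => (a, r)) (fun p : R * R => itvL2 p.1 p.2)).
    by apply: continuousF_pair; [exact: cst_continuous|move=> r; exact: cvg_id].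
  exact: itvL2_continuous.
move=> r _; rewrite lee_fin /= indicE.
have [rI|_] := boolP (r \in _); last by rewrite mul0r normr0.
move: rI; rewrite mem_setE in_itv/= => /andP[ar rb].
rewrite indicE mem_set; last by rewrite /J /= in_itv/= ar ltW.
rewrite mul1r mulr1 [leRHS]ger0_norm ?addr_ge0//.
apply: le_trans (ler_normB _ _) _; apply: lerD.
  apply: le_trans (cauchy_schwarz _ _) _; rewrite -[leRHS]mulr1.
  apply: ler_wpM2l => //; rewrite -(@expr_le1 _ 2)// norm_itvL2//; [lra|exact: ltW|lra].
by rewrite normrM ler_piMl// ger0_norm; lra.
Qed.

Lemma ibp_xi n j (p : n.-tuple R) (G : L2 R) : (j <= n)%N -> Qn n p ->
  \int[xiM xi]_r (\1_`]knot p j, knot p j.+1[%classic r * (dot G (itvL2 (knot p j) r) -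
     (r - knot p j) * ibp_mean p j G)) = - ibp_cov p j G.
Proof.
move=> jn P; have j1 : (j < n.+1)%N by [].
apply: xi_ibp => //.
- by apply: knot_ge0 => //; exact: leqW.
- by rewrite -subr_gt0; exact: (gap_gt0 (Ordinal j1) P).
- exact: knot_le1.
Qed.

(** Fubini in (r, y): with [y] fixed, the knot is integrated first and [ibp_xi] evaluates the
    kernel. *)
Lemma ibp_wjump_section n j (p : n.-tuple R) : (j <= n)%N ->
  let Y y := - (\1_(@Qn R n) p * wgt p * (\1_(@En R n.+1) y * V (chi p y)) * ibp_cov p j (GU (chi p y))) in
  (laM R n.+1).-integrable setT (EFin \o Y) /\
  \int[xiM xi]_r \int[laM R n.+1]_y ibp_wjump j (ins j r p, y) = \int[laM R n.+1]_y Y y.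
Proof.
move=> jn Y.
pose f (z : mR * n.+1.-tuple mR) : R := ibp_wjump j (ins j z.1 p, z.2).
have mf : measurable_fun setT f.
  apply: (measurableT_comp (ibp_wjump_measurable jn)).
  apply/measurable_fun_pairP; split; last exact: measurable_snd.
  have h := measurableT_comp (@measurable_ins _ mR n j jn) (@pair2_measurable _ _ mR (n.-tuple mR) p).
  exact: measurableT_comp h measurable_fst.
pose J : set mR := `]knot p j, knot p j.+1]%classic.
have mJ : measurable J by exact: measurable_itv.
have fi : (xiM xi \x laM R n.+1)%E.-integrable setT (EFin \o f).
  (* The ordering of the knots confines [r] to [J], which has finite mass for d xi. *)
  apply: (prod_integrable_of_bound mf mJ (M := 2 * K * K * slab_bound 1 C n)).
    have [h|h] := leP (knot p j) (knot p j.+1).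
      by have := xiM_ocitv xi h => ->; exact: ltry.
    by rewrite /J set_itv_ge ?measure0// bnd_simp -leNgt ltW.
  move=> r; apply: le_trans (ibp_wjump_bound (ins j r p) jn) _.
  rewrite lee_fin; apply: ler_wpM2l.
    exact: mulr_ge0 (mulr_ge0 (mulr_ge0 (ler0n _ _) K0) K0) (slab_bound_ge0 _ _ ltr01).
  rewrite !indicE; have [/set_mem Q|//] := boolP (ins j r p \in Qn n.+1).
  have [_ /andP[pr rp]] := (Qn_ins _ _ jn).1 Q.
  by rewrite mem_set// /J /= in_itv/= pr ltW.
have YE y : \int[xiM xi]_r f (r, y) = Y y.
  rewrite /f /=; under eq_Rintegral do rewrite ibp_wjump_ins//.
  have [P|nP] := pselect (Qn n p); last first.
    rewrite /Y indicE memNset// !mul0r oppr0 /Rintegral integral0_eq// => r _.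
    by rewrite !mul0r.
  have j1 : (j < n.+1)%N by [].
  rewrite RintegralZl//; last first.
    apply: xi_kernel_integrable.
    - by apply: knot_ge0 => //; exact: leqW.
    - by rewrite -subr_gt0; exact: (gap_gt0 (Ordinal j1) P).
    - exact: knot_le1.
  by rewrite ibp_xi// mulrN.
split.
  have := integrable_Rfubini2 fi; apply: eq_integrable => // y _.
  by rewrite YE.
rewrite -(Rfubini1 fi) Rfubini2//; apply: eq_Rintegral => y _; exact: YE.
Qed.

Definition ibp_rem n (p : n.-tuple R * n.+1.-tuple R) : R :=
  V (chi p.1 p.2) * dot (GU (chi p.1 p.2) - prj p.1 (GU (chi p.1 p.2))) (bddDup_L2 xi).

Lemma ibp_sum_measurable n :
  measurable_fun setT (fun p : n.-tuple mR * n.+1.-tuple mR => ibp_sum p : R).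
Proof.
apply: measurable_sum => i; apply: measurable_funM; last exact: ibp_dflux_measurable.
exact: measurableT_comp (measurable_funinv (@measurable_gap R n i)) measurable_fst.
Qed.

Lemma ibp_sum_bound n (q : n.-tuple R) x : Qn n q -> `|ibp_sum (q, x)| <= n.+1%:R * (2 * K * K).
Proof.
move=> Q; apply: le_trans (ler_norm_sum _ _ _) _.
rewrite mulr_natl -[X in _ *+ X]card_ord -sumr_const; apply: ler_sum => i _.
have g0 := gap_gt0 i Q; rewrite normrM ger0_norm ?invr_ge0 ?(ltW g0)// mulrC.
by rewrite ler_pdivrMr//; apply: ibp_dflux_bound => //; rewrite -ltnS.
Qed.

Lemma ibp_sum_vanish n (q : n.-tuple R) x : C < sqnorm (chi q x) -> ibp_sum (q, x) = 0.
Proof.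
move=> h; apply: big1 => i _.
by have [_ /= ->] := @ibp_vanish n q i x h; rewrite mulr0.
Qed.

Lemma ibp_sum_integrable n : (prodM xi n).-integrable setT (fun p => (dens p * ibp_sum p)%:E).
Proof.
apply: (@dens_integrable R xi n _ (n.+1%:R * (2 * K * K)) C).
- exact: ibp_sum_measurable.
- by move=> q x; exact: ibp_sum_bound.
- by move=> q x _; exact: ibp_sum_vanish.
- by rewrite !mulr_ge0.
Qed.

Lemma ibp_rem_measurable n :
  measurable_fun setT (fun p : n.-tuple mR * n.+1.-tuple mR => ibp_rem p : R).
Proof.
have e (p : n.-tuple mR * n.+1.-tuple mR) : ibp_rem p = V (chi p.1 p.2) *
    (dot (GU (chi p.1 p.2)) (bddDup_L2 xi) - \sum_(i < n.+1) (gap p.1 i)^-1 *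
      (dot (GU (chi p.1 p.2)) (stepL2 p.1 i) * dot (bddDup_L2 xi) (stepL2 p.1 i))).
  rewrite /ibp_rem dotBl dot_prj_sym; congr (_ * (_ - _)).
  by apply: eq_bigr => i _; rewrite mulrA.
have -> : (fun p : n.-tuple mR * n.+1.-tuple mR => ibp_rem p) = _ := funext e.
have mV : measurable_fun setT (fun p : n.-tuple mR * n.+1.-tuple mR => V (chi p.1 p.2) : R).
  apply: (@measurable_of_rv _ _ (fun p => V (chi p.1 p.2))).
  by apply: continuous_chi_comp; exact: nice_fun_continuous.
have cG : continuous (fun p : 'rV[R]_n * 'rV[R]_n.+1 => GU (chi (tup p.1) (tup p.2))).
  by apply: continuous_chi_comp; exact: nice_continuous nU.
apply: measurable_funM => //; apply: measurable_funB.
  apply: (@measurable_of_rv _ _ (fun p => dot (GU (chi p.1 p.2)) (bddDup_L2 xi))).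
  by apply: continuousF_dot cG _; exact: cst_continuous.
apply: measurable_sum => i; apply: measurable_funM.
  exact: measurableT_comp (measurable_funinv (@measurable_gap R n i)) measurable_fst.
apply: (@measurable_of_rv _ _ (fun p => dot (GU (chi p.1 p.2)) (stepL2 p.1 i) * dot (bddDup_L2 xi) (stepL2 p.1 i))).
apply: continuousFM; apply: continuousF_dot.
- exact: cG.
- exact: stepL2_pair_continuous.
- exact: cst_continuous.
- exact: stepL2_pair_continuous.
Qed.

(** The projection is bounded step by step, at the cost of a factor [n.+1] that the decay of the
    slab bounds absorbs. *)
Lemma ibp_rem_bound n (q : n.-tuple R) x : Qn n q ->
  `|ibp_rem (q, x)| <= n.+1%:R * (2 * K * K * `|bddDup_L2 xi|).
Proof.
move=> Q; rewrite /ibp_rem /= normrM; set G := GU _; set h := bddDup_L2 xi.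
have GK : `|G| <= K := GUK _.
have h1 : `|dot G h| <= K * `|h|.
  by apply: le_trans (cauchy_schwarz _ _) _; exact: ler_wpM2r.
have h2 : `|dot (prj q G) h| <= n.+1%:R * (K * `|h|).
  rewrite dot_prj_sym; apply: le_trans (ler_norm_sum _ _ _) _.
  rewrite [leRHS]mulr_natl -[X in _ *+ X]card_ord -sumr_const; apply: ler_sum => i _.
  have g0 := gap_gt0 i Q; rewrite -mulrA normrM ger0_norm ?invr_ge0 ?(ltW g0)// mulrC.
  rewrite ler_pdivrMr// -norm_stepL2//; last by rewrite -ltnS.
  rewrite normrM; set e := stepL2 q i.
  have a1 : `|dot G e| <= K * `|e|.
    by apply: le_trans (cauchy_schwarz _ _) _; exact: ler_wpM2r.
  have a2 : `|dot h e| <= `|h| * `|e| by exact: cauchy_schwarz.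
  have := ler_pM (normr_ge0 _) (normr_ge0 _) a1 a2; rewrite expr2; lra.
have h3 : `|dot (G - prj q G) h| <= n.+1%:R * (2 * K * `|h|).
  rewrite dotBl; apply: le_trans (ler_normB _ _) _; apply: le_trans (lerD h1 h2) _.
  have : K * `|h| <= n.+1%:R * (K * `|h|) by rewrite ler_peMl ?mulr_ge0// ler1n.
  lra.
have := ler_pM (normr_ge0 _) (normr_ge0 _) (VK (chi q x)) h3; lra.
Qed.

Lemma ibp_rem_vanish n (q : n.-tuple R) x : C < sqnorm (chi q x) -> ibp_rem (q, x) = 0.
Proof.
move=> /U0[G0 _]; rewrite /ibp_rem /= G0 dotBl dot_prj_sym dot0l big1 ?subrr ?mulr0// => i _.
by rewrite dot0l mulr0 mul0r.
Qed.

Lemma ibp_rem_integrable n : (prodM xi n).-integrable setT (fun p => (dens p * ibp_rem p)%:E).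
Proof.
apply: (@dens_integrable R xi n _ (n.+1%:R * (2 * K * K * `|bddDup_L2 xi|)) C).
- exact: ibp_rem_measurable.
- by move=> q x; exact: ibp_rem_bound.
- by move=> q x _; exact: ibp_rem_vanish.
- by rewrite !mulr_ge0.
Qed.

Lemma dens_ibp_sum n :
  \int[prodM xi n]_p (dens p * ibp_sum p) =
  \int[nuM xi n]_q (\1_(@Qn R n) q * (wgt q * \int[laM R n.+1]_x (\1_(@En R n.+1) x * ibp_sum (q, x)))).
Proof.
rewrite (Rfubini1 (m1 := nuM xi n) (m2 := laM R n.+1)); last exact: ibp_sum_integrable.
apply: eq_Rintegral => q _; rewrite /dens /= [in RHS]indicE.
have [Q|nQ] := pselect (Qn n q); last first.
  rewrite memNset// mul0r /Rintegral integral0_eq// => x _.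
  by rewrite indicE memNset// !mul0r.
rewrite mem_set// mul1r -RintegralZl//.
  by apply: eq_Rintegral => x _; rewrite [\1_(Qn n) q]indicE mem_set// mul1r mulrA.
have : (laM R n.+1).-integrable setT (EFin \o (fun x => \sum_(i < n.+1) (gap q i)^-1 * (\1_(@En R n.+1) x * ibp_dflux q i x))).
  apply: integrableR_sum => // i _; apply: integrableRZ => //.
  by apply: ibp_dflux_integrable => //; rewrite -ltnS.
apply: eq_integrable => // x _; congr EFin.
by rewrite [in RHS]/ibp_sum mulr_sumr; apply: eq_bigr => i _; rewrite mulrCA.
Qed.

(** With a single step the cone is the whole line and has no face. *)
Lemma ibp_zero : \int[prodM xi 0]_p (dens p * ibp_sum p) = 0.
Proof.
rewrite dens_ibp_sum /Rintegral integral0_eq// => q _.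
have [Q|nQ] := pselect (Qn 0 q); last by rewrite indicE memNset// mul0r.
rewrite -[X in wgt q * X]/(\int[laM R 1]_x (\1_(@En R 1) x * ibp_sum (q, x))).
rewrite inner_ibp// big_ord1 /= /Rintegral integral0_eq ?mulr0// => y _.
by rewrite !mul0r subrr mulr0.
Qed.

Lemma ibp_step n :
  \int[prodM xi n.+1]_p (dens p * ibp_sum p) = - \int[prodM xi n]_p (dens p * ibp_rem p).
Proof.
have jn (j : 'I_n.+1) : (j <= n)%N by rewrite -ltnS.
have Ti (j : 'I_n.+1) := ibp_wjump_integrable (jn j).
pose h (j : 'I_n.+1) (q : n.+1.-tuple mR) : R := \int[laM R n.+1]_y ibp_wjump j (q, y).
have hi (j : 'I_n.+1) : (nuM xi n.+1).-integrable setT (EFin \o h j) := integrable_Rfubini1 (Ti j).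
transitivity (\int[nuM xi n.+1]_q \sum_(j < n.+1) h j q).
  rewrite dens_ibp_sum; apply: eq_Rintegral => q _.
  have [Q|nQ] := pselect (Qn n.+1 q); last first.
    rewrite indicE memNset// mul0r big1// => j _; rewrite /h /Rintegral integral0_eq// => y _.
    by rewrite /ibp_wjump /= indicE memNset// !mul0r.
  rewrite indicE mem_set// mul1r inner_ibpS// mulr_sumr; apply: eq_bigr => j _.
  have i1 := ibp_flux_dup_integrable Q (jn j) (leqW (jn j)).
  have i2 := ibp_flux_dup_integrable Q (jn j) (jn j : (j.+1 <= n.+1)%N).
  have ij : (laM R n.+1).-integrable setT (EFin \o (fun y => \1_(@En R n.+1) y * ibp_jump (q, y) j)).
    have := integrableRB measurableT (integrableRZ measurableT (gap q j)^-1 i1) (integrableRZ measurableT (gap q j.+1)^-1 i2).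
    by apply: eq_integrable => // y _; congr EFin; rewrite /ibp_jump /=; lra.
  rewrite -(RintegralZl _ measurableT ij); apply: eq_Rintegral => y _.
  by rewrite /ibp_wjump /= [\1_(Qn n.+1) q]indicE mem_set// mul1r.
rewrite Rintegral_sum//.
(* Each face [j] splits off its own knot [r]; after this integration all faces live over the same
   [n] knots and can be summed. *)
pose X (j : 'I_n.+1) (p : n.-tuple mR) : R := \int[xiM xi]_r h j (ins j r p).
have Xi_ (j : 'I_n.+1) : (nuM xi n).-integrable setT (EFin \o X j).
  exact: (integrable_Rfubini2 (integrable_ins (jn j) (hi j))).
transitivity (\sum_(j < n.+1) \int[nuM xi n]_p X j p).
  apply: eq_bigr => j _.
  have -> : \int[nuM xi n.+1]_q h j q = \int[(xiM xi \x nuM xi n)%E]_z h j (ins j z.1 z.2).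
    by rewrite /Rintegral (integral_ins (jn j) (hi j)).
  by rewrite (Rfubini2 (integrable_ins (jn j) (hi j))).
rewrite -Rintegral_sum// (Rfubini1 (m1 := nuM xi n) (m2 := laM R n.+1)); last exact: ibp_rem_integrable.
rewrite -[RHS]mulN1r -RintegralZl//; last exact: (integrable_Rfubini1 (@ibp_rem_integrable n)).
apply: eq_Rintegral => p _.
pose Y (j : 'I_n.+1) (y : n.+1.-tuple mR) : R :=
  - (\1_(@Qn R n) p * wgt p * (\1_(@En R n.+1) y * V (chi p y)) * ibp_cov p j (GU (chi p y))).
have Yi (j : 'I_n.+1) : (laM R n.+1).-integrable setT (EFin \o Y j).
  by have [] := ibp_wjump_section p (jn j).
transitivity (\sum_(j < n.+1) \int[laM R n.+1]_y Y j y).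
  by apply: eq_bigr => j _; have [_] := ibp_wjump_section p (jn j).
rewrite -Rintegral_sum//.
have e y : dens (p, y) * ibp_rem (p, y) = -1 * \sum_(j < n.+1) Y j y.
  rewrite /Y /dens /ibp_rem /=.
  have [P|nP] := pselect (Qn n p); last first.
    by rewrite indicE memNset// !mul0r big1 ?mulr0// => j _; rewrite !mul0r oppr0.
  by rewrite -sum_ibp_cov// !mulr_sumr; apply: eq_bigr => j _; lra.
under [in RHS]eq_Rintegral do rewrite e.
have Ysum := @integrableR_sum _ _ _ (laM R n.+1) setT measurableT _ (index_enum 'I_n.+1) xpredT Y (fun (j : 'I_n.+1) _ => Yi j).
rewrite (RintegralZl _ measurableT Ysum).
by rewrite mulN1r mulN1r opprK.
Qed.

End ibp.

(** * Summation over the strata *)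

Lemma abs_summable_series (R : realType) (a : R^nat) :
  (\sum_(0 <= n <oo) `|a n|%:E < +oo)%E ->
  exists2 A, series a @ \oo --> A & (\sum_(0 <= n <oo) (a n)%:E = A%:E)%E.
Proof.
move=> afin; have cs : cvgn (series a).
  apply: normed_cvg; apply: nondecreasing_is_cvgn.
    by apply: nondecreasing_series => n _ _; exact: normr_ge0.
  exists (fine (\sum_(0 <= n <oo) `|a n|%:E)%E) => _ [n _ <-].
  have s0 : (0 <= \sum_(0 <= n <oo) `|a n|%:E)%E by apply: nneseries_ge0 => k _ _; rewrite lee_fin.
  rewrite -lee_fin fineK ?ge0_fin_numE// /series /= -sumEFin.
  by apply: nneseries_lim_ge => k _ _; rewrite lee_fin.
exists (limn (series a)) => //; apply/cvg_lim => //.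
have -> : (fun n => \sum_(0 <= k < n) (a k)%:E)%E = EFin \o series a.
  by apply/funext => n; rewrite /= /series /= sumEFin.
by apply: cvg_EFin => //; exact: nearW.
Qed.

Section Xi_integral.
Variables (R : realType) (xi : bddDup R).
Notation mR := (measurableTypeR R).

Lemma gap_sum_continuous_at n (F : 'I_n.+1 -> 'rV[R]_n * 'rV[R]_n.+1 -> R) p :
  (forall i, continuous (F i)) -> good xi (tup p.1, tup p.2) ->
  {for p, continuous (fun z => \sum_(i < n.+1) (gap (tup z.1) i)^-1 * F i z)}.
Proof.
move=> cF [/= Q _ _]; pose G i (z : 'rV[R]_n * 'rV[R]_n.+1) := (gap (tup z.1) (i : 'I_n.+1))^-1 * F i z.
have cG i : G i z @[z --> p] --> G i p.
  apply: cvgM; last exact: cF.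
  apply: cvgV; first by rewrite gt_eqF// gap_gt0.
  exact: (continuousF_comp (@continuousF_fst _ _) (@gap_continuous R n i)).
suff H s : \sum_(i <- s) G i z @[z --> p] --> \sum_(i <- s) G i p by exact: H.
elim: s => [|i s IH].
  have -> : (fun z => \sum_(i <- [::]) G i z) = cst 0 by apply/funext => z; rewrite big_nil.
  by rewrite big_nil; exact: cvg_cst.
have -> : (fun z => \sum_(j <- i :: s) G j z) = (fun z => G i z + \sum_(j <- s) G j z).
  by apply/funext => z; rewrite big_cons.
by rewrite big_cons; exact: cvgD (cG i) IH.
Qed.

(** Keeps the real series beside the value of the integral: the three integrals are compared through
    partial sums, stratum by stratum. *)
Definition Xi_integral_to (F : L2 R -> R) (f : forall n, n.-tuple R * n.+1.-tuple R -> R) (A : R) :=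
  [/\ forall n, (prodM xi n).-integrable setT (fun p => (dens p * f n p)%:E),
    series (fun n => \int[prodM xi n]_p (dens p * f n p)) @ \oo --> A &
    (\int[Xi xi]_(g in L2up_of (bddDup_L2 xi)) (F g)%:E = A%:E)%E].

Lemma Xi_integral (F : L2 R -> R) (f : forall n, n.-tuple R * n.+1.-tuple R -> R) (K C : R) :
  0 <= K ->
  (forall n (p : n.-tuple R * n.+1.-tuple R), good xi p -> F (chi p.1 p.2) = f n p) ->
  (forall n p, good xi (tup p.1, tup p.2) ->
    {for p, continuous (fun z : 'rV[R]_n * 'rV[R]_n.+1 => f n (tup z.1, tup z.2))}) ->
  (forall n, measurable_fun setT (fun p : n.-tuple mR * n.+1.-tuple mR => f n p)) ->
  (forall n q x, Qn n q -> `|f n (q, x)| <= n.+1%:R * K) ->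
  (forall n q x, Qn n q -> C < sqnorm (chi q x) -> f n (q, x) = 0) ->
  exists A, Xi_integral_to F f A.
Proof.
move=> K0 Ff cf mf fK f0.
have nK0 n : 0 <= n.+1%:R * K by rewrite mulr_ge0.
have int_ n := @dens_integrable R xi n (f n) (n.+1%:R * K) C (mf n) (@fK n) (@f0 n) (nK0 n).
have sumf : (\sum_(0 <= n <oo) \int[prodM xi n]_p `|dens p * f n p|%:E < +oo)%E.
  apply: (@slab_series_lty R xi _ K C K0) => [n|n s s0].
    by apply: integral_ge0 => p _; rewrite lee_fin.
  exact: (@dens_abs_le R xi n (f n) (n.+1%:R * K) C (mf n) (@fK n) (@f0 n) (nK0 n) s s0).
have mF : measurable_fun setT (F \_ (core xi)).
  apply: measurable_on_core => n; exists (fun z => f n (tup z.1, tup z.2)) => p gp.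
  by split; [exact: cf|exact: (Ff n _ gp)].
have e n : (\int[prodM xi n]_p (dens p * f n p)%:E = (\int[prodM xi n]_p (dens p * f n p))%:E)%E.
  by rewrite /Rintegral fineK//; exact: integrable_fin_num (int_ n).
have /abs_summable_series[A cA AE] : (\sum_(0 <= n <oo) `|\int[prodM xi n]_p (dens p * f n p)|%:E < +oo)%E.
  apply: le_lt_trans sumf; apply: lee_nneseries => n _; first by rewrite lee_fin.
  have := le_abse_integral (prodM xi n) measurableT (measurable_int _ (int_ n)).
  by rewrite e.
exists A; split => //; rewrite (integral_Xi_series mF Ff int_ sumf) -AE.
by apply: eq_eseriesr => n _; rewrite e.
Qed.

End Xi_integral.

Section conclusion.
Variables (R : realType) (xi : bddDup R).
Notation mR := (measurableTypeR R).
Notation xiL2 := (bddDup_L2 xi).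
Variables (U V : L2 R -> R) (GU GV : L2 R -> L2 R) (HU HV : L2 R -> L2 R -> R).
Hypotheses (nU : nice U GU HU) (nV : nice V GV HV).

Lemma nice_ibp :
  let I1 := (\int[Xi xi]_(g in L2up_of xiL2) (dot (Dgrad U g) (Dgrad V g))%:E)%E in
  let I2 := (\int[Xi xi]_(g in L2up_of xiL2) (L0 U g * V g)%:E)%E in
  let I3 := (\int[Xi xi]_(g in L2up_of xiL2) (V g * dot (grad U g - Dgrad U g) xiL2)%:E)%E in
  [/\ I1 \is a fin_num, I2 \is a fin_num, I3 \is a fin_num & I1 = (- I2 - I3)%E].
Proof.
have [K1 [C1 [K10 C10 _ [GUK1 HUK1] U0]]] := nice_bounded nU.
have [K2 [C2 [K20 C20 VK2 [GVK2 HVK2] V0]]] := nice_bounded nV.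
pose K := K1 + K2; have K0 : 0 <= K by rewrite addr_ge0.
have GUK g : `|GU g| <= K by apply: le_trans (GUK1 g) _; rewrite lerDl.
have HUK g a : `|HU g a| <= K * `|a| ^+ 2.
  by apply: le_trans (HUK1 g a) _; rewrite ler_wpM2r ?exprn_ge0// lerDl.
have VK g : `|V g| <= K by apply: le_trans (VK2 g) _; rewrite lerDr.
have GVK g : `|GV g| <= K by apply: le_trans (GVK2 g) _; rewrite lerDr.
(* Every integrand contains a derivative of [U], so the support radius of [U] serves all three. *)
have {}U0 g : C1 < sqnorm g -> GU g = 0 /\ forall a, HU g a = 0.
  by move=> /U0[_ g0 h0]; split.
pose f1 n (p : n.-tuple R * n.+1.-tuple R) := \sum_(i < n.+1) (gap p.1 i)^-1 *
  (dot (GU (chi p.1 p.2)) (stepL2 p.1 i) * dot (GV (chi p.1 p.2)) (stepL2 p.1 i)).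
pose f2 n (p : n.-tuple R * n.+1.-tuple R) := \sum_(i < n.+1) (gap p.1 i)^-1 *
  (HU (chi p.1 p.2) (stepL2 p.1 i) * V (chi p.1 p.2)).
pose f3 n (p : n.-tuple R * n.+1.-tuple R) := ibp_rem xi V GU p.
have c1 n (i : 'I_n.+1) : continuous (fun z : 'rV[R]_n * 'rV[R]_n.+1 =>
    dot (GU (chi (tup z.1) (tup z.2))) (stepL2 (tup z.1) i) * dot (GV (chi (tup z.1) (tup z.2))) (stepL2 (tup z.1) i)).
  apply: continuousFM; apply: continuousF_dot (@stepL2_pair_continuous R n i).
    by apply: continuous_chi_comp; exact: nice_continuous nU.
  by apply: continuous_chi_comp; exact: nice_continuous nV.
have cV n : continuous (fun z : 'rV[R]_n * 'rV[R]_n.+1 => V (chi (tup z.1) (tup z.2))).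
  by apply: continuous_chi_comp; exact: nice_fun_continuous nV.
have c2 n (i : 'I_n.+1) : continuous (fun z : 'rV[R]_n * 'rV[R]_n.+1 =>
    HU (chi (tup z.1) (tup z.2)) (stepL2 (tup z.1) i) * V (chi (tup z.1) (tup z.2))).
  exact: (continuousFM (@nice_H_pair_continuous R U GU HU nU n i) (cV n)).
have mgap n (i : 'I_n.+1) : measurable_fun setT (fun p : n.-tuple mR * n.+1.-tuple mR => (gap p.1 i)^-1 : R).
  exact: measurableT_comp (measurable_funinv (@measurable_gap R n i)) measurable_fst.
have ns n (q : n.-tuple R) (i : 'I_n.+1) : Qn n q -> `|stepL2 q i| ^+ 2 = gap q i.
  by move=> Q; rewrite norm_stepL2// -ltnS.
have sum_le n (q : n.-tuple R) (c : 'I_n.+1 -> R) : Qn n q ->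
    (forall i, `|c i| <= K * K * gap q i) ->
    `|\sum_(i < n.+1) (gap q i)^-1 * c i| <= n.+1%:R * (K * K).
  move=> Q cK; apply: le_trans (ler_norm_sum _ _ _) _.
  rewrite mulr_natl -[X in _ *+ X]card_ord -sumr_const; apply: ler_sum => i _.
  have g0 := gap_gt0 i Q; rewrite normrM ger0_norm ?invr_ge0 ?(ltW g0)// mulrC.
  by rewrite ler_pdivrMr.
have KK0 : 0 <= K * K by rewrite mulr_ge0.
have [A1 AP1] : exists A, Xi_integral_to xi (fun g => dot (Dgrad U g) (Dgrad V g)) f1 A.
  apply: (@Xi_integral R xi _ _ (K * K) C1 KK0).
  - move=> n [q x] [/= Q Ex _]; rewrite (Dgrad_chi nU Q Ex) (Dgrad_chi nV Q Ex) dot_prj_sym.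
    by apply: eq_bigr => i _; rewrite dot_prj_stepL2// mulrA.
  - by move=> n p gp; exact: gap_sum_continuous_at gp.
  - move=> n; apply: measurable_sum => i; apply: measurable_funM; first exact: mgap.
    exact: (measurable_of_rv (f := fun p => dot (GU (chi p.1 p.2)) (stepL2 p.1 i) * dot (GV (chi p.1 p.2)) (stepL2 p.1 i)) (c1 n i)).
  - move=> n q x Q; apply: sum_le => // i /=; rewrite -ns//.
    have h1 : `|dot (GU (chi q x)) (stepL2 q i)| <= K * `|stepL2 q i|.
      by apply: le_trans (cauchy_schwarz _ _) _; exact: ler_wpM2r.
    have h2 : `|dot (GV (chi q x)) (stepL2 q i)| <= K * `|stepL2 q i|.
      by apply: le_trans (cauchy_schwarz _ _) _; exact: ler_wpM2r.
    rewrite normrM; have := ler_pM (normr_ge0 _) (normr_ge0 _) h1 h2; rewrite expr2; lra.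
  - move=> n q x Q /U0[G0 _]; rewrite /f1 big1// => i _.
    by rewrite /= G0 dot0l mul0r mulr0.
have [A2 AP2] : exists A, Xi_integral_to xi (fun g => L0 U g * V g) f2 A.
  apply: (@Xi_integral R xi _ _ (K * K) C1 KK0).
  - move=> n [q x] [/= Q Ex _]; rewrite (L0_chi nU Q Ex) mulr_suml.
    by apply: eq_bigr => i _; rewrite /= mulrA.
  - by move=> n p gp; exact: gap_sum_continuous_at gp.
  - move=> n; apply: measurable_sum => i; apply: measurable_funM; first exact: mgap.
    exact: (measurable_of_rv (f := fun p => HU (chi p.1 p.2) (stepL2 p.1 i) * V (chi p.1 p.2)) (c2 n i)).
  - move=> n q x Q; apply: sum_le => // i /=; rewrite -ns// normrM.
    have := ler_pM (normr_ge0 _) (normr_ge0 _) (HUK (chi q x) (stepL2 q i)) (VK (chi q x)); lra.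
  - move=> n q x Q /U0[_ H0]; rewrite /f2 big1// => i _.
    by rewrite /= H0 mul0r mulr0.
have [A3 AP3] : exists A, Xi_integral_to xi (fun g => V g * dot (grad U g - Dgrad U g) xiL2) f3 A.
  apply: (@Xi_integral R xi _ _ (2 * K * K * `|xiL2|) C1).
  - by rewrite !mulr_ge0.
  - by move=> n [q x] [/= Q Ex _]; rewrite (Dgrad_chi nU Q Ex) (grad_nice _ nU).
  - move=> n p gp.
    have -> : (fun z : 'rV[R]_n * 'rV[R]_n.+1 => f3 n (tup z.1, tup z.2)) =
        (fun z => V (chi (tup z.1) (tup z.2)) * (dot (GU (chi (tup z.1) (tup z.2))) xiL2 -
          \sum_(i < n.+1) (gap (tup z.1) i)^-1 * (dot (GU (chi (tup z.1) (tup z.2))) (stepL2 (tup z.1) i) * dot xiL2 (stepL2 (tup z.1) i)))).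
      apply/funext => z; rewrite /f3 /ibp_rem /= dotBl dot_prj_sym; congr (_ * (_ - _)).
      by apply: eq_bigr => i _; rewrite mulrA.
    have cG : continuous (fun z : 'rV[R]_n * 'rV[R]_n.+1 => GU (chi (tup z.1) (tup z.2))).
      by apply: continuous_chi_comp; exact: nice_continuous nU.
    have cxi : continuous (fun _ : 'rV[R]_n * 'rV[R]_n.+1 => xiL2) by exact: cst_continuous.
    apply: cvgM; first exact: cV; apply: cvgB; first exact: continuousF_dot cG cxi p.
    apply: gap_sum_continuous_at gp => i; apply: continuousFM; apply: continuousF_dot (@stepL2_pair_continuous R n i) => //.
  - by move=> n; exact: ibp_rem_measurable nU nV n.
  - by move=> n q x Q; exact: (ibp_rem_bound xi K0 GUK VK).
  - by move=> n q x Q; exact: (ibp_rem_vanish xi V U0).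
move: AP1 AP2 AP3 => [int1 cA1 I1E] [int2 cA2 I2E] [_ cA3 I3E].
rewrite /= I1E I2E I3E; split => //; rewrite -EFinN -EFinB; congr EFin.
pose a n := \int[prodM xi n]_p (dens p * f1 n p).
pose b n := \int[prodM xi n]_p (dens p * f2 n p).
pose c n := \int[prodM xi n]_p (dens p * f3 n p).
have ab n : a n + b n = \int[prodM xi n]_p (dens p * ibp_sum V GU GV HU p).
  rewrite /a /b -(RintegralD measurableT (int1 n) (int2 n)); apply: eq_Rintegral => p _.
  rewrite -mulrDr /f1 /f2 /ibp_sum -big_split/=; congr (_ * _); apply: eq_bigr => i _.
  by rewrite /ibp_dflux -mulrDr addrC.
have ab0 : a 0 + b 0 = 0 by rewrite ab; exact: (ibp_zero xi nU nV K0 GUK HUK VK GVK U0).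
have abS n : a n.+1 + b n.+1 = - c n by rewrite ab; exact: (ibp_step xi nU nV K0 GUK HUK VK GVK U0).
(* The stratum without knots contributes nothing to the left, which accounts for the shift by
   one. *)
have sE n : series a n.+1 + series b n.+1 = - series c n.
  rewrite /series /= -big_split /= big_nat_recl// ab0 add0r -sumrN.
  by apply: eq_bigr => i _; exact: abS.
have : (fun n => series a n.+1 + series b n.+1) @ \oo --> A1 + A2.
  by apply: cvgD; rewrite cvg_shiftS.
have -> : (fun n => series a n.+1 + series b n.+1) = - series c by apply/funext => n; rewrite sE.
move=> cAB; have cC : - series c @ \oo --> - A3 by exact: cvgN.
have E : A1 + A2 = - A3 := cvg_unique (@norm_hausdorff _ R) cAB cC.
by rewrite -opprD -[LHS](addrK A2) E; lra.
Qed.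

End conclusion.

Section cylinder.
Variables (R : realType) (m : nat) (u : 'rV[R]_m -> R) (phi : R -> R) (h : 'I_m -> L2 R).
Hypotheses (su : Cb_smooth u) (sphi : C0_smooth phi).

(* The radial part of the gradient is a multiple of [chi q x], which the projection fixes. *)
Lemma cylf_grad_remainder n (q : n.-tuple R) (x : n.+1.-tuple R) (k : L2 R) :
  Qn n q -> En0 n.+1 x -> let g := chi q x in
  dot (grad (cylf u phi h) g - Dgrad (cylf u phi h) g) k =
  phi (`|g| ^+ 2) * \sum_(j < m) partial j u (coords h g) * dot (h j) (k - pr g k).
Proof.
move=> Q Ex g; have nU := cylf_nice h su sphi.
rewrite (grad_nice _ nU) (Dgrad_chi nU Q Ex) (pr_chi k Q Ex) -/g.
have -> a : dot (a - prj q a) k = dot a (k - prj q k).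
  rewrite dotBl dotBr [dot a (prj q k)]dotC !dot_prj_sym; congr (_ - _).
  by apply: eq_bigr => i _; rewrite mulrAC.
rewrite cyl_dotG [dot g _](_ : _ = 0) ?mulr0 ?addr0//.
rewrite dotBr [dot g (prj q k)]dotC dot_prj_sym [X in _ - X](_ : _ = dot (prj q g) k).
  by rewrite /g chi_comb (prj_comb _ Q) subrr.
by rewrite dot_prj_sym; apply: eq_bigr => i _; rewrite mulrAC.
Qed.

End cylinder.

Theorem theorem5p6 (R : realType) (xi : bddDup R) :
  (forall U V : L2 R -> R, FC (bddDup_L2 xi) U -> FC (bddDup_L2 xi) V ->
    let I1 := (\int[Xi xi]_(g in L2up_of (bddDup_L2 xi))
                 (dot (Dgrad U g) (Dgrad V g))%:E)%E in
    let I2 := (\int[Xi xi]_(g in L2up_of (bddDup_L2 xi))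
                 (L0 U g * V g)%:E)%E in
    let I3 := (\int[Xi xi]_(g in L2up_of (bddDup_L2 xi))
                 (V g * dot (grad U g - Dgrad U g) (bddDup_L2 xi))%:E)%E in
    [/\ I1 \is a fin_num, I2 \is a fin_num, I3 \is a fin_num &
        I1 = (- I2 - I3)%E]) /\
  (forall (m : nat) (u : 'rV[R]_m -> R) (phi : R -> R) (h : 'I_m -> L2 R)
      (V : L2 R -> R),
    Cb_smooth u -> C0_smooth phi ->
    (forall j, L2_of (bddDup_L2 xi) (h j)) ->
    FC (bddDup_L2 xi) V ->
    let U := cylf u phi h in
    let I1 := (\int[Xi xi]_(g in L2up_of (bddDup_L2 xi))
                 (dot (Dgrad U g) (Dgrad V g))%:E)%E in
    let I2 := (\int[Xi xi]_(g in L2up_of (bddDup_L2 xi))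
                 (L0 U g * V g)%:E)%E in
    let I3 := (\int[Xi xi]_(g in L2up_of (bddDup_L2 xi))
                 (phi (`|g| ^+ 2) * V g *
                  \sum_(j < m) partial j u (coords h g) *
                    dot (h j) (bddDup_L2 xi - pr g (bddDup_L2 xi)))%:E)%E in
    [/\ I1 \is a fin_num, I2 \is a fin_num, I3 \is a fin_num &
        I1 = (- I2 - I3)%E]).

Proof.
split => [U V /FC_nice[GU [HU nU]] /FC_nice[GV [HV nV]]|m u phi h V su sphi hxi /FC_nice[GV [HV nV]]].
  exact: nice_ibp nU nV.
have nU := cylf_nice h su sphi.
have /= := nice_ibp xi nU nV.
suff -> : (\int[Xi xi]_(g in L2up_of (bddDup_L2 xi))
    (V g * dot (grad (cylf u phi h) g - Dgrad (cylf u phi h) g) (bddDup_L2 xi))%:E =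
  \int[Xi xi]_(g in L2up_of (bddDup_L2 xi)) (phi (`|g| ^+ 2) * V g *
    \sum_(j < m) partial j u (coords h g) * dot (h j) (bddDup_L2 xi - pr g (bddDup_L2 xi)))%:E)%E by [].
(* The two integrands are compared on [core] only, where the projection is explicit. *)
apply: etrans (integral_XiE xi _) (etrans _ (esym (integral_XiE xi _))).
apply: eq_integral => g _; congr EFin; rewrite !patchE; case: ifPn => // /set_mem[n [p [[Q Ex _] ->]]].
by rewrite (cylf_grad_remainder h su sphi _ Q Ex) mulrCA mulrA.
Qed.
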